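(* Consider initial data $(u(0),\tau(0))=(u_{\mathrm{in}},\tau_{\mathrm{in}})\in H^6(\mathbb T^2)$ with $\nabla\cdot u_{\mathrm{in}}=0$ and $\int_{\mathbb T^2}u_{\mathrm{in}}\,dx=0$. Let $\varepsilon_0\in(0,1)$, depending on $\|u_{\mathrm{in}},\tau_{\mathrm{in}}\|_{H^6}$, be such that for $0<\varepsilon<\varepsilon_0$ the system $$\begin{cases}\partial_t u+u\cdot\nabla u+\nabla p=\nabla\cdot\tau,\\ \partial_t(\tau-\Delta\tau)+u\cdot\nabla\tau+Q(\tau,\nabla u)=\frac{1}{\varepsilon^2}\,(D(u)-\tau),\\ \nabla\cdot u=0\end{cases}$$ on $\mathbb T^2$ with these initial data has a unique classical solution $(u,\tau)$ (depending on $\varepsilon$) for $0\le t\le\varepsilon^{-2/3}$, satisfying $$\begin{gathered}\sup_{0\le t\le\varepsilon^{-2/3}}\Big(\|u(t),\varepsilon\tau(t),\varepsilon\nabla\tau(t)\|_{H^6}^2+\|\tau(t)-D(u)(t),\nabla(\tau(t)-D(u)(t))\|_{H^2}^2\Big)\\ +\int_0^{\varepsilon^{-2/3}}\Big(\|\tau(t)\|_{H^6}^2+\Big\|\nabla u(t),\frac{\tau(t)-D(u)(t)}{\varepsilon}\Big\|_{H^2}^2\Big)\,dt<C\end{gathered}$$ with a finite constant $C\in(0,\infty)$ depending only on the initial data (such $\varepsilon_0$ and $C$ exist). Then for arbitrary $T\in(0,\infty)$ there exists $0<\varepsilon_T\le\varepsilon_0$ such that, for $\varepsilon<\varepsilon_T$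 and $\varepsilon\to0^+$, there exists $v\in L^\infty(0,T;H^6(\mathbb T^2))$ with $$u\to v\quad\text{in } C(0,T;H^5(\mathbb T^2)),\qquad \tau\to D(v)\quad\text{in } L^2(0,T;H^2(\mathbb T^2)).$$ Moreover, $v$ satisfies the Navier-Stokes equations, i.e., with a pressure $\pi$, $$\partial_t v+v\cdot\nabla v+\nabla\pi=\nabla\cdot D(v),\qquad \nabla\cdot v=0.$$
   Context: $\mathbb T^2$ is the two-dimensional torus. The unknowns are the incompressible velocity $u$ (with values in $\mathbb R^2$), the pressure $p$ (scalar), and the stress tensor $\tau$ (with values in $\mathbb R^{2\times2}$). Conventions: $(\nabla u)_{ij}=\partial_j u_i$, $(\nabla\cdot\tau)_i=\sum_j\partial_j\tau_{ij}$. Furthermore $$D(u)=\frac{\nabla u+(\nabla u)^\top}{2},\qquad W(u)=\frac{\nabla u-(\nabla u)^\top}{2},$$ $$Q(\tau,\nabla u)=\tau W(u)-W(u)\tau+b\,(\tau D(u)+D(u)\tau),$$ where $b$ is a fixed real parameter of the model. For several functions, $\|f,g,\dots\|_X^2$ denotes $\|f\|_X^2+\|g\|_X^2+\cdots$. $C(0,T;H^5)$ denotes the space of continuous functions of time on $[0,T]$ with values in $H^5$, with the supremum norm. *)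

(* Defs.v *)
From HB Require Import structures.
From mathcomp Require Import all_boot all_order all_algebra.
From mathcomp Require Import all_classical all_reals all_analysis.

Set Implicit Arguments.
Unset Strict Implicit.
Unset Printing Implicit Defensive.

Import Order.TTheory GRing.Theory Num.Theory.
Import numFieldNormedType.Exports.

Local Open Scope classical_set_scope.
Local Open Scope ring_scope.

(* The torus is (R / 2 pi Z)^2: a function on it is a function on R * R that is
   2 pi-periodic in each coordinate.  Vector fields take values in 'cV[R]_2,
   tensor fields in 'M[R]_2. *)

Section Torus.
Context {R : realType}.
Implicit Types (f : R * R -> R) (x : R * R) (j : 'I_2).

Definition periodic2 f : Prop :=
  forall x, f (x.1 + 2 * pi, x.2) = f x /\ f (x.1, x.2 + 2 * pi) = f x.

Definition cell : set (R * R) := `[0, 2 * pi] `*` `[0, 2 * pi].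

Definition area := (@lebesgue_measure R \x @lebesgue_measure R)%E.

(* The squared modulus of the Fourier coefficient
   (2 pi)^-1 \int f(x) e^{- i k.x} dx; with this normalization
   Parseval's identity reads \sum_k |f^(k)|^2 = ||f||_{L^2}^2. *)
Definition fourier_sq f (k : int * int) : R :=
  let phase x := k.1%:~R * x.1 + k.2%:~R * x.2 in
  ((2 * pi)^-1 * \int[area]_(x in cell) (f x * cos (phase x))) ^+ 2 +
  ((2 * pi)^-1 * \int[area]_(x in cell) (f x * sin (phase x))) ^+ 2.

(* The squared norm ||f||_{H^s}^2 = \sum_k (1 + |k|^2)^s |f^(k)|^2, possibly
   infinite. *)
Definition sobolev_sq (s : nat) f : \bar R :=
  \esum_(k in [set: int * int])
    ((1 + k.1%:~R ^+ 2 + k.2%:~R ^+ 2) ^+ s * fourier_sq f k)%:E.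

Definition in_sobolev (s : nat) f : Prop :=
  [/\ periodic2 f, measurable_fun setT f,
      area.-integrable cell (fun x => (f x ^+ 2)%:E) &
      (sobolev_sq s f < +oo)%E].

Definition dir j : R * R := if j == ord0 then (1, 0) else (0, 1).

Definition pd j f x : R := 'D_(dir j) f x.

Definition pgrad f x : 'cV[R]_2 := \col_j pd j f x.

Section Fields.
Variables m n : nat.
Implicit Types A : R * R -> 'M[R]_(m, n).

Definition entry A (i : 'I_m) (k : 'I_n) : R * R -> R := fun x => A x i k.

Definition pdM j A x : 'M[R]_(m, n) := \matrix_(i, k) pd j (entry A i k) x.

Definition lapM A x : 'M[R]_(m, n) := \sum_j pdM j (pdM j A) x.

Definition advect (u : R * R -> 'cV[R]_2) A x : 'M[R]_(m, n) :=
  \sum_j u x j ord0 *: pdM j A x.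

Definition in_sobolevM (s : nat) A : Prop :=
  forall i k, in_sobolev s (entry A i k).

Definition sobolevM_sq (s : nat) A : \bar R :=
  (\sum_(i < m) \sum_(k < n) sobolev_sq s (entry A i k))%E.

Definition sobolev_gradM_sq (s : nat) A : \bar R :=
  (\sum_(j < 2) sobolevM_sq s (pdM j A))%E.

End Fields.

Definition grad (u : R * R -> 'cV[R]_2) x : 'M[R]_2 :=
  \matrix_(i, j) pd j (entry u i ord0) x.

Definition vdiv (u : R * R -> 'cV[R]_2) x : R :=
  \sum_j pd j (entry u j ord0) x.

Definition tdiv (tau : R * R -> 'M[R]_2) x : 'cV[R]_2 :=
  \col_i \sum_j pd j (entry tau i j) x.

Definition symm (G : 'M[R]_2) : 'M[R]_2 := 2^-1 *: (G + G^T).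
Definition skew (G : 'M[R]_2) : 'M[R]_2 := 2^-1 *: (G - G^T).

Definition Dsym (u : R * R -> 'cV[R]_2) x : 'M[R]_2 := symm (grad u x).

Definition Qterm (b : R) (tau G : 'M[R]_2) : 'M[R]_2 :=
  tau *m skew G - skew G *m tau + b *: (tau *m symm G + symm G *m tau).

End Torus.

(* Time-dependent fields: the first argument is the time. *)
Section Evolution.
Context {R : realType}.

Definition continuous_upto (S : R) (f : R -> R * R -> R) : Prop :=
  {within `[0, S] `*` setT, continuous (fun z : R * (R * R) => f z.1 z.2)}.

(* f and its first space derivatives exist and are continuous on
   [0, S] x T^2. *)
Definition spaceC1 (S : R) (f : R -> R * R -> R) : Prop :=
  [/\ forall t, 0 <= t <= S -> periodic2 (f t),
      continuous_upto S f,
      forall t x j, 0 <= t <= S -> derivable (f t) x (dir j) &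
      forall j, continuous_upto S (fun t => pd j (f t))].

Definition spaceC2 (S : R) (f : R -> R * R -> R) : Prop :=
  spaceC1 S f /\ forall j, spaceC1 S (fun t => pd j (f t)).

Section Fields.
Variables m n : nat.
Implicit Types A B : R -> R * R -> 'M[R]_(m, n).

Definition spaceC1M (S : R) A : Prop :=
  forall i k, spaceC1 S (fun t => entry (A t) i k).

Definition spaceC2M (S : R) A : Prop :=
  forall i k, spaceC2 S (fun t => entry (A t) i k).

Definition time_derivable (S : R) A : Prop :=
  forall t x i k, 0 < t < S -> derivable (fun r => A r x i k) t 1.

Definition dt A t x : 'M[R]_(m, n) :=
  \matrix_(i, k) derive1 (fun r => A r x i k) t.

Definition in_C_sobolev (T : R) (s : nat) A : Prop :=
  (forall t, 0 <= t <= T -> in_sobolevM s (A t)) /\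
  (forall t, 0 <= t <= T ->
     sobolevM_sq s (fun x => A r x - A t x) @[r --> within `[0, T] (nbhs t)]
       --> 0%E).

(* Joint measurability in time and space; H^s being separable, this gives the
   strong measurability of the H^s-valued map t |-> A(t). *)
Definition jointly_measurable (T : R) A : Prop :=
  forall i k, measurable_fun (`[0, T] `*` setT)
    (fun z : R * (R * R) => A z.1 z.2 i k).

Definition in_L2_sobolev (T : R) (s : nat) A : Prop :=
  [/\ jointly_measurable T A,
      {ae lebesgue_measure, forall t, 0 <= t <= T -> in_sobolevM s (A t)} &
      (\int[lebesgue_measure]_(t in `[0%R, T]) sobolevM_sq s (A t) < +oo)%E].

Definition in_Linfty_sobolev (T : R) (s : nat) A : Prop :=
  jointly_measurable T A /\
  exists M : R, {ae lebesgue_measure, forall t, 0 <= t <= T ->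
    in_sobolevM s (A t) /\ (sobolevM_sq s (A t) <= M%:E)%E}.

(* The squared distances of A and B in C(0,T;H^s) and in L^2(0,T;H^s). *)
Definition C_sobolev_dist_sq (T : R) (s : nat) A B : \bar R :=
  ereal_sup [set sobolevM_sq s (fun x => A t x - B t x) | t in `[0, T]].

Definition L2_sobolev_dist_sq (T : R) (s : nat) A B : \bar R :=
  (\int[lebesgue_measure]_(t in `[0%R, T])
     sobolevM_sq s (fun x => A t x - B t x)%R)%E.

End Fields.

(* Classical solutions: every derivative occurring in the system exists in the
   classical sense; fields and space derivatives are continuous up to the ends
   of the time interval, and the equations hold in its interior (hence, by
   continuity, at the ends with one-sided time derivatives).  The initial
   conditions are pointwise: data in H^6 are identified with their continuous
   (in fact C^4) representatives.  The pressure is existential, being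
   determined only up to a function of time. *)
Definition classical_solution (b eps S : R)
    (uin : R * R -> 'cV[R]_2) (tauin : R * R -> 'M[R]_2)
    (u : R -> R * R -> 'cV[R]_2) (tau : R -> R * R -> 'M[R]_2) : Prop :=
  let elastic t x := tau t x - lapM (tau t) x in
  spaceC1M S u /\ spaceC2M S tau /\
  time_derivable S u /\ time_derivable S elastic /\
  (forall x, u 0 x = uin x /\ tau 0 x = tauin x) /\
  exists p : R -> R * R -> R, spaceC1 S p /\
    forall t x, 0 < t < S ->
    [/\ dt u t x + advect (u t) (u t) x + pgrad (p t) x = tdiv (tau t) x,
        dt elastic t x + advect (u t) (tau t) x
          + Qterm b (tau t x) (grad (u t) x)
          = (eps ^+ 2)^-1 *: (Dsym (u t) x - tau t x) &
        vdiv (u t) x = 0].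

Definition navier_stokes (T : R) (v : R -> R * R -> 'cV[R]_2) : Prop :=
  spaceC2M T v /\ time_derivable T v /\
  exists q : R -> R * R -> R, spaceC1 T q /\
    forall t x, 0 < t < T ->
    dt v t x + advect (v t) (v t) x + pgrad (q t) x = tdiv (Dsym (v t)) x /\
    vdiv (v t) x = 0.

Definition energy_sq (eps : R) (u : R * R -> 'cV[R]_2)
    (tau : R * R -> 'M[R]_2) : \bar R :=
  let r x := tau x - Dsym u x in
  (sobolevM_sq 6 u + sobolevM_sq 6 (fun x => eps *: tau x)%R
   + sobolev_gradM_sq 6 (fun x => eps *: tau x)%R
   + (sobolevM_sq 2 r + sobolev_gradM_sq 2 r))%E.

Definition dissipation_sq (eps : R) (u : R * R -> 'cV[R]_2)
    (tau : R * R -> 'M[R]_2) : \bar R :=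
  (sobolevM_sq 6 tau
   + (sobolev_gradM_sq 2 u
      + sobolevM_sq 2 (fun x => eps^-1 *: (tau x - Dsym u x))%R))%E.

Definition uniform_bound (eps S C : R) (u : R -> R * R -> 'cV[R]_2)
    (tau : R -> R * R -> 'M[R]_2) : Prop :=
  (ereal_sup [set energy_sq eps (u t) (tau t) | t in `[0%R, S]]
   + \int[lebesgue_measure]_(t in `[0%R, S])
       dissipation_sq eps (u t) (tau t) < C%:E)%E.

End Evolution.

(* Main.v *)
Require Import Defs.
From mathcomp Require Import all_boot all_order all_algebra.
From mathcomp Require Import all_classical all_reals all_analysis.
From mathcomp Require Import measurable_realfun ring lra.
Import Order.TTheory GRing.Theory Num.Theory.
Import numFieldNormedType.Exports.
Set Implicit Arguments.
Unset Strict Implicit.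
Unset Printing Implicit Defensive.
Local Open Scope classical_set_scope.
Local Open Scope ring_scope.

(** The limit equation is reached by comparing Fourier coefficients one
    frequency at a time, and no energy estimate on derivatives is needed.

    Write the stress as the strain rate plus a remainder. The bound on the
    solutions gives a uniform bound for the velocities in [H^6] and makes the
    remainder of order [eps] in [L^2(0,T;H^2)]. A Fourier coefficient [w] of
    the difference of two of these velocities then solves an ordinary
    differential equation ([flow_mode]) with viscous damping [|k|^2 / 2], a
    pressure that does no work because the modes are orthogonal to [k], and
    [k] contracted with the modes of the momentum flux and of the remainder.
    The damping absorbs the factor [k] ([energy_mode]), so the modulus of [w]
    is driven by undifferentiated quantities. The quadratic flux couples all
    modes; but the [H^6] bound makes coefficients summable, so a flux
    difference is at most a constant times the supremum over all frequencies
    of the coefficients of the difference ([coef_mulB]). Gronwall's inequality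
    for that supremum ([gronwall_family]) gives, with equal initial data,
    coefficients that are Cauchy at the rate [eps + eps'], uniformly in the
    frequency and in time ([modes_cauchy]).

    Interpolating this with the [H^6] bound gives convergence in [C(0,T;H^5)]
    ([sobolev5_small], [velocity_close]), and with the smallness of the
    remainder convergence of the stress in [L^2(0,T;H^2)]
    ([strain_distance_le]).

    The limits of the coefficients decay like [(1 + |k|^2)^-3] and solve the
    equations of the modes without remainder ([limit_ode]). Their Fourier
    series can therefore be differentiated termwise, twice in space and once
    in time; with the pressure that solves the Poisson equation, the sum
    satisfies the Navier-Stokes equations because both sides have the same
    Fourier coefficients ([velocity_navier_stokes], through the uniqueness
    theorem [coef_uniq]). *)

(** * Measurability of continuous functions on products of lines *)

(** Second countability in a form that passes to products: a product of two
    such families consists of measurable rectangles, whereas the Borel sets of a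
    product of two topological spaces need not form the product
    sigma-algebra. *)
Definition measurable_base d (T : measurableType d) (nb : T -> set (set T)) : Prop :=
  exists B : nat -> set T, (forall n, measurable (B n)) /\
    forall x U, nb x U -> exists n, B n x /\ B n `<=` U.

Lemma measurable_base_real (R : realType) :
  @measurable_base _ (measurableTypeR R) (@nbhs R R).
Proof.
pose b (p : rat * nat) : set R := @ball R R (ratr p.1) (p.2.+1%:R^-1).
exists (fun n => if @pickle_inv (rat * nat)%type n is Some p then b p else set0).
split=> [n|].
  case: (pickle_inv n) => [p|] /=; last exact: measurable0.
  by rewrite /b ball_itv; exact: measurable_itv.
suff H : forall (x : R) (U : set R), nbhs x U -> exists n,
    (if @pickle_inv (rat * nat)%type n is Some p then b p else set0) x /\
    (if @pickle_inv (rat * nat)%type n is Some p then b p else set0) `<=` U.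
  by move=> x U; exact: H.
move=> x U /nbhs_ballP[e /= e0 eU].
have [n [r [rE r0 ne]]] : exists n (r : R), [/\ n.+1%:R^-1 = r, 0 < r & r < e / 2].
  have e20 : 0 < e / 2 by rewrite divr_gt0.
  have [n _ Hn] := near_infty_natSinv_lt (PosNum e20).
  exists n, n.+1%:R^-1; split => //.
  exact: (Hn n (leqnn n)).
have [q] : exists q, ratr q \in `]x - r, x + r[ by apply: rat_in_itvoo; lra.
rewrite in_itv /= => /andP[q1 q2].
exists (pickle (q, n)); rewrite pickleK_inv /b /= rE; split.
  by rewrite /ball /= ltr_norml; apply/andP; split; lra.
move=> y; rewrite /ball /= ltr_norml => /andP[y1 y2]; apply: eU.
rewrite /ball /= ltr_norml; apply/andP; split; lra.
Qed.

Lemma measurable_base_prod d1 d2 (T1 : measurableType d1) (T2 : measurableType d2)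
    (nb1 : T1 -> set (set T1)) (nb2 : T2 -> set (set T2)) :
  measurable_base nb1 -> measurable_base nb2 ->
  @measurable_base _ (T1 * T2)%type
    (fun z => filter_prod (nb1 z.1) (nb2 z.2)).
Proof.
move=> [B1 [mB1 H1]] [B2 [mB2 H2]].
exists (fun n => if @pickle_inv (nat * nat)%type n is Some p
                 then B1 p.1 `*` B2 p.2 else set0).
split=> [n|x U].
  case: (pickle_inv n) => [p|]; last exact: measurable0.
  by apply: measurableX.
move=> -[[U1 U2] /= [/H1[n1 [Bx1 BU1]] /H2[n2 [Bx2 BU2]]] UU].
exists (pickle (n1, n2)); rewrite pickleK_inv; split => //=.
by move=> [y1 y2] /= [y1B y2B]; apply: UU; split; [exact: BU1|exact: BU2].
Qed.

(** Inside [D], the preimage of an open ray is the union of the countably many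
    base sets whose trace on [D] it contains. *)
Lemma base_measurable_fun d (T : measurableType d) (nb : T -> set (set T))
    (R : realType) (D : set T) (f : T -> R) :
  measurable_base nb -> measurable D ->
  (forall x U, D x -> nbhs (f x) U -> nb x [set y | D y -> U (f y)]) ->
  measurable_fun D f.
Proof.
move=> [B [mB HB]] mD fc.
apply: (measurability _ (RGenOInfty.measurableE R)).
move=> _ [_ [a ->] <-].
set U := `]a, +oo[%classic.
have -> : D `&` f @^-1` U =
    D `&` \bigcup_(n in [set n | D `&` B n `<=` f @^-1` U]) B n.
  apply/seteqP; split=> x /= [Dx].
    move=> Ux; split=> //.
    have [|n [Bx BU]] := HB x [set y | D y -> U (f y)].
      apply: fc => //; move: Ux; rewrite /U /= in_itv /= andbT => ax.
      by near=> y; rewrite /U /= in_itv /= andbT; near: y; exact: lt_nbhsr.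
    by exists n => //= y [Dy By]; exact: BU.
  by move=> [n /= nU Bx]; split => //; apply: nU.
apply: measurableI => //; apply: bigcup_measurable => n _; exact: mB.
Unshelve. all: by end_near. Qed.

Lemma continuous_measurable2 (R : realType) (f : R * R -> R) :
  continuous f -> measurable_fun setT f.
Proof.
move=> cf; apply: (base_measurable_fun
  (measurable_base_prod (@measurable_base_real R) (@measurable_base_real R))) => //.
move=> x U _ /cf fU.
by apply: (@filterS _ (nbhs x) _ (f @^-1` U) _ _ fU) => y Uy _.
Qed.

Lemma continuous_measurable3 (R : realType) (D : set R) (f : R * (R * R) -> R) :
  measurable D ->
  {within D `*` setT, continuous f} -> measurable_fun (D `*` setT) f.
Proof.
move=> mD cf; apply: (base_measurable_fun
  (measurable_base_prod (@measurable_base_real R)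
    (measurable_base_prod (@measurable_base_real R) (@measurable_base_real R)))).
  exact: measurableX.
move=> x U Dx fxU.
have H : nbhs_subspace (x : subspace (D `*` setT)) (f @^-1` U) := cf x U fxU.
rewrite -(nbhs_subspace_in Dx) in H.
by apply: filterS H => y.
Qed.

(** * Integration of continuous functions over the period cell *)

Notation cellint f := (\int[area]_(x in cell) f x).

Lemma continuousT_pair (T U V : topologicalType) (f : T -> U) (g : T -> V) :
  continuous f -> continuous g -> continuous (fun x => (f x, g x)).
Proof. by move=> cf cg x; apply: cvg_pair; [exact: cf|exact: cg]. Qed.

Lemma continuousT_comp (T U V : topologicalType) (f : T -> U) (g : U -> V) :
  continuous f -> continuous g -> continuous (fun x => g (f x)).
Proof. by move=> cf cg x; apply: continuous_comp; [exact: cf|exact: cg]. Qed.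

Lemma continuousT_fst (T U : topologicalType) : continuous (@fst T U).
Proof. by move=> x; exact: cvg_fst. Qed.

Lemma continuousT_snd (T U : topologicalType) : continuous (@snd T U).
Proof. by move=> x; exact: cvg_snd. Qed.

Section CellIntegral.
Context {R : realType}.
Implicit Types (f g : R * R -> R).

Lemma twopi_gt0 : 0 < 2 * pi :> R.
Proof. by rewrite mulr_gt0// pi_gt0. Qed.

Lemma measurable_cell : measurable (@cell R).
Proof. by apply: measurableX; exact: measurable_itv. Qed.

Lemma compact_cell : compact (@cell R).
Proof. by apply: compact_setX; exact: segment_compact. Qed.

Lemma area_cell : area (@cell R) = ((2 * pi) ^+ 2)%:E.
Proof.
have L : @lebesgue_measure R `[0, 2 * pi]%classic = (2 * pi)%:E.
  by rewrite lebesgue_measure_itv /= lte_fin twopi_gt0 -EFinD subr0.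
rewrite /area product_measure1E; [|exact: measurable_itv..].
by rewrite expr2 EFinM; exact: (f_equal2 _ L L).
Qed.

Lemma continuous_bounded_on (T : topologicalType) (A : set T) (f : T -> R) :
  compact A -> {within A, continuous f} ->
  exists2 M, 0 <= M & forall x, A x -> `|f x| <= M.
Proof.
move=> cA cf; have [->|/set0P A0] := eqVneq A set0; first by exists 0.
have [x _ xM] := compact_EVT_max A0 cA cf.
have [y _ ym] := compact_EVT_min A0 cA cf.
exists (`|f x| + `|f y|); first by rewrite addr_ge0.
move=> z /mem_set Az; rewrite ler_norml; apply/andP; split.
  have := ym _ Az; have := ler_norm (- f y); rewrite normrN.
  have := normr_ge0 (f x); lra.
have := xM _ Az; have := ler_norm (f x); have := normr_ge0 (f y); lra.
Qed.

Lemma continuous_cell_integrable f : continuous f ->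
  area.-integrable cell (EFin \o f).
Proof.
move=> cf; apply: measurable_bounded_integrable.
- exact: measurable_cell.
- by rewrite (_ : _ cell = ((2 * pi) ^+ 2)%:E) ?ltry//; exact: area_cell.
- by apply: measurable_funTS; exact: continuous_measurable2.
- have [M M0 fM] := continuous_bounded_on compact_cell (continuous_subspaceT cf).
  exists M; split; first exact: num_real.
  by move=> N MN x /fM /le_trans; apply; exact: ltW.
Qed.

Lemma cellintD f g : continuous f -> continuous g ->
  cellint (fun x => f x + g x) = cellint f + cellint g.
Proof.
by move=> cf cg; apply: RintegralD; [exact: measurable_cell|
  exact: continuous_cell_integrable..].
Qed.

Lemma cellintB f g : continuous f -> continuous g ->
  cellint (fun x => f x - g x) = cellint f - cellint g.
Proof.
by move=> cf cg; apply: RintegralB; [exact: measurable_cell|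
  exact: continuous_cell_integrable..].
Qed.

Lemma cellintZ f (c : R) : continuous f ->
  cellint (fun x => c * f x) = c * cellint f.
Proof.
by move=> cf; apply: RintegralZl; [exact: measurable_cell|
  exact: continuous_cell_integrable].
Qed.

Lemma cellint_cst (c : R) : cellint (fun=> c) = c * (2 * pi) ^+ 2.
Proof.
rewrite Rintegral_cst; last exact: measurable_cell.
by congr (_ * _); rewrite (_ : _ cell = ((2 * pi) ^+ 2)%:E) //; exact: area_cell.
Qed.

Lemma continuous_bigsum (T : topologicalType) (I : Type) (s : seq I) (F : I -> T -> R) :
  (forall i, continuous (F i)) -> continuous (fun x => \sum_(i <- s) F i x).
Proof.
move=> cF; elim: s => [|i s IH].
  by under eq_fun do rewrite big_nil; exact: cst_continuous.
under eq_fun do rewrite big_cons.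
by move=> x; apply: continuousD; [exact: cF|exact: IH].
Qed.

Lemma cellint_sum (I : Type) (s : seq I) (F : I -> R * R -> R) :
  (forall i, continuous (F i)) ->
  cellint (fun x => \sum_(i <- s) F i x) = \sum_(i <- s) cellint (F i).
Proof.
move=> cF; elim: s => [|i s IH].
  under eq_Rintegral do rewrite big_nil.
  by rewrite big_nil cellint_cst mul0r.
under eq_Rintegral do rewrite big_cons.
by rewrite big_cons cellintD ?IH//; exact: continuous_bigsum.
Qed.

Lemma le_cellint f g : continuous f -> continuous g ->
  (forall x, cell x -> f x <= g x) -> cellint f <= cellint g.
Proof.
by move=> cf cg fg; apply: le_Rintegral => //; [exact: measurable_cell|
  exact: continuous_cell_integrable..].
Qed.

Lemma cellint_norm_le f (M : R) : continuous f ->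
  (forall x, cell x -> `|f x| <= M) -> `|cellint f| <= M * (2 * pi) ^+ 2.
Proof.
move=> cf fM; rewrite -cellint_cst ler_norml; apply/andP; split.
  rewrite -mulN1r -cellintZ; last exact: cst_continuous.
  apply: le_cellint => //; first by move=> x; exact: cst_continuous.
  by move=> x /fM; rewrite ler_norml mulN1r => /andP[].
apply: le_cellint => //; first exact: cst_continuous.
by move=> x /fM; rewrite ler_norml => /andP[].
Qed.

Lemma slice_pd0 f (s y : R) :
  (derivable f (s, y) (dir ord0) <-> derivable (fun r => f (r, y)) s 1) /\
  pd ord0 f (s, y) = derive1 (fun r => f (r, y)) s.
Proof.
have E : (fun h => h^-1 *: ((f \o shift (s, y)) (h *: dir ord0) - f (s, y))) =
         (fun h : R => h^-1 *: (f (h + s, y) - f (s, y))).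
  apply/funext => h /=; congr (_ *: (f _ - _)).
  by rewrite /dir eqxx /=; congr (_, _); rewrite /= /GRing.scale /= ?mulr1 ?mulr0 ?add0r.
split; last by rewrite /pd /derive /derive1 E.
rewrite /derivable E; set F := (X in cvg (X @ _) <-> _).
suff -> : F = (fun h => h^-1 *: (((fun r => f (r, y)) \o shift s) (h *: 1) - f (s, y))) by [].
by apply/funext => h; rewrite /F /= /GRing.scale /= mulr1.
Qed.

Lemma slice_pd1 f (x s : R) :
  (derivable f (x, s) (dir ord_max) <-> derivable (fun r => f (x, r)) s 1) /\
  pd ord_max f (x, s) = derive1 (fun r => f (x, r)) s.
Proof.
have E : (fun h => h^-1 *: ((f \o shift (x, s)) (h *: dir ord_max) - f (x, s))) =
         (fun h : R => h^-1 *: (f (x, h + s) - f (x, s))).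
  apply/funext => h /=; congr (_ *: (f _ - _)).
  by rewrite /dir /=; congr (_, _); rewrite /= /GRing.scale /= ?mulr1 ?mulr0 ?add0r.
split; last by rewrite /pd /derive /derive1 E.
rewrite /derivable E; set F := (X in cvg (X @ _) <-> _).
suff -> : F = (fun h => h^-1 *: (((fun r => f (x, r)) \o shift s) (h *: 1) - f (x, s))) by [].
by apply/funext => h; rewrite /F /= /GRing.scale /= mulr1.
Qed.

(** The fundamental theorem of calculus over a full period. *)
Lemma integral_derive_period (g : R -> R) : (forall s, derivable g s 1) ->
  continuous (derive1 g) -> g (2 * pi) = g 0 ->
  (\int[lebesgue_measure]_(s in `[0%R, (2 * pi)%R]) (derive1 g s)%:E = 0)%E.
Proof.
move=> dg cg g0.
have cg0 : continuous g.
  by move=> s; apply: differentiable_continuous; apply/derivable1_diffP.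
have oo : derivable_oo_LRcontinuous g 0 (2 * pi).
  split; first by move=> s _; exact: dg.
  + by apply: cvg_at_right_filter; exact: cg0.
  + by apply: cvg_at_left_filter; exact: cg0.
have H := @continuous_FTC2 R _ g 0 (2 * pi) twopi_gt0 (continuous_subspaceT cg) oo
  (fun s _ => erefl).
by rewrite H g0 subee.
Qed.

Lemma cellint_fubini1 f : continuous f ->
  (forall x, \int[lebesgue_measure]_(y in `[0%R, (2 * pi)%R]) (f (x, y))%:E = 0)%E ->
  cellint f = 0.
Proof.
move=> cf H; have := continuous_cell_integrable cf.
rewrite integrable_mkcond; last exact: measurable_cell.
move/integral12_prod_meas1; rewrite -integral_mkcond /Rintegral => <-.
rewrite (eq_integral (cst 0%E)) ?integral0// => x _.
rewrite /fubini_F -[RHS](_ : (if x \in `[0%R, (2 * pi)%R]%classic then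
  \int[lebesgue_measure]_(y in `[0%R, (2 * pi)%R]) (f (x, y))%:E else 0)%E = _); last first.
  by case: ifP => // _; rewrite H.
case: ifPn => xI.
  rewrite [RHS]integral_mkcond; apply: eq_integral => y _.
  by rewrite /patch /cell /= in_setX xI.
rewrite (eq_integral (cst 0%E)) ?integral0// => y _.
by rewrite /patch /cell /= in_setX (negbTE xI).
Qed.

Lemma cellint_fubini2 f : continuous f ->
  (forall y, \int[lebesgue_measure]_(x in `[0%R, (2 * pi)%R]) (f (x, y))%:E = 0)%E ->
  cellint f = 0.
Proof.
move=> cf H; have := continuous_cell_integrable cf.
rewrite integrable_mkcond; last exact: measurable_cell.
move/integral21_prod_meas1; rewrite -integral_mkcond /Rintegral => <-.
rewrite (eq_integral (cst 0%E)) ?integral0// => y _.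
rewrite /fubini_G -[RHS](_ : (if y \in `[0%R, (2 * pi)%R]%classic then
  \int[lebesgue_measure]_(x in `[0%R, (2 * pi)%R]) (f (x, y))%:E else 0)%E = _); last first.
  by case: ifP => // _; rewrite H.
case: ifPn => yI.
  rewrite [RHS]integral_mkcond; apply: eq_integral => x _.
  by rewrite /patch /cell /= in_setX yI andbT.
rewrite (eq_integral (cst 0%E)) ?integral0// => x _.
by rewrite /patch /cell /= in_setX (negbTE yI) andbF.
Qed.

Lemma dir_cases (P : 'I_2 -> Prop) : P ord0 -> P ord_max -> forall j, P j.
Proof.
move=> P0 P1 [[|[|//]] i].
  by rewrite (_ : Ordinal i = ord0)//; exact/val_inj.
by rewrite (_ : Ordinal i = ord_max)//; exact/val_inj.
Qed.

(** Fubini's theorem reduces this to one variable: the inner integral runs along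
    the direction of the derivative, over a full period. *)
Lemma cellint_pd (j : 'I_2) f : periodic2 f ->
  (forall x, derivable f x (dir j)) -> continuous (pd j f) ->
  cellint (pd j f) = 0.
Proof.
move=> pf; elim/dir_cases: j => df cpf.
- apply: (cellint_fubini2 cpf) => y.
  under eq_integral do rewrite (slice_pd0 f _ y).2.
  apply: (integral_derive_period (g := fun r => f (r, y))).
  + by move=> s; have [h _] := slice_pd0 f s y; exact: (h.1 (df (s, y))).
  + rewrite (_ : derive1 _ = pd ord0 f \o (fun r => (r, y))).
      apply: continuousT_comp => //.
      by apply: continuousT_pair => s; [exact: cvg_id|exact: cvg_cst].
    by apply/funext => r /=; rewrite (slice_pd0 f _ y).2.
  + by have [/= + _] := pf (0, y); rewrite add0r.
- apply: (cellint_fubini1 cpf) => x.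
  under eq_integral do rewrite (slice_pd1 f x _).2.
  apply: (integral_derive_period (g := fun r => f (x, r))).
  + by move=> s; have [h _] := slice_pd1 f x s; exact: (h.1 (df (x, s))).
  + rewrite (_ : derive1 _ = pd ord_max f \o (fun r => (x, r))).
      apply: continuousT_comp => //.
      by apply: continuousT_pair => s; [exact: cvg_cst|exact: cvg_id].
    by apply/funext => r /=; rewrite (slice_pd1 f x _).2.
  + by have [_ /= +] := pf (x, 0); rewrite add0r.
Qed.

(** The tube lemma for the compact cell. *)
Lemma near_cell_uniform (T : topologicalType) (F : T -> R * R -> R) t0 (e : R) :
  continuous (fun z : T * (R * R) => F z.1 z.2) -> 0 < e ->
  \forall t \near t0, forall x, cell x -> `|F t x - F t0 x| < e.
Proof.
move=> cF e0.
have e20 : 0 < e / 2 by rewrite divr_gt0.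
have := (compact_near_coveringP (@cell R)).1 compact_cell T (nbhs t0)
  (fun t x => `|F t x - F t0 x| < e) _.
apply => x cx.
have /cvgrPdist_lt/(_ _ e20) H1 := cF (t0, x).
have H2 : \forall z \near (t0, x), `|F t0 x - F t0 z.2| < e / 2.
  have c : continuous (fun z : T * (R * R) => F t0 z.2).
    apply: (@continuousT_comp _ _ _ (fun z : T * (R * R) => (t0, z.2)) (fun z => F z.1 z.2)) => //.
    by apply: continuousT_pair => z; [exact: cvg_cst|exact: cvg_snd].
  by have /cvgrPdist_lt/(_ _ e20) := c (t0, x).
have H3 : \forall z \near (t0, x), `|F z.1 z.2 - F t0 z.2| < e.
  near=> z.
  have h1 : `|F t0 x - F z.1 z.2| < e / 2 by near: z.
  have h2 : `|F t0 x - F t0 z.2| < e / 2 by near: z.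
  rewrite (_ : F z.1 z.2 - F t0 z.2 = (F t0 x - F t0 z.2) - (F t0 x - F z.1 z.2)); last by ring.
  by rewrite (le_lt_trans (ler_normB _ _))// (splitr e) ltrD.
case: H3 => -[U V] /= [tU xV] UV.
exists (V, U) => //= -[y s] /= [Vy Us].
exact: (UV (s, y)).
Unshelve. all: by end_near. Qed.

Definition jcont (F : R -> R * R -> R) :=
  continuous (fun z : R * (R * R) => F z.1 z.2).

Lemma jcont_slice F t : jcont F -> continuous (F t).
Proof.
move=> cF; apply: (@continuousT_comp _ _ _ (fun x => (t, x)) (fun z => F z.1 z.2)) => //.
by apply: continuousT_pair => x; [exact: cvg_cst|exact: cvg_id].
Qed.

Lemma cellint_continuous F : jcont F -> continuous (fun t => cellint (F t)).
Proof.
move=> cF t0; apply/cvgrPdist_le => e e0.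
have k0 : 0 < (2 * pi) ^+ 2 :> R by rewrite exprn_gt0// twopi_gt0.
have ek : 0 < e / (2 * pi) ^+ 2 by rewrite divr_gt0.
near=> t.
have H : forall x, cell x -> `|F t x - F t0 x| < e / (2 * pi) ^+ 2.
  by near: t; exact: (near_cell_uniform t0 cF ek).
rewrite -cellintB; [|exact: jcont_slice..].
have -> : e = e / (2 * pi) ^+ 2 * (2 * pi) ^+ 2 by rewrite divfK// gt_eqF.
apply: cellint_norm_le.
  by move=> x; apply: continuousB; exact: jcont_slice.
by move=> x cx; rewrite distrC ltW// H.
Unshelve. all: by end_near. Qed.

(** Differentiation under the integral sign; on a compact time interval the time
    derivative is bounded, which provides the dominating constant. *)
Lemma cellint_derive F G (a b t : R) : jcont F -> jcont G ->
  (forall s x, a < s < b -> is_derive s 1 (F^~ x) (G s x)) ->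
  a < t < b -> is_derive t 1 (fun s => cellint (F s)) (cellint (G t)).
Proof.
move=> cF cG dF tab.
have [M M0 GM] : exists2 M, 0 <= M & forall z, (`[a, b] `*` cell) z -> `|G z.1 z.2| <= M.
  apply: continuous_bounded_on; last exact: continuous_subspaceT.
  by apply: compact_setX; [exact: segment_compact|exact: compact_cell].
have tI : `]a, b[%classic t by rewrite /= in_itv.
have Id s : `]a, b[%classic s -> a < s < b by rewrite /= in_itv.
have intF s : `]a, b[%classic s -> area.-integrable cell (EFin \o F s).
  by move=> _; apply: continuous_cell_integrable; exact: jcont_slice.
have dF' s y : `]a, b[%classic s -> cell y -> derivable (F^~ y) s 1.
  by move=> /Id /(dF s y)[].
have pE s y : `]a, b[%classic s -> partial1of2 F s y = G s y.
  by move=> /Id /(dF s y) ?; rewrite /partial1of2 derive1E derive_val.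
have intM : area.-integrable cell (EFin \o cst M).
  by apply: continuous_cell_integrable; exact: cst_continuous.
have bd s y : `]a, b[%classic s -> cell y -> `|partial1of2 F s y| <= M.
  move=> sI cy; rewrite pE//; apply: (GM (s, y)); split => //=.
  by move: sI; rewrite /= !in_itv /= => /andP[/ltW-> /ltW->].
have := @cvg_differentiation_under_integral R _ _ area F cell measurable_cell t a b tI
  intF dF' (cst M) (fun=> M0) intM bd.
rewrite (_ : \int[area]_(y in cell) partial1of2 F t y = cellint (G t)); last first.
  by apply: eq_Rintegral => x _; rewrite -pE.
move=> H; have E : (fun h => h^-1 *: (((fun s => cellint (F s)) \o shift t) (h *: 1) - cellint (F t)))
    = (fun h : R => h^-1 *: (cellint (F (h + t)) - cellint (F t))).
  by apply/funext => h; rewrite /= /GRing.scale /= mulr1.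
apply: DeriveDef; rewrite ?/derivable ?/derive E; last exact: cvg_lim.
by apply/cvg_ex; exists (cellint (G t)).
Qed.
End CellIntegral.

(** * Fourier coefficients with a real phase *)

Section Coefficients.
Context {R : realType}.
Implicit Types (f g : R * R -> R) (k l : int * int) (th : R).

Definition dotZ k (x : R * R) : R := k.1%:~R * x.1 + k.2%:~R * x.2.

Definition wave k th (x : R * R) : R := cos (dotZ k x - th).

(** The real part of [e^(i th)] times the integral of [f(x) e^(-i k.x)]. Carrying
    the phase [th] keeps everything real: the two real coefficients of
    [fourier_sq] are the phases [0] and [pi / 2], and a derivative shifts the
    phase by a quarter of a period. *)
Definition coef f k th : R := cellint (fun x => f x * wave k th x).

Definition freq k (j : 'I_2) : R := if j == ord0 then k.1%:~R else k.2%:~R.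

Lemma mul_continuous (T : topologicalType) (f g : T -> R) :
  continuous f -> continuous g -> continuous (fun x => f x * g x).
Proof. by move=> cf cg x; apply: continuousM; [exact: cf|exact: cg]. Qed.

Lemma add_continuous (T : topologicalType) (f g : T -> R) :
  continuous f -> continuous g -> continuous (fun x => f x + g x).
Proof. by move=> cf cg x; apply: continuousD; [exact: cf|exact: cg]. Qed.

Lemma sub_continuous (T : topologicalType) (f g : T -> R) :
  continuous f -> continuous g -> continuous (fun x => f x - g x).
Proof. by move=> cf cg x; apply: continuousB; [exact: cf|exact: cg]. Qed.

Lemma dotZ_continuous k : continuous (dotZ k).
Proof.
apply: add_continuous; apply: mul_continuous; try by move=> x; exact: cst_continuous.
  exact: continuousT_fst.
exact: continuousT_snd.
Qed.

Lemma wave_continuous k th : continuous (wave k th).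
Proof.
apply: (@continuousT_comp _ _ _ (fun x => dotZ k x - th) cos).
  apply: sub_continuous; first exact: dotZ_continuous.
  by move=> x; exact: cst_continuous.
exact: continuous_cos.
Qed.

Lemma mulwave_continuous f k th : continuous f ->
  continuous (fun x => f x * wave k th x).
Proof. by move=> cf; apply: mul_continuous => //; exact: wave_continuous. Qed.

Lemma wave_norm_le k th x : `|wave k th x| <= 1.
Proof. by rewrite ler_norml cos_geN1 cos_le1. Qed.

Lemma coefD f g k th : continuous f -> continuous g ->
  coef (fun x => f x + g x) k th = coef f k th + coef g k th.
Proof.
move=> cf cg; rewrite /coef -cellintD; [|exact: mulwave_continuous..].
by apply: eq_Rintegral => x _; rewrite mulrDl.
Qed.

Lemma coefB f g k th : continuous f -> continuous g ->
  coef (fun x => f x - g x) k th = coef f k th - coef g k th.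
Proof.
move=> cf cg; rewrite /coef -cellintB; [|exact: mulwave_continuous..].
by apply: eq_Rintegral => x _; rewrite mulrBl.
Qed.

Lemma coefZ f (c : R) k th : continuous f ->
  coef (fun x => c * f x) k th = c * coef f k th.
Proof.
move=> cf; rewrite /coef -cellintZ; last exact: mulwave_continuous.
by apply: eq_Rintegral => x _; rewrite mulrA.
Qed.

Lemma coef_sum (I : Type) (s : seq I) (F : I -> R * R -> R) k th :
  (forall i, continuous (F i)) ->
  coef (fun x => \sum_(i <- s) F i x) k th = \sum_(i <- s) coef (F i) k th.
Proof.
move=> cF; rewrite /coef -cellint_sum; last by move=> i; exact: mulwave_continuous.
by apply: eq_Rintegral => x _; rewrite mulr_suml.
Qed.

Lemma eq_coef f g k th : f =1 g -> coef f k th = coef g k th.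
Proof. by move=> fg; apply: eq_Rintegral => x _; rewrite fg. Qed.

Lemma coef_norm_le f (M : R) k th : continuous f ->
  (forall x, cell x -> `|f x| <= M) -> `|coef f k th| <= M * (2 * pi) ^+ 2.
Proof.
move=> cf fM; apply: cellint_norm_le; first exact: mulwave_continuous.
by move=> x cx; rewrite normrM -[M]mulr1 ler_pM// ?wave_norm_le// fM.
Qed.

Lemma coef_trig f k th : continuous f ->
  coef f k th = coef f k 0 * cos th + coef f k (pi / 2) * sin th.
Proof.
move=> cf; rewrite mulrC [X in _ + X]mulrC -!coefZ// /coef -cellintD; first last.
- by apply: mulwave_continuous; apply: mul_continuous => // x; exact: cst_continuous.
- by apply: mulwave_continuous; apply: mul_continuous => // x; exact: cst_continuous.
apply: eq_Rintegral => x _; rewrite /wave subr0 cosB.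
by rewrite (cosB _ (pi / 2)) cos_pihalf sin_pihalf; ring.
Qed.

Lemma coef_opp f k th : coef f (- k) (- th) = coef f k th.
Proof.
apply: eq_Rintegral => x _; rewrite /wave -[in RHS]cosN; congr (_ * cos _).
by rewrite /dotZ /= !mulrNz; ring.
Qed.

Lemma coef_pi f k th : continuous f -> coef f k (th + pi) = - coef f k th.
Proof.
move=> cf; rewrite -mulN1r -coefZ//; apply: eq_Rintegral => x _.
by rewrite /wave opprD addrA (cosB _ pi) cospi sinpi; ring.
Qed.

Lemma is_derive_line (F : R * R -> R) x (v : R * R) (d : R) :
  is_derive (0 : R) 1 (fun h => F (h *: v + x)) d -> is_derive x v F d.
Proof.
move=> [dF <-].
have E : (fun h => h^-1 *: ((F \o shift x) (h *: v) - F x)) =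
  (fun h => h^-1 *: (((fun h => F (h *: v + x)) \o shift (0 : R)) (h *: (1 : R)) -
     F ((0 : R) *: v + x))).
  apply/funext => h /=; rewrite scale0r add0r addr0.
  by rewrite [h *: (1 : R)]mulr1.
by apply: DeriveDef; rewrite /derivable /derive E.
Qed.

Lemma dotZ_line k x j (h : R) : dotZ k (h *: dir j + x) = freq k j * h + dotZ k x.
Proof.
rewrite /dotZ /freq /dir; case: ifP => _ /=; rewrite /GRing.scale /=; ring.
Qed.

#[global] Instance is_derive_wave k th x j :
  is_derive x (dir j) (wave k th) (freq k j * wave k (th - pi / 2) x).
Proof.
apply: is_derive_line; rewrite /wave.
have -> : (fun h => cos (dotZ k (h *: dir j + x) - th)) =
    cos \o (fun h : R => freq k j * h + (dotZ k x - th)).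
  by apply/funext => h /=; rewrite dotZ_line -addrA.
apply: is_derive_eq.
rewrite /= mulr0 add0r addr0 [_ *: 1]mulr1 mulrC.
rewrite -cosDpihalf; congr (_ * cos _); ring.
Qed.

Lemma wave_period k th : periodic2 (wave k th).
Proof.
have Pn n (a : R) : cos (a + n%:R * (2 * pi)) = cos a.
  elim: n a => [|n IH] a; first by rewrite mul0r addr0.
  rewrite -[RHS]IH -[RHS]cosD2pi -natr1; congr cos; rewrite mulr2n; ring.
have P (m : int) (a : R) : cos (a + m%:~R * (2 * pi)) = cos a.
  case: m => n; first exact: Pn.
  rewrite NegzE mulrNz -[LHS](Pn n.+1); congr cos.
  by rewrite -pmulrn; ring.
move=> x; split; rewrite /wave /dotZ /=.
  by rewrite -[RHS](P k.1); congr cos; ring.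
by rewrite -[RHS](P k.2); congr cos; ring.
Qed.

Lemma periodic2M f g : periodic2 f -> periodic2 g -> periodic2 (fun x => f x * g x).
Proof. by move=> pf pg x; rewrite !(pf x).1 !(pf x).2 !(pg x).1 !(pg x).2. Qed.

(** Integration by parts: the derivative of a wave is the same wave, a quarter of
    a period off. *)
Lemma coef_pd j f k th : periodic2 f -> continuous f ->
  (forall x, derivable f x (dir j)) -> continuous (pd j f) ->
  coef (pd j f) k th = freq k j * coef f k (th + pi / 2).
Proof.
move=> pf cf df cpf.
have dw x : derivable (wave k th) x (dir j) by have [] := is_derive_wave k th x j.
have pdw x : pd j (wave k th) x = freq k j * wave k (th - pi / 2) x.
  by rewrite /pd derive_val.
have E x : pd j (fun x => f x * wave k th x) x =
    pd j f x * wave k th x + freq k j * (f x * wave k (th - pi / 2) x).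
  rewrite /pd (deriveM (df x) (dw x)) -!/(pd _ _ _) pdw /GRing.scale /=; ring.
have := @cellint_pd R j (fun x => f x * wave k th x).
have c1 : continuous (fun x => pd j f x * wave k th x) by exact: mulwave_continuous.
have c2 : continuous (fun x => f x * wave k (th - pi / 2) x) by exact: mulwave_continuous.
have c3 : continuous (fun x => freq k j * (f x * wave k (th - pi / 2) x)).
  by apply: mul_continuous => // x; exact: cst_continuous.
rewrite (funext E) cellintD// cellintZ// -!/(coef _ _ _).
move=> /(_ (periodic2M pf (wave_period k th)) (fun x => derivableM (df x) (dw x))
  (add_continuous c1 c3)) /eqP.
rewrite addr_eq0 => /eqP ->; rewrite -mulrN -coef_pi//; congr (_ * coef _ _ _); lra.
Qed.

Lemma fourier_sqE f k : continuous f ->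
  fourier_sq f k = ((2 * pi)^-1) ^+ 2 * (coef f k 0 ^+ 2 + coef f k (pi / 2) ^+ 2).
Proof.
move=> cf; rewrite mulrDr -!exprMn /fourier_sq.
congr ((_ * _) ^+ 2 + (_ * _) ^+ 2).
  by apply: eq_Rintegral => x _; rewrite /wave subr0.
by apply: eq_Rintegral => x _; rewrite /wave cosBpihalf.
Qed.

Lemma coef_sq_le f k th : continuous f ->
  coef f k th ^+ 2 <= (2 * pi) ^+ 2 * fourier_sq f k.
Proof.
move=> cf; rewrite fourier_sqE// mulrA -exprMn mulfV ?gt_eqF ?twopi_gt0//.
rewrite expr1n mul1r coef_trig//.
set a := coef f k 0; set b := coef f k _.
rewrite -subr_ge0.
have := cos2Dsin2 th; move: (cos th) (sin th) => c s cs.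
have -> : a ^+ 2 + b ^+ 2 - (a * c + b * s) ^+ 2 = (a * s - b * c) ^+ 2.
  have -> : a ^+ 2 + b ^+ 2 = (a ^+ 2 + b ^+ 2) * (c ^+ 2 + s ^+ 2) by rewrite cs mulr1.
  ring.
exact: sqr_ge0.
Qed.

Lemma fourier_sq_ge0 f k : 0 <= fourier_sq f k.
Proof. by rewrite addr_ge0// sqr_ge0. Qed.

Lemma fourier_sq_le f k (B : R) : continuous f ->
  (forall th, coef f k th ^+ 2 <= B) -> fourier_sq f k <= 2 * B.
Proof.
move=> cf H; rewrite fourier_sqE//.
have p1 : ((2 * pi)^-1) ^+ 2 <= 1 :> R.
  rewrite expr_le1 ?invr_ge0 ?(ltW twopi_gt0)// invf_le1 ?twopi_gt0//.
  have := @pi_ge2 R; lra.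
have s0 : 0 <= coef f k 0 ^+ 2 + coef f k (pi / 2) ^+ 2 by rewrite addr_ge0// sqr_ge0.
have := H 0; have := H (pi / 2); have := ler_wpM2r s0 p1; lra.
Qed.

(** Multiplication by a wave shifts the frequency both ways. *)
Lemma coef_mulwave g k th l ph : continuous g ->
  coef (fun x => g x * wave l ph x) k th =
  2^-1 * (coef g (k + l) (th + ph) + coef g (k - l) (th - ph)).
Proof.
move=> cg; have c1 k' th' : continuous (fun x => g x * wave k' th' x) by exact: mulwave_continuous.
rewrite /coef -cellintD// -cellintZ; last exact: add_continuous.
apply: eq_Rintegral => x _; rewrite /wave.
have -> : dotZ (k + l) x - (th + ph) = (dotZ k x - th) + (dotZ l x - ph).
  by rewrite /dotZ /= !intrD; ring.
have -> : dotZ (k - l) x - (th - ph) = (dotZ k x - th) - (dotZ l x - ph).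
  by rewrite /dotZ /= !intrD !intrN; ring.
by move: (dotZ k x - th) (dotZ l x - ph) => A B; rewrite cosD cosB; field.
Qed.

Lemma coef_cst1 k th : coef (fun=> 1) k th = if k == 0 then (2 * pi) ^+ 2 * cos th else 0.
Proof.
case: eqP => [->|/eqP k0].
  rewrite /coef (_ : (fun _ => _) = fun=> cos th) ?cellint_cst 1?mulrC//.
  by apply/funext => x; rewrite /wave /dotZ /= !mul0r addr0 sub0r cosN mul1r.
have [j kj] : exists j, freq k j != 0.
  move: k0; rewrite -pair_eqE /= negb_and => /orP[k1|k2].
    by exists ord0; rewrite /freq /= intr_eq0.
  by exists ord_max; rewrite /freq /= intr_eq0.
have c1 : continuous (fun _ : R * R => 1 : R) by move=> x; exact: cst_continuous.
have p1 : pd j (fun=> 1 : R) = (fun=> 0 : R).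
  by apply/funext => x; rewrite /pd derive_cst.
have := @coef_pd j (fun=> 1) k (th - pi / 2) _ c1 _.
rewrite p1 subrK => /(_ _ _ _) H.
have : freq k j * coef (fun=> 1) k th = 0.
  rewrite -H//; last by move=> x; exact: cst_continuous.
  rewrite /coef (_ : (fun _ => _) = fun=> 0) ?cellint_cst ?mul0r//.
  by apply/funext => x; rewrite mul0r.
by move/eqP; rewrite mulf_eq0 (negbTE kj) => /eqP.
Qed.
End Coefficients.

(** * Uniqueness of Fourier coefficients *)

Section Uniqueness.
Context {R : realType}.
Implicit Types (f g : R * R -> R) (a x : R * R).

(** The powers of this bump are trigonometric polynomials that concentrate at
    [a], and so serve as test functions that only see Fourier coefficients. *)
Definition peak a x : R :=
  (1 + cos (x.1 - a.1)) / 2 * ((1 + cos (x.2 - a.2)) / 2).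

Lemma peakE a x :
  peak a x = (1 + wave (1%Z, 0%Z) a.1 x) / 2 * ((1 + wave (0%Z, 1%Z) a.2 x) / 2).
Proof. by rewrite /peak /wave /dotZ /= !mul1r !mul0r addr0 add0r. Qed.

Lemma half1cos_bnd (t : R) : 0 <= (1 + cos t) / 2 <= 1.
Proof. have := cos_geN1 t; have := cos_le1 t => ? ?; apply/andP; split; lra. Qed.

Lemma peak_ge0 a x : 0 <= peak a x.
Proof.
by have /andP[? _] := half1cos_bnd (x.1 - a.1);
   have /andP[? _] := half1cos_bnd (x.2 - a.2); rewrite mulr_ge0.
Qed.

Lemma half1wave_continuous k th : continuous (fun x => (1 + wave k th x) / 2 : R).
Proof.
apply: mul_continuous; last by move=> x; exact: cst_continuous.
apply: add_continuous; first by move=> x; exact: cst_continuous.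
exact: wave_continuous.
Qed.

Lemma peak_continuous a : continuous (peak a).
Proof.
rewrite (funext (peakE a)); apply: mul_continuous; exact: half1wave_continuous.
Qed.

Lemma peak_a a : peak a a = 1.
Proof. by rewrite /peak !subrr cos0; field. Qed.

Lemma coef0_half1wave g l ph : continuous g -> (forall k th, coef g k th = 0) ->
  forall k th, coef (fun x => g x * ((1 + wave l ph x) / 2)) k th = 0.
Proof.
move=> cg g0 k th.
rewrite (@eq_coef _ _ (fun x => 2^-1 * (g x + g x * wave l ph x))); last first.
  by move=> x; field.
rewrite coefZ; last by apply: add_continuous => //; exact: mulwave_continuous.
rewrite coefD//; last exact: mulwave_continuous.
by rewrite coef_mulwave// !(g0, addr0, mulr0).
Qed.

(** Each factor of the bump only shifts frequencies. *)
Lemma cellint_peak0 f a n : continuous f -> (forall k th, coef f k th = 0) ->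
  cellint (fun x => f x * peak a x ^+ n) = 0.
Proof.
move=> cf f0.
suff [_ H] : continuous (fun x => f x * peak a x ^+ n) /\
    forall k th, coef (fun x => f x * peak a x ^+ n) k th = 0.
  rewrite -[RHS](H 0 0); apply: eq_Rintegral => x _.
  by rewrite /wave /dotZ /= !mul0r addr0 subr0 cos0 mulr1.
elim: n => [|n [cn Hn]].
  by rewrite (_ : (fun x => _) = f)//; apply/funext => x; rewrite expr0 mulr1.
rewrite (_ : (fun x => f x * peak a x ^+ n.+1) = (fun x => (f x * peak a x ^+ n) *
  ((1 + wave (1%Z, 0%Z) a.1 x) / 2) * ((1 + wave (0%Z, 1%Z) a.2 x) / 2))); last first.
  by apply/funext => x; rewrite exprSr peakE; ring.
have c1 : continuous (fun x => (f x * peak a x ^+ n) * ((1 + wave (1%Z, 0%Z) a.1 x) / 2)).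
  by apply: mul_continuous => //; exact: half1wave_continuous.
split; first by apply: mul_continuous => //; exact: half1wave_continuous.
by apply: coef0_half1wave => //; exact: coef0_half1wave.
Qed.

Lemma peak_lt1 a x : 0 < a.1 < 2 * pi -> 0 < a.2 < 2 * pi -> cell x ->
  x <> a -> peak a x < 1.
Proof.
have cos1 (t : R) : - (2 * pi) < t < 2 * pi -> t != 0 -> cos t < 1.
  move=> /andP[t1 t2] t0.
  have c t' : 0 < t' < 2 * pi -> cos t' < 1.
    move=> /andP[s0 s2].
    have s : 0 < sin (t' / 2) by apply: sin_gt0_pi; apply/andP; split; lra.
    have -> : cos t' = 1 - 2 * sin (t' / 2) ^+ 2.
      rewrite {1}(_ : t' = t' / 2 + t' / 2); last by field.
      have := cos2Dsin2 (t' / 2); rewrite cosD; nra.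
    by rewrite ltrBlDr ltrDl mulr_gt0// exprn_gt0.
  have [t'0|t'0|] := ltgtP t 0; last by move/eqP; rewrite (negbTE t0).
    by rewrite -cosN c//; apply/andP; split; lra.
  by rewrite c// t'0.
move=> /andP[a1 a1'] /andP[a2 a2'] [/= ]; rewrite !in_itv /= => /andP[x1 x1'] /andP[x2 x2'] xa.
have /andP[h1 h1'] := half1cos_bnd (x.1 - a.1).
have /andP[h2 h2'] := half1cos_bnd (x.2 - a.2).
have [e1|n1] := eqVneq (x.1 - a.1) 0; last first.
  have c1 : cos (x.1 - a.1) < 1 by apply: cos1 => //; apply/andP; split; lra.
  apply: le_lt_trans (_ : (1 + cos (x.1 - a.1)) / 2 < 1); last by lra.
  by rewrite -[leRHS]mulr1 ler_wpM2l.
have [e2|n2] := eqVneq (x.2 - a.2) 0; last first.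
  have c2 : cos (x.2 - a.2) < 1 by apply: cos1 => //; apply/andP; split; lra.
  apply: le_lt_trans (_ : (1 + cos (x.2 - a.2)) / 2 < 1); last by lra.
  by rewrite -[leRHS]mul1r ler_wpM2r.
case: xa; rewrite (surjective_pairing x) (surjective_pairing a).
by congr (_, _); apply/eqP; rewrite -subr_eq0 ?e1 ?e2.
Qed.

Lemma cellint_ge_box g a (d c : R) : continuous g -> (forall x, 0 <= g x) ->
  0 < d -> 0 <= c ->
  (forall x, `|x.1 - a.1| <= d -> `|x.2 - a.2| <= d -> cell x /\ c <= g x) ->
  c * (2 * d) ^+ 2 <= cellint g.
Proof.
move=> cg g0 d0 c0 H.
pose I (t : R) := `[t - d, t + d]%classic.
have mI t : measurable (I t) by exact: measurable_itv.
have LI t : @lebesgue_measure R (I t) = (2 * d)%:E.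
  rewrite lebesgue_measure_itv /= lte_fin ifT; last by lra.
  by rewrite -EFinD; congr EFin; ring.
have mV : measurable (I a.1 `*` I a.2) by exact: measurableX.
have VH x : (I a.1 `*` I a.2) x -> cell x /\ c <= g x.
  move=> [/=]; rewrite /I /= !in_itv /= => /andP[? ?] /andP[? ?].
  by apply: H; rewrite ler_norml; apply/andP; split; lra.
have AV : area (I a.1 `*` I a.2) = ((2 * d) ^+ 2)%:E.
  rewrite /area product_measure1E; [|exact: mI..].
  by rewrite expr2 EFinM; exact: (f_equal2 _ (LI _) (LI _)).
have mg D : measurable_fun D (EFin \o g).
  by apply: measurable_funTS; apply/measurable_EFinP; exact: continuous_measurable2.
have fn : (\int[area]_(x in cell) (g x)%:E)%E \is a fin_num.
  apply: integrable_fin_num; [exact: measurable_cell|exact: continuous_cell_integrable].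
suff : ((c * (2 * d) ^+ 2)%:E <= \int[area]_(x in cell) (g x)%:E)%E.
  by rewrite -(fineK fn) lee_fin.
apply: (@le_trans _ _ (\int[area]_(x in I a.1 `*` I a.2) (g x)%:E)%E).
  have -> : ((c * (2 * d) ^+ 2)%:E = \int[area]_(x in I a.1 `*` I a.2) c%:E)%E.
    by rewrite integral_cst; [rewrite EFinM -AV|exact: mV].
  apply: ge0_le_integral.
  - exact: mV.
  - by move=> x _; rewrite lee_fin.
  - exact: measurable_cst.
  - exact: mg.
  - by move=> x /VH[_]; rewrite lee_fin.
apply: ge0_subset_integral.
- exact: mV.
- exact: measurable_cell.
- exact: mg.
- by move=> x _; rewrite lee_fin.
- by move=> x /VH[].
Qed.

(** If [f a] were positive, then the integral of [f] against the [n]-th power of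
    the bump would be at least [kap * sg ^+ n], from a small box around [a], up
    to an error [M' * rho ^+ n] with [rho < sg], from the points where [f] is
    smaller than [f a / 2]. It vanishes, so [n] large is a contradiction. *)
Lemma coef0_le0_interior f a : continuous f -> (forall k th, coef f k th = 0) ->
  0 < a.1 < 2 * pi -> 0 < a.2 < 2 * pi -> f a <= 0.
Proof.
move=> cf f0 a1 a2; rewrite leNgt; apply/negP => fa.
pose c := f a.
have [M M0 fM] := continuous_bounded_on compact_cell (continuous_subspaceT cf).
have [rho [r0 r1 Hr]] : exists rho, [/\ 0 < rho, rho < 1 &
    forall x, cell x -> f x <= c / 2 -> peak a x <= rho].
  pose K := cell `&` [set x | f x <= c / 2].
  have cK : compact K.
    apply: compact_closedI; first exact: compact_cell.
    rewrite (_ : [set x | _] = f @^-1` [set y | y <= c / 2])//.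
    by apply: closed_comp => [x _|]; [exact: cf|exact: closed_le].
  have [K0|/set0P K0] := eqVneq K set0.
    exists 2^-1; split; [lra|lra|] => x cx fx.
    by have : K x by []; rewrite K0.
  have [y /set_mem [cy fy] yM] :=
    compact_EVT_max K0 cK (continuous_subspaceT (@peak_continuous a)).
  exists (Num.max 2^-1 (peak a y)); split; [by rewrite lt_max; apply/orP; left; lra| |].
    rewrite gt_max; apply/andP; split; first by lra.
    apply: peak_lt1 => // ya; move: fy; rewrite ya /= /c; move: fa; lra.
  by move=> x cx fx; rewrite le_max yM ?orbT//; apply/mem_set.
pose sg := (1 + rho) / 2.
have sg0 : 0 < sg by rewrite /sg; lra.
have rs : rho < sg by rewrite /sg; lra.
have s1 : sg < 1 by rewrite /sg; lra.
have [d d0 Hd] : exists2 d, 0 < d & forall x, `|x.1 - a.1| <= d -> `|x.2 - a.2| <= d ->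
    cell x /\ sg <= peak a x.
  have : \forall x \near a, [/\ 0 < x.1, x.1 < 2 * pi, 0 < x.2, x.2 < 2 * pi & sg < peak a x].
    have c1 := @continuousT_fst R R; have c2 := @continuousT_snd R R.
    case/andP: a1 => a1 a1'; case/andP: a2 => a2 a2'.
    have sa : sg < peak a a by rewrite peak_a.
    have n1 : \forall x \near a, 0 < x.1 := c1 a _ (lt_nbhsr a1).
    have n2 : \forall x \near a, x.1 < 2 * pi := c1 a _ (lt_nbhsl a1').
    have n3 : \forall x \near a, 0 < x.2 := c2 a _ (lt_nbhsr a2).
    have n4 : \forall x \near a, x.2 < 2 * pi := c2 a _ (lt_nbhsl a2').
    have n5 : \forall x \near a, sg < peak a x := @peak_continuous a a _ (lt_nbhsr sa).
    by near=> x; split; near: x.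
  move=> /nbhs_ballP[e /= e0 eH]; exists (e / 2); first by rewrite divr_gt0.
  move=> x x1 x2; have [] := eH x.
    by split; rewrite /ball /= distrC (le_lt_trans x1,le_lt_trans x2)//; lra.
  move=> ? ? ? ? ?; split; last exact: ltW.
  by split; rewrite /= in_itv /= !ltW.
pose kap := c / 2 * (2 * d) ^+ 2.
have kap0 : 0 < kap by rewrite /kap mulr_gt0 ?exprn_gt0//; [move: fa; rewrite /c; lra|lra].
pose M' := (M + c / 2) * (2 * pi) ^+ 2.
have key n : kap * sg ^+ n <= M' * rho ^+ n.
  have cp : continuous (fun x => peak a x ^+ n).
    apply: (@continuousT_comp _ _ _ (peak a) (fun y : R => y ^+ n)).
      exact: peak_continuous.
    exact: exprn_continuous.
  have p0 x : 0 <= peak a x ^+ n by rewrite exprn_ge0// peak_ge0.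
  have B : sg ^+ n * (2 * d) ^+ 2 <= cellint (fun x => peak a x ^+ n).
    apply: (cellint_ge_box (a := a)) => //; first by rewrite exprn_ge0// ltW.
    move=> x /Hd /[apply] -[? ?]; split => //.
    by rewrite lerXn2r// nnegrE ?peak_ge0// ltW.
  have ccp : continuous (fun x => c / 2 * peak a x ^+ n).
    by apply: mul_continuous => // x; exact: cst_continuous.
  have E : cellint (fun x => c / 2 * peak a x ^+ n - (M + c / 2) * rho ^+ n) <=
           cellint (fun x => f x * peak a x ^+ n).
    apply: le_cellint.
    - by apply: sub_continuous => // x; exact: cst_continuous.
    - exact: mul_continuous.
    move=> x cx; have [fx|fx] := leP (f x) (c / 2); last first.
      have := ler_wpM2r (p0 x) (ltW fx); have : 0 <= (M + c / 2) * rho ^+ n.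
        by rewrite mulr_ge0 ?exprn_ge0// ?(ltW r0)//; move: fa; rewrite -/c; lra.
      lra.
    have pr : peak a x ^+ n <= rho ^+ n by rewrite lerXn2r ?Hr// nnegrE ?peak_ge0// ltW.
    have := fM x cx; rewrite ler_norml => /andP[fx1 fx2].
    have := ler_wpM2r (p0 x) fx1.
    have c20 : 0 <= c / 2 by move: fa; rewrite -/c; lra.
    have := ler_wpM2l c20 pr; have := ler_wpM2l M0 pr; lra.
  rewrite cellint_peak0// cellintB// in E; last by move=> x; exact: cst_continuous.
  rewrite cellintZ// cellint_cst in E.
  have c20 : 0 <= c / 2 by move: fa; rewrite -/c; lra.
  have := ler_wpM2l c20 B; rewrite /kap /M'; move: E; lra.
have q1 : `|rho / sg| < 1.
  have q0 : 0 <= rho / sg by rewrite divr_ge0 ?ltW.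
  by rewrite ger0_norm// ltr_pdivrMr// mul1r.
have M'0 : 0 < M' + 1.
  rewrite /M'; have : 0 <= (M + c / 2) * (2 * pi) ^+ 2; last by lra.
  by rewrite mulr_ge0 ?sqr_ge0//; move: fa; rewrite -/c; lra.
have := cvg_expr q1 => /cvgrPdist_lt/(_ (kap / (M' + 1))) []; first by rewrite divr_gt0.
move=> n _ /(_ n (leqnn n)) /=; rewrite sub0r normrN ger0_norm; last first.
  by rewrite exprn_ge0// divr_ge0// ltW.
rewrite expr_div_n ltr_pdivrMr ?exprn_gt0// mulrAC ltr_pdivlMr// => hn.
have := key n; have : 0 < rho ^+ n by rewrite exprn_gt0.
lra.
Unshelve. all: by end_near. Qed.

Theorem coef_uniq f : continuous f -> periodic2 f ->
  (forall k th, coef f k th = 0) -> forall x, f x = 0.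
Proof.
move=> cf pf f0.
have in0 a : 0 < a.1 < 2 * pi -> 0 < a.2 < 2 * pi -> f a = 0.
  move=> a1 a2; apply/eqP; rewrite eq_le coef0_le0_interior//=.
  rewrite -oppr_le0; apply: (@coef0_le0_interior (fun x => - f x)) => //.
    by move=> x; apply: continuousN; exact: cf.
  move=> k th; rewrite -[RHS](mulr0 (-1)) -(f0 k th) -coefZ//.
  by apply: eq_coef => x; rewrite mulN1r.
have pi0 := @twopi_gt0 R.
(* One coordinate at a time: a continuous function vanishing on an open period
   interval vanishes at its end point, and then everywhere by periodicity. *)
have line (g : R -> R) : continuous g -> (forall t, g (t + 2 * pi) = g t) ->
    (forall t, 0 < t < 2 * pi -> g t = 0) -> forall t, g t = 0.
  move=> cg pg g0.
  have g00 : g 0 = 0.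
    have H1 : g x @[x --> 0^'+] --> g 0 by apply: cvg_at_right_filter; exact: cg.
    have H2 : g x @[x --> 0^'+] --> (0 : R).
      have E : \forall x \near 0^'+, g x = 0.
        near=> x; rewrite g0//; apply/andP; split; first by near: x; exact: nbhs_right_gt.
        by near: x; exact: nbhs_right_lt.
      exact: cvg_near_cst.
    by have := cvg_unique _ H1 H2; apply.
  have g1 t : 0 <= t < 2 * pi -> g t = 0.
    move=> /andP[]; rewrite le_eqVlt => /predU1P[<- //|t0 t1].
    by rewrite g0// t0.
  have gN n t : g (t + n%:R * (2 * pi)) = g t.
    elim: n t => [|n IH] t; first by rewrite mul0r addr0.
    by rewrite -[RHS]IH -[RHS]pg -natr1; congr g; ring.
  have gZ (m : int) t : g (t + m%:~R * (2 * pi)) = g t.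
    case: m => n; first exact: gN.
    by rewrite NegzE mulrNz -[LHS](gN n.+1); congr g; rewrite -pmulrn; ring.
  move=> t; pose m := Num.floor (t / (2 * pi)).
  rewrite -(gZ (- m)); apply: g1.
  have /andP[m1 m2] := floor_itv (t / (2 * pi)).
  rewrite ler_pdivlMr// in m1; rewrite ltr_pdivrMr// intrD in m2.
  rewrite mulrNz; apply/andP; split; rewrite /m; lra.
have s1 (x2 : R) : 0 < x2 < 2 * pi -> forall x1 : R, f (x1, x2) = 0.
  move=> h2; apply: line.
  - apply: (@continuousT_comp _ _ _ (fun t => (t, x2)) f) => //.
    by apply: continuousT_pair => s; [exact: cvg_id|exact: cvg_cst].
  - by move=> t; have [] := pf (t, x2).
  - by move=> t ht; apply: in0.
move=> [x1 x2]; apply: (line (fun t => f (x1, t))).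
- apply: (@continuousT_comp _ _ _ (fun t => (x1, t)) f) => //.
  by apply: continuousT_pair => s; [exact: cvg_cst|exact: cvg_id].
- by move=> t; have [] := pf (x1, t).
- by move=> t ht; exact: s1.
Unshelve. all: by end_near. Qed.
End Uniqueness.

(** * Dominated sums over the lattice *)

Section LatticeSum.
Context {R : realType}.
Local Notation Z2 := (int * int)%type.
Implicit Types (a b M : Z2 -> R).

(** Summability is expressed by finite partial sums, which do not depend on an
    enumeration of the lattice. *)
Definition majorant M (Z : R) :=
  (forall k, 0 <= M k) /\ forall s : seq Z2, uniq s -> \sum_(k <- s) M k <= Z.

Definition zterm a (n : nat) : R := if @pickle_inv Z2 n is Some k then a k else 0.

Definition zsum a : R := limn (series (zterm a)).

Lemma zterm_range a (m n : nat) : exists2 s : seq Z2, uniq s &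
  \sum_(m <= i < n) zterm a i = \sum_(k <- s) a k.
Proof.
exists (pmap (@pickle_inv Z2) (index_iota m n)).
  by apply: (pmap_uniq (@pickle_invK Z2)); exact: iota_uniq.
elim: (index_iota m n) => [|i s IH]; first by rewrite !big_nil.
rewrite big_cons IH /zterm /= .
by case: (pickle_inv i) => [k|] /=; rewrite ?big_cons ?add0r.
Qed.

Lemma zterm_norm_le a M n : (forall k, `|a k| <= M k) -> `|zterm a n| <= zterm M n.
Proof. by move=> aM; rewrite /zterm; case: pickle_inv => [k|] //; rewrite normr0. Qed.

Lemma majorant_series M Z : majorant M Z -> cvgn (series (zterm M)).
Proof.
move=> [M0 MZ]; apply: nondecreasing_is_cvgn.
  apply/nondecreasing_seqP => n; rewrite /series /= big_nat_recr//= lerDl.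
  by rewrite /zterm; case: pickle_inv.
exists Z => _ [n _ <-]; rewrite /series /=.
by have [s us ->] := zterm_range M 0 n; exact: MZ.
Qed.

Lemma dominated_cvg a M Z : majorant M Z -> (forall k, `|a k| <= M k) ->
  cvgn (series (zterm a)).
Proof.
move=> MZ aM; apply: normed_cvg.
apply: series_le_cvg (majorant_series MZ) => n /=; rewrite ?normr_ge0//.
  by rewrite /zterm; case: pickle_inv => // k; apply: (MZ.1).
exact: zterm_norm_le.
Qed.

Lemma zsum_norm_le a M Z : majorant M Z -> (forall k, `|a k| <= M k) -> `|zsum a| <= Z.
Proof.
move=> MZ aM.
have h n : `|series (zterm a) n| <= Z.
  rewrite /series /=; have [s us ->] := zterm_range a 0 n.
  apply: (le_trans (ler_norm_sum _ _ _)); apply: (le_trans _ (MZ.2 s us)).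
  by apply: ler_sum => k _; exact: aM.
have ca := dominated_cvg MZ aM.
rewrite ler_norml; apply/andP; split.
  by apply: limr_ge => //; near=> n; have := h n; rewrite ler_norml => /andP[].
by apply: limr_le => //; near=> n; have := h n; rewrite ler_norml => /andP[].
Unshelve. all: by end_near. Qed.

(** The truncation rank depends on the majorant alone, which makes the exchanges
    of limits below uniform. *)
Lemma zsum_tail M Z (e : R) : majorant M Z -> 0 < e ->
  exists N0, forall a N, (forall k, `|a k| <= M k) -> (N0 <= N)%N ->
    `|zsum a - \sum_(0 <= n < N) zterm a n| <= e.
Proof.
move=> MZ e0; have cM := majorant_series MZ.
have /cvgrPdist_le/(_ _ e0)[N0 _ HN] := cM.
exists N0 => a N aM N0N; have ca := dominated_cvg MZ aM.
have h m : (N <= m)%N -> `|series (zterm a) m - \sum_(0 <= n < N) zterm a n| <= e.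
  move=> Nm; rewrite /series /= (@big_cat_nat _ _ _ N)//= addrAC subrr add0r.
  apply: (le_trans (ler_norm_sum _ _ _)).
  have h1 : \sum_(N <= i < m) `|zterm a i| <= \sum_(N <= i < m) zterm M i.
    by apply: ler_sum => i _; exact: zterm_norm_le.
  apply: (le_trans h1); have := HN N N0N; rewrite /series /=.
  apply: le_trans; apply: le_trans (ler_norm _).
  rewrite lerBrDl -(@big_cat_nat _ _ _ N)//=.
  apply: nondecreasing_cvgn_le => //.
  apply/nondecreasing_seqP => n; rewrite /series /= big_nat_recr//= lerDl.
  by rewrite /zterm; case: pickle_inv => // k; apply: (MZ.1).
have c2 : series (zterm a) m - \sum_(0 <= n < N) zterm a n @[m --> \oo] -->
    zsum a - \sum_(0 <= n < N) zterm a n.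
  by apply: cvgB => //; exact: cvg_cst.
rewrite -(cvg_lim _ (cvg_norm c2))//.
apply: limr_le; first by apply/cvg_ex; eexists; exact: cvg_norm c2.
near=> m; apply: h; near: m; exact: nbhs_infty_ge.
Unshelve. all: by end_near. Qed.

(** Dominated convergence: the tails are uniformly small, and the truncated sums
    converge. *)
Lemma zsum_cvg (T : Type) (F : set_system T) {FF : Filter F} (a : T -> Z2 -> R)
    (l : Z2 -> R) M Z : majorant M Z ->
  (\forall x \near F, forall k, `|a x k| <= M k) -> (forall k, `|l k| <= M k) ->
  (forall k, a x k @[x --> F] --> l k) -> zsum (a x) @[x --> F] --> zsum l.
Proof.
move=> MZ aM lM al; apply/cvgrPdist_le => e e0.
have e30 : 0 < e / 3 by rewrite divr_gt0.
have [N /(_ _ N _ (leqnn N)) HN] := zsum_tail MZ e30.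
have c : \sum_(0 <= n < N) zterm (a x) n @[x --> F] --> \sum_(0 <= n < N) zterm l n.
  elim: N {HN} => [|N IH].
    under eq_fun do rewrite big_geq//.
    by rewrite big_geq//; exact: cvg_cst.
  under eq_fun do rewrite big_nat_recr//=.
  rewrite big_nat_recr//=; apply: cvgD => //.
  by rewrite /zterm; case: pickle_inv => [k|]; [exact: al|exact: cvg_cst].
move/cvgrPdist_le : c => /(_ _ e30) c.
near=> x.
have h1 := HN _ lM.
have h2 : `|zsum (a x) - \sum_(0 <= n < N) zterm (a x) n| <= e / 3.
  by apply: HN; near: x.
have h3 : `|\sum_(0 <= n < N) zterm l n - \sum_(0 <= n < N) zterm (a x) n| <= e / 3.
  by near: x.
move: h1 h2 h3; rewrite !ler_norml => /andP[? ?] /andP[? ?] /andP[? ?].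
apply/andP; split; lra.
Unshelve. all: by end_near. Qed.

Lemma eq_zsum a b : a =1 b -> zsum a = zsum b.
Proof. by move=> /funext ->. Qed.

Lemma zsumD a b M Z : majorant M Z -> (forall k, `|a k| <= M k) ->
  (forall k, `|b k| <= M k) -> zsum (fun k => a k + b k) = zsum a + zsum b.
Proof.
move=> MZ aM bM; rewrite /zsum -limD; [|exact: dominated_cvg MZ _..].
congr (limn _); apply/funext => n.
transitivity (series (zterm a) n + series (zterm b) n) => //.
rewrite /series /= -big_split /=.
by apply: eq_bigr => i _; rewrite /zterm; case: pickle_inv => //; rewrite addr0.
Qed.

Lemma zsumZ a (c : R) M Z : majorant M Z -> (forall k, `|a k| <= M k) ->
  zsum (fun k => c * a k) = c * zsum a.
Proof.
move=> MZ aM; have ca := dominated_cvg MZ aM.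
apply: cvg_lim => //.
rewrite (_ : series _ = fun n => c * series (zterm a) n); first exact: cvgMr.
apply/funext => n; rewrite /series /= mulr_sumr.
by apply: eq_bigr => i _; rewrite /zterm; case: pickle_inv => //; rewrite mulr0.
Qed.

Lemma zsum_delta k0 (c : R) : zsum (fun k => if k == k0 then c else 0) = c.
Proof.
apply: cvg_lim => //; apply: cvg_near_cst; near=> n.
have kn : (pickle k0 < n)%N by near: n; exact: nbhs_infty_gt.
rewrite /series /= (bigD1_seq (pickle k0)) ?mem_index_iota ?iota_uniq//=.
rewrite {1}/zterm pickleK_inv eqxx big1 ?addr0// => i /eqP ik.
rewrite /zterm; case E: (pickle_inv i) => [k|]//.
case: eqP => // kk; case: ik; have := @pickle_invK Z2 i; rewrite E /= => <-.
by rewrite kk.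
Unshelve. all: by end_near. Qed.

Lemma majorantZ M Z (c : R) : 0 <= c -> majorant M Z -> majorant (fun k => c * M k) (c * Z).
Proof.
move=> c0 [M0 MZ]; split=> [k|s us]; first by rewrite mulr_ge0.
by rewrite -mulr_sumr ler_wpM2l// MZ.
Qed.

Lemma majorantD M1 Z1 M2 Z2 : majorant M1 Z1 -> majorant M2 Z2 ->
  majorant (fun k => M1 k + M2 k) (Z1 + Z2).
Proof.
move=> [M10 MZ1] [M20 MZ2]; split=> [k|s us]; first by rewrite addr_ge0.
by rewrite big_split /= lerD// ?MZ1 ?MZ2.
Qed.

Lemma majorant_inj M Z (p : Z2 -> Z2) : injective p -> majorant M Z ->
  majorant (fun k => M (p k)) Z.
Proof.
move=> ip [M0 MZ]; split=> [k|s us]; first exact: M0.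
by rewrite -(big_map p xpredT M) MZ// map_inj_uniq.
Qed.

Lemma majorant_le M Z M' : majorant M Z -> (forall k, 0 <= M' k <= M k) -> majorant M' Z.
Proof.
move=> [M0 MZ] h; split=> [k|s us]; first by case/andP: (h k).
by apply: le_trans (MZ s us); apply: ler_sum => k _; case/andP: (h k).
Qed.

(** Summation and integration are exchanged through the uniform truncation
    error. *)
Lemma cellint_zsum (g : Z2 -> R * R -> R) M Z : majorant M Z ->
  (forall k, continuous (g k)) -> (forall k x, `|g k x| <= M k) ->
  continuous (fun x => zsum (g^~ x)) /\
  cellint (fun x => zsum (g^~ x)) = zsum (fun k => cellint (g k)).
Proof.
move=> MZ cg gM.
have cG : continuous (fun x => zsum (g^~ x)).
  move=> x; apply: (zsum_cvg MZ) => //; first by near=> y => k; exact: gM.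
  by move=> k; exact: cg.
split=> //.
have k0 : 0 < (2 * pi) ^+ 2 :> R by rewrite exprn_gt0// twopi_gt0.
have cN N : continuous (fun x => \sum_(0 <= n < N) zterm (g^~ x) n).
  apply: continuous_bigsum => n; rewrite /zterm.
  by case: pickle_inv => [k|]; [exact: cg|move=> x; exact: cvg_cst].
have E N : cellint (fun x => \sum_(0 <= n < N) zterm (g^~ x) n) =
    \sum_(0 <= n < N) zterm (fun k => cellint (g k)) n.
  rewrite cellint_sum; last first.
    by move=> n; rewrite /zterm; case: pickle_inv => [k|]; [exact: cg|move=> x; exact: cvg_cst].
  apply: eq_bigr => n _; rewrite /zterm; case: pickle_inv => [k|] //.
  by rewrite cellint_cst mul0r.
have MZ' := majorantZ (ltW k0) MZ.
have aM' k : `|cellint (g k)| <= (2 * pi) ^+ 2 * M k.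
  by rewrite mulrC; exact: cellint_norm_le.
apply/eqP; rewrite -subr_eq0 -normr_le0; apply/ler_addgt0Pl => e e0; rewrite addr0.
pose c := 1 + (2 * pi) ^+ 2 : R.
have c0 : 0 < c by rewrite addr_gt0.
have ec : 0 < e / c by rewrite divr_gt0.
have [N1 H1] := zsum_tail MZ ec; have [N2 H2] := zsum_tail MZ' ec.
pose N := maxn N1 N2.
have {}H1 x : `|zsum (g^~ x) - \sum_(0 <= n < N) zterm (g^~ x) n| <= e / c.
  by apply: H1 => [k|]; [exact: gM|exact: leq_maxl].
have {}H2 := H2 _ N aM' (leq_maxr _ _).
have : `|cellint (fun x => zsum (g^~ x) - \sum_(0 <= n < N) zterm (g^~ x) n)| <=
    e / c * (2 * pi) ^+ 2.
  by apply: cellint_norm_le => //; exact: sub_continuous.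
rewrite cellintB// E => H3.
have -> : e = e / c + e / c * (2 * pi) ^+ 2.
  by apply/esym; rewrite -[X in X + _]mulr1 -mulrDr divfK// gt_eqF.
move: H2 H3; rewrite !ler_norml => /andP[? ?] /andP[? ?]; apply/andP; split; lra.
Unshelve. all: by end_near. Qed.

(** Termwise differentiation: the difference quotients are dominated by the
    majorant of the derivatives, by the mean value theorem. *)
Lemma zsum_derive (phi dphi : Z2 -> R -> R) (lo hi s0 : R) M0 Z0 M Z :
  majorant M0 Z0 -> majorant M Z -> lo < s0 < hi ->
  (forall k s, lo < s < hi -> is_derive s 1 (phi k) (dphi k s)) ->
  (forall k s, lo < s < hi -> `|phi k s| <= M0 k) ->
  (forall k s, lo < s < hi -> `|dphi k s| <= M k) ->
  is_derive s0 1 (fun s => zsum (phi^~ s)) (zsum (dphi^~ s0)).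
Proof.
move=> MZ0 MZ s0I dphiP bphi bdphi.
have nI : \forall h \near (0 : R)^', lo < h + s0 < hi.
  have /andP[s0a s0b] := s0I.
  apply: nbhs_dnbhs.
  have n1 : \forall h \near (0 : R), lo - s0 < h by apply: lt_nbhsr; lra.
  have n2 : \forall h \near (0 : R), h < hi - s0 by apply: lt_nbhsl; lra.
  near=> h.
  have h1 : lo - s0 < h by near: h.
  have h2 : h < hi - s0 by near: h.
  by apply/andP; split; lra.
have mvt k x y : lo < x -> x < y -> y < hi -> `|phi k y - phi k x| <= M k * (y - x).
  move=> lx xy yh.
  have [] := @MVT _ (phi k) (dphi k) x y xy.
  - by move=> z; rewrite in_itv /= => /andP[xz zy]; apply: dphiP; apply/andP; split; lra.
  - apply: derivable_within_continuous => z; rewrite in_itv /= => /andP[xz zy].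
    by apply: ex_derive; apply: dphiP; apply/andP; split; lra.
  move=> z; rewrite in_itv /= => /andP[xz zy] ->.
  rewrite normrM (ger0_norm (x := y - x)); last by lra.
  by rewrite ler_wpM2r ?bdphi//; [lra|apply/andP; split; lra].
pose quot h k := h^-1 * (phi k (h + s0) - phi k s0).
have bq h k : h != 0 -> lo < h + s0 < hi -> `|quot h k| <= M k.
  move=> h0 /andP[hI1 hI2]; have /andP[s0a s0b] := s0I.
  rewrite /quot normrM normfV mulrC ler_pdivrMr ?normr_gt0//.
  have [h0'|h0'|h0'] := ltgtP h 0; last by rewrite h0' eqxx in h0.
  - by rewrite distrC (le_trans (mvt _ _ _ _ _ _))//; [lra|rewrite ltr0_norm//; lra].
  - by rewrite (le_trans (mvt _ _ _ _ _ _))//; [lra|rewrite gtr0_norm//; lra].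
have C : zsum (quot h) @[h --> 0^'] --> zsum (dphi^~ s0).
  apply: (zsum_cvg MZ).
  - near=> h => k; apply: bq; first by near: h; exact: nbhs_dnbhs_neq.
    by near: h.
  - by move=> k; exact: bdphi.
  - move=> k; have [/cvg_ex[l cl] dl] := dphiP k s0 s0I.
    move: dl; rewrite /derive (cvg_lim _ cl)// => <-.
    by move: cl; under eq_fun do rewrite /= [_ *: 1]mulr1.
have E : \forall h \near (0 : R)^', zsum (quot h) =
    h^-1 *: (((fun s => zsum (phi^~ s)) \o shift s0) (h *: 1) - zsum (phi^~ s0)).
  near=> h; rewrite /= [_ *: 1]mulr1.
  have hI : lo < h + s0 < hi by near: h.
  rewrite /GRing.scale /= -mulN1r -(zsumZ _ MZ0); last by move=> k; exact: bphi.
  rewrite -(zsumD MZ0); last 2 first.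
  - by move=> k; exact: bphi.
  - by move=> k; rewrite mulN1r normrN; exact: bphi.
  rewrite -(zsumZ _ (majorantD MZ0 MZ0)); last first.
    by move=> k; rewrite mulN1r (le_trans (ler_normB _ _))// lerD//; exact: bphi.
  by apply: eq_zsum => k; rewrite mulN1r.
have {}C : h^-1 *: (((fun s => zsum (phi^~ s)) \o shift s0) (h *: 1) - zsum (phi^~ s0))
    @[h --> (0 : R)^'] --> zsum (dphi^~ s0).
  by apply: cvg_trans C; apply: near_eq_cvg.
apply: DeriveDef; last exact: cvg_lim.
by apply/cvg_ex; exists (zsum (dphi^~ s0)).
Unshelve. all: by end_near. Qed.

End LatticeSum.

(** * Lattice weights *)

Section Weights.
Context {R : realType}.
Local Notation Z2 := (int * int)%type.
Implicit Types k l : Z2.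

Definition bracket k : R := 1 + k.1%:~R ^+ 2 + k.2%:~R ^+ 2.

Lemma bracket_ge1 k : 1 <= bracket k.
Proof. by rewrite /bracket -addrA lerDl addr_ge0// sqr_ge0. Qed.

Lemma bracket_gt0 k : 0 < bracket k.
Proof. exact: lt_le_trans ltr01 (bracket_ge1 k). Qed.

Lemma bracketN k : bracket (- k) = bracket k.
Proof. by rewrite /bracket /= !mulrNz !sqrrN. Qed.

Lemma sum_uniq_sub (I : eqType) (s t : seq I) (F : I -> R) : uniq s -> uniq t ->
  {subset s <= t} -> (forall i, 0 <= F i) -> \sum_(i <- s) F i <= \sum_(i <- t) F i.
Proof.
move=> us ut st F0.
have p : perm_eq s [seq i <- t | i \in s].
  apply: uniq_perm => //; first exact: seq.filter_uniq.
  by move=> i; rewrite mem_filter /=; have [/st->|] := boolP (i \in s).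
rewrite (perm_big _ p) big_filter [leLHS]big_mkcond /=.
by apply: ler_sum => i _; case: ifP.
Qed.

(** Telescoping: each term is at most [4 * (1 / (n + 1) - 1 / (n + 2))]. *)
Lemma sum_inv_sq_le (n : nat) : \sum_(i <- iota 0 n) (1 + i%:R ^+ 2)^-1 <= 4 :> R.
Proof.
suff H : \sum_(0 <= i < n) (1 + i%:R ^+ 2)^-1 <= 4 * (1 - n.+1%:R^-1) :> R.
  rewrite [X in \sum_(_ <- X) _](_ : _ = index_iota 0 n); last by rewrite /index_iota subn0.
  by apply: (le_trans H); rewrite -[leRHS]mulr1 ler_wpM2l// gerBl invr_ge0.
elim: n => [|n IH]; first by rewrite big_geq// invr1 subrr mulr0.
rewrite big_nat_recr//=; apply: (le_trans (lerD IH (lexx _))).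
suff h : (1 + n%:R ^+ 2)^-1 <= 4 * (n.+1%:R^-1 - n.+2%:R^-1) :> R.
  by move: h; move: (_^-1) (n.+1%:R^-1 : R) (n.+2%:R^-1 : R) => A B C; lra.
rewrite -(addn1 n.+1) -(addn1 n) !natrD; have := ler0n R n; move: (n%:R : R) => x x0.
have -> : (x + 1)^-1 - (x + 1 + 1)^-1 = ((x + 1) * (x + 2))^-1.
  by field; apply/andP; split; rewrite gt_eqF//; lra.
rewrite -[4]invrK -invfM lef_pV2 ?posrE; [|nra|nra].
nra.
Qed.

Definition int_range (n : nat) : seq int :=
  [seq Posz i | i <- iota 0 n] ++ [seq Negz i | i <- iota 0 n].

Lemma int_range_uniq n : uniq (int_range n).
Proof.
rewrite cat_uniq !map_inj_uniq ?iota_uniq ?andbT /=; [|by move=> ? ? []..].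
by apply/hasPn => _ /mapP[i _ ->]; apply/negP => /mapP[].
Qed.

Lemma mem_int_range (m : int) n : (absz m < n)%N -> m \in int_range n.
Proof.
rewrite mem_cat; case: m => i /= h; apply/orP.
  by left; apply/mapP; exists i; rewrite ?mem_iota.
by right; apply/mapP; exists i; rewrite ?mem_iota//= (ltn_trans _ h).
Qed.

Lemma sum_int_range_le n : \sum_(m <- int_range n) (1 + m%:~R ^+ 2)^-1 <= 8 :> R.
Proof.
rewrite big_cat /= !big_map; have h := sum_inv_sq_le n.
have h2 : \sum_(i <- iota 0 n) (1 + (Negz i)%:~R ^+ 2)^-1 <=
    \sum_(i <- iota 0 n) (1 + i%:R ^+ 2)^-1 :> R.
  apply: ler_sum => i _; rewrite NegzE mulrNz sqrrN lef_pV2 ?posrE ?ltr_pwDl ?sqr_ge0//.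
  by rewrite lerD2l lerXn2r ?nnegrE ?ler0n// -pmulrn ler_nat.
by have := lerD h (le_trans h2 h); lra.
Qed.

(** The square of the bracket dominates a product of one-dimensional weights,
    so its inverse is summable over the planar lattice. *)
Lemma majorant_bracket2 : majorant (fun k => (bracket k ^+ 2)^-1) 64.
Proof.
split=> [k|s us]; first by rewrite invr_ge0 sqr_ge0.
pose n := (\max_(k <- s) (absz k.1 + absz k.2)).+1.
have sub : {subset s <= [seq (a, b) | a <- int_range n, b <- int_range n]}.
  move=> [a b] ks; apply/allpairsP; exists (a, b) => /=.
  have le : (absz a + absz b < n)%N.
    by rewrite ltnS (@leq_bigmax_seq _ s xpredT (fun k : Z2 => (absz k.1 + absz k.2)%N) (a, b)).
  by split=> //; apply: mem_int_range; apply: leq_ltn_trans le; rewrite ?leq_addr ?leq_addl.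
have ub : uniq [seq (a, b) | a <- int_range n, b <- int_range n].
  by apply: allpairs_uniq; rewrite ?int_range_uniq// => -[? ?] [? ?].
apply: (le_trans (sum_uniq_sub us ub sub _)) => [k|].
  by rewrite invr_ge0 sqr_ge0.
rewrite big_allpairs /=.
have w0 (m : int) : 0 < 1 + m%:~R ^+ 2 :> R by rewrite ltr_pwDl ?sqr_ge0.
apply: (@le_trans _ _ (\sum_(a <- int_range n) \sum_(b <- int_range n)
   (1 + a%:~R ^+ 2)^-1 * (1 + b%:~R ^+ 2)^-1)).
  apply: ler_sum => a _; apply: ler_sum => b _.
  rewrite -invfM lef_pV2 ?posrE ?mulr_gt0 ?exprn_gt0 ?bracket_gt0// /bracket /=.
  have := sqr_ge0 (a%:~R : R); have := sqr_ge0 (b%:~R : R).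
  by move: (a%:~R ^+ 2 : R) (b%:~R ^+ 2 : R) => A B; nra.
under eq_bigr do rewrite -mulr_sumr.
rewrite -mulr_suml (_ : 64 = 8 * 8 :> R); last by ring.
by apply: ler_pM; rewrite ?sum_int_range_le//; apply: sumr_ge0 => m _;
  rewrite invr_ge0 ltW.
Qed.

Lemma freq_sq_le k j : freq k j ^+ 2 <= bracket k :> R.
Proof.
rewrite /freq /bracket; have := sqr_ge0 (k.1%:~R : R); have := sqr_ge0 (k.2%:~R : R).
by case: ifP => _; lra.
Qed.

Lemma freq_norm_le k j : `|freq k j| <= Num.sqrt (bracket k) :> R.
Proof. by rewrite -sqrtr_sqr ler_wsqrtr// freq_sq_le. Qed.

Lemma bracket_add k l : bracket (k + l) <= 2 * (bracket k + bracket l).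
Proof.
rewrite /bracket /= !intrD.
have := sqr_ge0 (k.1%:~R - l.1%:~R : R); have := sqr_ge0 (k.2%:~R - l.2%:~R : R).
move: (k.1%:~R : R) (k.2%:~R : R) (l.1%:~R : R) (l.2%:~R : R) => a b c d.
rewrite !sqrrB !sqrrD; lra.
Qed.

(** A Peetre-type inequality, from [bracket_add] and the convexity of the cube; it
    makes a convolution of inverse cubes of brackets decay like an inverse
    cube. *)
Lemma bracket_conv k l : (bracket k ^+ 3)^-1 * (bracket l ^+ 3)^-1 <=
  32 * (bracket (k + l) ^+ 3)^-1 * ((bracket k ^+ 3)^-1 + (bracket l ^+ 3)^-1).
Proof.
have a0 := bracket_gt0 k; have b0 := bracket_gt0 l; have c0 := bracket_gt0 (k + l).
have h := bracket_add k l; move: (bracket k) (bracket l) (bracket (k + l)) a0 b0 c0 h.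
move=> a b c a0 b0 c0 h.
have h3 : c ^+ 3 <= 32 * (a ^+ 3 + b ^+ 3).
  have e : c ^+ 3 <= (2 * (a + b)) ^+ 3 by rewrite lerXn2r ?nnegrE; lra.
  apply: (le_trans e).
  have -> : 32 * (a ^+ 3 + b ^+ 3) = (2 * (a + b)) ^+ 3 + 24 * ((a + b) * (a - b) ^+ 2) by ring.
  by rewrite lerDl mulr_ge0// mulr_ge0 ?sqr_ge0// addr_ge0// ltW.
have A0 : 0 < a ^+ 3 by rewrite exprn_gt0.
have B0 : 0 < b ^+ 3 by rewrite exprn_gt0.
have C0 : 0 < c ^+ 3 by rewrite exprn_gt0.
have -> : (a ^+ 3)^-1 * (b ^+ 3)^-1 = (c ^+ 3)^-1 * (c ^+ 3 * ((a ^+ 3)^-1 * (b ^+ 3)^-1)).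
  by rewrite mulrA mulVf ?mul1r// gt_eqF.
rewrite [leRHS](_ : _ = (c ^+ 3)^-1 * (32 * ((a ^+ 3)^-1 + (b ^+ 3)^-1))); last by ring.
rewrite ler_wpM2l ?invr_ge0 ?(ltW C0)//.
have -> : 32 * ((a ^+ 3)^-1 + (b ^+ 3)^-1) =
    (32 * (a ^+ 3 + b ^+ 3)) * ((a ^+ 3)^-1 * (b ^+ 3)^-1).
  by field; rewrite !gt_eqF.
by rewrite ler_wpM2r// mulr_ge0// invr_ge0 ltW.
Qed.

Lemma majorant_bracket3 : majorant (fun k => (bracket k ^+ 3)^-1) 64.
Proof.
apply: majorant_le majorant_bracket2 _ => k.
rewrite invr_ge0 exprn_ge0 ?(ltW (bracket_gt0 _))//= lef_pV2 ?posrE ?exprn_gt0 ?bracket_gt0//.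
by rewrite ler_weXn2l ?bracket_ge1.
Qed.
End Weights.

(** * Synthesis of functions from coefficients *)

Section Synthesis.
Context {R : realType}.
Local Notation Z2 := (int * int)%type.
Implicit Types (A : Z2 -> R -> R) (M : Z2 -> R) (f g : R * R -> R).

(** The families [k, th |-> A k th] that arise as Fourier coefficients of real
    functions: the phase enters through a single sinusoid, and opposite
    frequencies carry the same information. *)
Definition trig A := (forall k th, A k th = A k 0 * cos th + A k (pi / 2) * sin th) /\
  forall k th, A (- k) (- th) = A k th.

(** The Fourier series: a coefficient evaluated at the phase [k.x] is the real
    part of its complex counterpart times [e^(i k.x)]. *)
Definition synth A (x : R * R) : R :=
  ((2 * pi) ^+ 2)^-1 * zsum (fun k => A k (dotZ k x)).

Definition dominated A M := forall k th, `|A k th| <= M k.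

Definition dcoef (j : 'I_2) A : Z2 -> R -> R :=
  fun k th => freq k j * A k (th + pi / 2).

Lemma trig_coef f : continuous f -> trig (coef f).
Proof. by move=> cf; split=> k th; [exact: coef_trig|exact: coef_opp]. Qed.

Lemma trig_addpi A k th : trig A -> A k (th + pi) = - A k th.
Proof.
by move=> [H _]; rewrite H [in RHS]H cosDpi sinDpi; ring.
Qed.

Lemma trig_dcoef j A : trig A -> trig (dcoef j A).
Proof.
move=> tA; have [H1 H2] := tA; split=> k th; rewrite /dcoef.
  rewrite add0r [A k (th + _)]H1 cosDpihalf sinDpihalf.
  by rewrite [A k (pi / 2 + _)]H1 cosDpihalf sinDpihalf cos_pihalf sin_pihalf; ring.
have -> : freq (- k) j = - freq k j :> R.
  by rewrite /freq; case: ifP => _; rewrite /= mulrNz.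
rewrite (_ : - th + pi / 2 = - (th - pi / 2)) ?H2; last by ring.
by rewrite mulNr -mulrN -trig_addpi//; congr (_ * A _ _); field.
Qed.

Lemma trig_lin A B (a b : R) : trig A -> trig B ->
  trig (fun k th => a * A k th + b * B k th).
Proof.
move=> [A1 A2] [B1 B2]; split=> k th; last by rewrite A2 B2.
by rewrite [A k th]A1 [B k th]B1; ring.
Qed.

Lemma trig_mulfreq A (w : Z2 -> R) : (forall k, w (- k) = w k) -> trig A ->
  trig (fun k th => w k * A k th).
Proof.
move=> wN [A1 A2]; split=> k th; last by rewrite A2 wN.
by rewrite [A k th]A1; ring.
Qed.

Lemma trig_sum (I : Type) (s : seq I) (F : I -> Z2 -> R -> R) :
  (forall i, trig (F i)) -> trig (fun k th => \sum_(i <- s) F i k th).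
Proof.
move=> tF; split=> k th; last by apply: eq_bigr => i _; exact: (tF i).2.
rewrite !mulr_suml -big_split /=; apply: eq_bigr => i _; exact: (tF i).1.
Qed.

Lemma trig_lim (T : Type) (F : set_system T) {FF : ProperFilter F} (a : T -> Z2 -> R -> R) A :
  (\forall t \near F, trig (a t)) -> (forall k th, a t k th @[t --> F] --> A k th) ->
  trig A.
Proof.
move=> ta aA; split=> k th.
  have H : a t k 0 * cos th + a t k (pi / 2) * sin th @[t --> F] -->
      A k 0 * cos th + A k (pi / 2) * sin th.
    by apply: cvgD; apply: cvgMl.
  apply: (cvg_unique _ (aA k th)) => //.
  apply: cvg_trans H; apply: near_eq_cvg; near=> t; apply: esym.
  have tt : trig (a t) by near: t.
  exact: tt.1.
apply: (cvg_unique _ (aA (- k) (- th))) => //.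
apply: cvg_trans (aA k th); apply: near_eq_cvg; near=> t.
have tt : trig (a t) by near: t.
by rewrite tt.2.
Unshelve. all: by end_near. Qed.

(** For fixed [k], the term depends on [t] through two coefficients only, since
    the phase enters through a sinusoid; this is what makes it jointly
    continuous. *)
Lemma synth_jcont (A : R -> Z2 -> R -> R) M Z : majorant M Z ->
  (forall t, trig (A t)) -> (forall t, dominated (A t) M) ->
  (forall k th, continuous (fun t => A t k th)) -> jcont (fun t => synth (A t)).
Proof.
move=> MZ tA dA cA; rewrite /jcont /synth.
apply: mul_continuous; first by move=> z; exact: cst_continuous.
move=> z; apply: (zsum_cvg MZ).
- by near=> y => k; exact: dA.
- by move=> k; exact: dA.
move=> k; under eq_fun do rewrite (tA _).1.
rewrite (tA _).1.
have cd : continuous (fun y : R * (R * R) => dotZ k y.2).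
  apply: continuousT_comp; [exact: continuousT_snd|exact: dotZ_continuous].
have c1 th : continuous (fun y : R * (R * R) => A y.1 k th).
  by apply: (@continuousT_comp _ _ _ fst (fun t => A t k th)) => //; exact: continuousT_fst.
have c2 : continuous (fun y : R * (R * R) => cos (dotZ k y.2)).
  by apply: continuousT_comp cd _; exact: continuous_cos.
have c3 : continuous (fun y : R * (R * R) => sin (dotZ k y.2)).
  by apply: continuousT_comp cd _; exact: continuous_sin.
exact: (add_continuous (mul_continuous (c1 _) c2) (mul_continuous (c1 _) c3)).
Unshelve. all: by end_near. Qed.

Lemma synth_continuous A M Z : majorant M Z -> trig A -> dominated A M ->
  continuous (synth A).
Proof.
move=> MZ tA dA; apply: (@jcont_slice _ (fun=> synth A) 0).
by apply: (synth_jcont MZ) => // k th t; exact: cst_continuous.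
Qed.

Lemma trig_dotZ A k : trig A -> periodic2 (fun x => A k (dotZ k x)) .
Proof.
move=> [tA _] x; rewrite tA [in X in _ /\ X = _]tA [A k (dotZ k x)]tA.
have W th : cos (dotZ k x - th) = wave k th x by [].
have Cx y : cos (dotZ k y) = wave k 0 y by rewrite /wave subr0.
have Sx y : sin (dotZ k y) = wave k (pi / 2) y by rewrite /wave cosBpihalf.
rewrite !Cx !Sx.
by rewrite !(wave_period k _ x).1 !(wave_period k _ x).2.
Qed.

Lemma synth_period A : trig A -> periodic2 (synth A).
Proof.
move=> tA x; rewrite /synth; split; congr (_ * _); apply: eq_zsum => k.
  by have [] := trig_dotZ k tA x.
by have [] := trig_dotZ k tA x.
Qed.

Lemma trigE A k x : trig A ->
  A k (dotZ k x) = A k 0 * wave k 0 x + A k (pi / 2) * wave k (pi / 2) x.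
Proof. by move=> tA; rewrite tA.1 /wave subr0 cosBpihalf. Qed.

Lemma coef_wave k th l ph : coef (wave l ph) k th =
  2^-1 * ((if l == - k then (2 * pi) ^+ 2 * cos (th + ph) else 0) +
          (if l == k then (2 * pi) ^+ 2 * cos (th - ph) else 0)) :> R.
Proof.
have -> : coef (wave l ph) k th = coef (fun x => 1 * wave l ph x) k th.
  by apply: eq_coef => x; rewrite mul1r.
rewrite coef_mulwave; last by move=> x; exact: cst_continuous.
have e1 : (k + l == 0) = (l == - k) by rewrite addrC addr_eq0.
have e2 : (k - l == 0) = (l == k) by rewrite subr_eq0 eq_sym.
by rewrite !coef_cst1 e1 e2.
Qed.

(** Orthogonality of the waves, applied term by term. *)
Lemma coef_synth A M Z k th : majorant M Z -> trig A -> dominated A M ->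
  coef (synth A) k th = A k th.
Proof.
move=> MZ tA dA.
have cs := synth_continuous MZ tA dA.
have pi2 : (2 * pi) ^+ 2 != 0 :> R by rewrite expf_neq0// gt_eqF ?twopi_gt0.
pose g l x := A l (dotZ l x) * wave k th x.
have cA l : continuous (fun x => A l (dotZ l x)).
  rewrite (_ : (fun x => _) = (fun x => A l 0 * wave l 0 x + A l (pi / 2) * wave l (pi / 2) x)).
    apply: add_continuous; apply: mul_continuous; try exact: wave_continuous;
    by move=> x; exact: cst_continuous.
  by apply/funext => x; exact: trigE.
have cg l : continuous (g l) by exact: mulwave_continuous.
have gM l x : `|g l x| <= M l.
  by rewrite /g normrM -[leRHS]mulr1 ler_pM// ?wave_norm_le// dA.
have [cz zE] := cellint_zsum MZ cg gM.
have E0 : coef (synth A) k th = ((2 * pi) ^+ 2)^-1 * cellint (fun x => zsum (g^~ x)).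
  rewrite -cellintZ//; apply: eq_Rintegral => x _; rewrite /synth -mulrA; congr (_ * _).
  rewrite mulrC -(zsumZ _ MZ); last by move=> l; exact: dA.
  by apply: eq_zsum => l; rewrite mulrC.
have E1 l : cellint (g l) = 2^-1 * (2 * pi) ^+ 2 *
   ((if l == - k then A k th else 0) + (if l == k then A k th else 0)).
  have -> : cellint (g l) = A l 0 * coef (wave l 0) k th + A l (pi / 2) * coef (wave l (pi / 2)) k th.
    rewrite -!coefZ; [|exact: wave_continuous..].
    rewrite -coefD; [|by apply: mul_continuous; [move=> x; exact: cst_continuous|exact: wave_continuous]..].
    by apply: eq_coef => x; rewrite trigE.
  rewrite !coef_wave addr0 subr0 cosDpihalf cosBpihalf.
  have [l1|] := eqVneq l (- k); have [l2|] := eqVneq l k => //.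
  - have ANk : A l 0 * cos th - A l (pi / 2) * sin th = A k th.
      have := tA.1 l (- th); rewrite cosN sinN mulrN => <-.
      by rewrite l1 tA.2.
    have Ak : A l 0 * cos th + A l (pi / 2) * sin th = A k th by rewrite -tA.1 l2.
    transitivity (2^-1 * (2 * pi) ^+ 2 * ((A l 0 * cos th - A l (pi / 2) * sin th) +
       (A l 0 * cos th + A l (pi / 2) * sin th))); first by ring.
    by rewrite ANk Ak.
  - have ANk : A l 0 * cos th - A l (pi / 2) * sin th = A k th.
      have := tA.1 l (- th); rewrite cosN sinN mulrN => <-.
      by rewrite l1 tA.2.
    by rewrite -ANk => _; ring.
  - have Ak : A l 0 * cos th + A l (pi / 2) * sin th = A k th by rewrite -tA.1 l2.
    by rewrite -Ak => _; ring.
  - by move=> _ _; ring.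
rewrite E0 zE (eq_zsum E1).
have MD k0 : majorant (fun l : Z2 => if l == k0 then `|A k th| else 0) `|A k th|.
  split=> [l|s us]; first by case: ifP.
  rewrite -big_mkcond /= big_const_seq iter_addr_0.
  have : (count (pred1 k0) s <= 1)%N by rewrite count_uniq_mem// leq_b1.
  rewrite (eq_count (a2 := pred1 k0))//.
  by case: count => [|[|//]] _; rewrite ?mulr0n ?mulr1n.
have MDD := majorantD (MD (- k)) (MD k).
rewrite (zsumZ _ MDD); last first.
  move=> l; apply: (le_trans (ler_normD _ _)).
  by apply: lerD; case: ifP => //; rewrite normr0.
rewrite (zsumD MDD) ?zsum_delta; first last.
- by move=> l; case: ifP => _; case: ifP => _; rewrite ?normr0 ?addr_ge0 ?lerDr ?lerDl ?addr0 ?add0r.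
- by move=> l; case: ifP => _; case: ifP => _; rewrite ?normr0 ?addr_ge0 ?lerDr ?lerDl ?addr0 ?add0r.
by move: pi2; move: ((2 * pi) ^+ 2) (A k th) => c a c0; field.
Qed.

(** Inversion: the function and its Fourier series have the same coefficients. *)
Lemma synth_coef f M Z : majorant M Z -> continuous f -> periodic2 f ->
  dominated (coef f) M -> forall x, f x = synth (coef f) x.
Proof.
move=> MZ cf pf dM x; apply/eqP; rewrite -subr_eq0; apply/eqP.
have tf := trig_coef cf.
have cs := synth_continuous MZ tf dM.
apply: (coef_uniq (f := fun x => f x - synth (coef f) x)).
- exact: sub_continuous.
- move=> y; have [p1 p2] := synth_period tf y; have [q1 q2] := pf y.
  by split; [rewrite p1 q1|rewrite p2 q2].
- by move=> k th; rewrite coefB// (coef_synth k th MZ)// subrr.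
Qed.

Lemma is_derive_trig A k (th : R) : trig A ->
  is_derive th 1 (A k) (A k (th + pi / 2)).
Proof.
move=> tA; have -> : A k = (fun th => A k 0 * cos th + A k (pi / 2) * sin th).
  by apply/funext => s; rewrite tA.1.
apply: is_derive_eq.
by rewrite cosDpihalf sinDpihalf /GRing.scale /=; ring.
Qed.

Lemma synth_pd A j M Z M' Z' x : majorant M Z -> majorant M' Z' -> trig A ->
  dominated A M -> dominated (dcoef j A) M' ->
  is_derive x (dir j) (synth A) (synth (dcoef j A) x).
Proof.
move=> MZ MZ' tA dA dA'; apply: is_derive_line; rewrite /synth.
have D : is_derive (0 : R) 1 (fun h => zsum (fun k => A k (freq k j * h + dotZ k x)))
    (zsum (fun k => dcoef j A k (dotZ k x))).
  rewrite (_ : zsum (fun k => dcoef j A k (dotZ k x)) =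
    zsum (fun k => (fun h => dcoef j A k (freq k j * h + dotZ k x)) 0)); last first.
    by apply: eq_zsum => k; rewrite mulr0 add0r.
  apply: (@zsum_derive _ (fun k h => A k (freq k j * h + dotZ k x))
     (fun k h => dcoef j A k (freq k j * h + dotZ k x)) (-1) 1 0 M Z M' Z') => //.
  - by apply/andP; split; lra.
  - move=> k s _.
    have d1 := is_derive_trig k (freq k j * s + dotZ k x) tA.
    have d2 : is_derive s 1 (fun h : R => freq k j * h + dotZ k x) (freq k j).
      by apply: is_derive_eq; rewrite addr0 [_ *: 1]mulr1.
    have := @is_derive1_comp R (A k) (fun h => freq k j * h + dotZ k x) s _ _ d1 d2.
    by rewrite [_ * freq k j]mulrC.
have -> : (fun h => ((2 * pi) ^+ 2)^-1 * zsum (fun k => A k (dotZ k (h *: dir j + x)))) =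
    (fun h : R => ((2 * pi) ^+ 2)^-1 *: zsum (fun k => A k (freq k j * h + dotZ k x))).
  by apply/funext => h; congr (_ * _); apply: eq_zsum => k; rewrite dotZ_line.
exact: is_deriveZ.
Qed.

Lemma synth_dt (A B : R -> Z2 -> R -> R) (lo hi t : R) x M Z M' Z' :
  majorant M Z -> majorant M' Z' -> lo < t < hi ->
  (forall s, dominated (A s) M) -> (forall s, dominated (B s) M') ->
  (forall k th s, lo < s < hi -> is_derive s 1 (fun s => A s k th) (B s k th)) ->
  is_derive t 1 (fun s => synth (A s) x) (synth (B t) x).
Proof.
move=> MZ MZ' tI dA dB AB; rewrite /synth.
apply: (@is_deriveZ _ _ _ (fun s => zsum (fun k => A s k (dotZ k x)))).
apply: (@zsum_derive _ (fun k s => A s k (dotZ k x)) (fun k s => B s k (dotZ k x))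
  lo hi t M Z M' Z') => // k s sI.
- exact: dA.
- exact: dB.
Qed.

End Synthesis.

(** * Products and squared Sobolev norms through coefficients *)

Section SobolevBounds.
Context {R : realType}.
Local Notation Z2 := (int * int)%type.
Implicit Types (f g : R * R -> R) (k l : Z2) (a : Z2 -> R).

Lemma inv_twopi2_le1 : ((2 * pi) ^+ 2)^-1 <= 1 :> R.
Proof.
have p : 1 <= 2 * pi :> R by have := @pi_ge2 R; lra.
by rewrite invf_le1 ?exprn_gt0 ?twopi_gt0// exprn_ege1.
Qed.

Lemma synth_norm_le (A : Z2 -> R -> R) M Z x : majorant M Z -> dominated A M ->
  `|synth A x| <= Z.
Proof.
move=> MZ dA; rewrite /synth normrM ger0_norm ?invr_ge0 ?sqr_ge0// -[leRHS]mul1r.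
rewrite ler_pM ?invr_ge0 ?sqr_ge0//; first exact: inv_twopi2_le1.
exact: (zsum_norm_le MZ).
Qed.

(** The Fourier series of one factor turns a product into a superposition of
    frequency shifts of the other factor. *)
Lemma coef_mul_le f g (Gb : R) (G : Z2 -> R) (M : Z2 -> R) Zf Z k th :
  continuous f -> periodic2 f -> majorant M Zf -> dominated (coef f) M ->
  continuous g -> (forall x, `|g x| <= Gb) -> dominated (coef g) G ->
  majorant (fun l => M l * (G (k + l) + G (k - l))) Z ->
  `|coef (fun x => g x * f x) k th| <= Z.
Proof.
move=> cf pf MZ dM cg gG dG MZ'.
have Gb0 : 0 <= Gb by exact: le_trans (normr_ge0 _) (gG 0).
have tf := trig_coef cf.
pose h l x := g x * coef f l (dotZ l x) * wave k th x.
have cA l : continuous (fun x => coef f l (dotZ l x)).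
  rewrite (_ : (fun x => _) = (fun x => coef f l 0 * wave l 0 x + coef f l (pi / 2) * wave l (pi / 2) x)).
    apply: add_continuous; apply: mul_continuous; try exact: wave_continuous;
    by move=> x; exact: cst_continuous.
  by apply/funext => x; exact: trigE.
have ch l : continuous (h l) by apply: mulwave_continuous; exact: mul_continuous.
have hM l x : `|h l x| <= Gb * M l.
  rewrite /h 2!normrM -[leRHS]mulr1 ler_pM ?mulr_ge0 ?wave_norm_le//.
  by rewrite ler_pM.
have [cz zE] := cellint_zsum (majorantZ Gb0 MZ) ch hM.
have -> : coef (fun x => g x * f x) k th =
    ((2 * pi) ^+ 2)^-1 * zsum (fun l => cellint (h l)).
  rewrite -zE -cellintZ//; apply: eq_Rintegral => x _.
  rewrite (synth_coef MZ cf pf dM) /synth.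
  rewrite [in LHS]mulrCA -mulrA; congr (_ * _).
  rewrite -(zsumZ _ MZ); last by move=> l; exact: dM.
  rewrite mulrC -(zsumZ _ (majorantZ Gb0 MZ)); last first.
    by move=> l; rewrite normrM ler_pM.
  by apply: eq_zsum => l; rewrite /h; ring.
rewrite normrM ger0_norm ?invr_ge0 ?sqr_ge0// -[leRHS]mul1r.
rewrite ler_pM ?invr_ge0 ?sqr_ge0//; first exact: inv_twopi2_le1.
apply: (zsum_norm_le MZ') => l.
have -> : cellint (h l) = coef f l 0 * coef (fun x => g x * wave l 0 x) k th +
     coef f l (pi / 2) * coef (fun x => g x * wave l (pi / 2) x) k th.
  rewrite -!coefZ; [|exact: mulwave_continuous..].
  rewrite -coefD; [|by apply: mul_continuous; [move=> x; exact: cst_continuous|exact: mulwave_continuous]..].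
  by apply: eq_Rintegral => x _; rewrite /h trigE//; ring.
have B ph : `|coef (fun x => g x * wave l ph x) k th| <= 2^-1 * (G (k + l) + G (k - l)).
  rewrite coef_mulwave// normrM ger0_norm ?invr_ge0// ler_wpM2l ?invr_ge0//.
  by apply: (le_trans (ler_normD _ _)); rewrite lerD.
apply: (le_trans (ler_normD _ _)); rewrite !normrM.
have := ler_pM (normr_ge0 _) (normr_ge0 _) (dM l 0) (B 0).
have := ler_pM (normr_ge0 _) (normr_ge0 _) (dM l (pi / 2)) (B (pi / 2)).
lra.
Qed.

Definition decay3 f (B : R) := dominated (coef f) (fun k => B * (bracket k ^+ 3)^-1).

Lemma decay3_majorant (B : R) : 0 <= B ->
  majorant (fun k => B * (bracket k ^+ 3)^-1) (B * 64).
Proof. by move=> B0; exact: majorantZ majorant_bracket3. Qed.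

Lemma decay3_bounded f (B : R) : 0 <= B -> continuous f -> periodic2 f -> decay3 f B ->
  forall x, `|f x| <= B * 64.
Proof.
move=> B0 cf pf df x; rewrite (synth_coef (decay3_majorant B0) cf pf df).
exact: (synth_norm_le _ (decay3_majorant B0) df).
Qed.

(** The coefficients of [f] being summable, multiplication by [f] is bounded for
    the sup norm of coefficients; the bound on [g] itself only justifies the
    exchange of sum and integral. *)
Lemma coef_mul_small f g (B Gb d : R) k th : 0 <= B -> 0 <= d ->
  continuous f -> periodic2 f -> decay3 f B ->
  continuous g -> (forall x, `|g x| <= Gb) -> dominated (coef g) (fun=> d) ->
  `|coef (fun x => g x * f x) k th| <= 128 * B * d.
Proof.
move=> B0 d0 cf pf df cg gb dg.
apply: (coef_mul_le (M := fun k => B * (bracket k ^+ 3)^-1) (Gb := Gb) (G := fun=> d)) => //.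
  exact: decay3_majorant.
have -> : 128 * B * d = 2 * d * (B * 64) by ring.
apply: majorant_le (majorantZ _ (decay3_majorant B0)) _; first by rewrite mulr_ge0.
move=> l; rewrite (_ : _ * (d + d) = 2 * d * (B * (bracket l ^+ 3)^-1)) ?lexx ?andbT; last by ring.
by rewrite !mulr_ge0// invr_ge0 exprn_ge0// ltW// bracket_gt0.
Qed.

(** The functions with cubic decay form an algebra, by [bracket_conv]. *)
Lemma decay3_mul f g (B B' : R) : 0 <= B -> 0 <= B' ->
  continuous f -> periodic2 f -> decay3 f B ->
  continuous g -> periodic2 g -> decay3 g B' ->
  decay3 (fun x => g x * f x) (8192 * B * B').
Proof.
move=> B0 B'0 cf pf df cg pg dg k th.
apply: (coef_mul_le (M := fun k => B * (bracket k ^+ 3)^-1) (Gb := B' * 64)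
   (G := fun k => B' * (bracket k ^+ 3)^-1)) => //.
- exact: decay3_majorant.
- exact: decay3_bounded.
have b0 l : 0 <= (bracket l ^+ 3)^-1 :> R by rewrite invr_ge0 exprn_ge0// ltW// bracket_gt0.
have i1 : injective (fun l : Z2 => k + l) by move=> ? ? /addrI.
have i2 : injective (fun l : Z2 => k - l) by move=> ? ? /addrI /oppr_inj.
(* 8192 = 32 * (4 * 64): the constant of [bracket_conv], times the four sums of
   inverse cubes that it produces. *)
pose c := 32 * B * B' * (bracket k ^+ 3)^-1.
have c0 : 0 <= c by rewrite /c !mulr_ge0.
have m1 := @majorant_bracket3 R.
have m2 := majorantZ c0 (majorantD (majorantD m1 (majorant_inj i1 m1)) (majorantD m1 (majorant_inj i2 m1))).
have -> : 8192 * B * B' * (bracket k ^+ 3)^-1 = c * (64 + 64 + (64 + 64)).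
  by rewrite /c; ring.
apply: majorant_le m2 _ => l; rewrite !mulr_ge0 ?addr_ge0 ?mulr_ge0//=.
have h1 : (bracket l ^+ 3)^-1 * (bracket (k + l) ^+ 3)^-1 <=
    32 * (bracket k ^+ 3)^-1 * ((bracket l ^+ 3)^-1 + (bracket (k + l) ^+ 3)^-1) :> R.
  have e : - l + (k + l) = k by rewrite addrCA addNr addr0.
  by have := @bracket_conv R (- l) (k + l); rewrite e bracketN.
have h2 : (bracket l ^+ 3)^-1 * (bracket (k - l) ^+ 3)^-1 <=
    32 * (bracket k ^+ 3)^-1 * ((bracket l ^+ 3)^-1 + (bracket (k - l) ^+ 3)^-1) :> R.
  have e : l + (k - l) = k by rewrite addrC subrK.
  by have := @bracket_conv R l (k - l); rewrite e.
have BB : 0 <= B * B' by rewrite mulr_ge0.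
have := ler_wpM2l BB (lerD h1 h2); rewrite /c.
move: (bracket l ^+ 3)^-1 (bracket (k + l) ^+ 3)^-1 (bracket (k - l) ^+ 3)^-1 (bracket k ^+ 3)^-1 => p q r s.
lra.
Qed.

(** Bounds on squared Sobolev norms, through finite partial sums so that all
    estimates stay among real numbers. *)
Definition sobolev_le (s : nat) f (c : R) :=
  forall S : seq Z2, uniq S -> \sum_(k <- S) bracket k ^+ s * fourier_sq f k <= c.

Lemma esum_leP a (c : R) : (forall k, 0 <= a k) ->
  (\esum_(k in [set: Z2]) (a k)%:E <= c%:E)%E <->
  forall s : seq Z2, uniq s -> \sum_(k <- s) a k <= c.
Proof.
move=> a0; split=> [h s us|h].
  rewrite -lee_fin; apply: le_trans h; apply: esum_ge; exists [set` s].
    by split; [exact: finite_seq|].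
  by rewrite -fsbig_seq// sumEFin.
apply: ge_ereal_sup => _ [X [fX _] <-].
by rewrite fsbig_finite// sumEFin lee_fin; apply: h; exact: finmap.fset_uniq.
Qed.

Lemma sobolev_leP s f (c : R) : (sobolev_sq s f <= c%:E)%E <-> sobolev_le s f c.
Proof.
apply: esum_leP => k; rewrite mulr_ge0 ?fourier_sq_ge0// exprn_ge0//.
exact: ltW (bracket_gt0 k).
Qed.

Lemma sobolev_sq_ge0 s f : (0 <= sobolev_sq s f)%E.
Proof.
apply: esum_ge0 => k _; rewrite lee_fin mulr_ge0 ?fourier_sq_ge0// exprn_ge0//.
exact: ltW (bracket_gt0 k).
Qed.

Lemma sobolev_le_term s f (c : R) k : sobolev_le s f c -> bracket k ^+ s * fourier_sq f k <= c.
Proof. by move/(_ [:: k] isT); rewrite big_seq1. Qed.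

Lemma sobolev_le_decay f (c : R) : continuous f -> 0 <= c -> sobolev_le 6 f c ->
  decay3 f (2 * pi * Num.sqrt c).
Proof.
move=> cf c0 h k th.
have b0 := @bracket_gt0 R k.
rewrite -ler_sqr ?nnegrE ?normr_ge0//; last first.
  by rewrite !mulr_ge0 ?sqrtr_ge0 ?pi_ge0// invr_ge0 exprn_ge0// ltW.
rewrite -normrX ger0_norm ?sqr_ge0// (le_trans (coef_sq_le k th cf))//.
have -> : (2 * pi * Num.sqrt c * (bracket k ^+ 3)^-1) ^+ 2 =
    (2 * pi) ^+ 2 * (c / bracket k ^+ 6).
  rewrite 2!exprMn sqr_sqrtr// exprVn -exprM mulrA//.
rewrite ler_wpM2l ?sqr_ge0// ler_pdivlMr ?exprn_gt0// mulrC.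
exact: sobolev_le_term.
Qed.

Lemma sobolev_le_mono s s' f (c : R) : (s' <= s)%N -> sobolev_le s f c -> sobolev_le s' f c.
Proof.
move=> ss h S uS; apply: le_trans (h S uS); apply: ler_sum => k _.
by rewrite ler_wpM2r ?fourier_sq_ge0// ler_weXn2l// bracket_ge1.
Qed.

Lemma sobolev_leZ s f (c e : R) : continuous f -> sobolev_le s f c ->
  sobolev_le s (fun x => e * f x) (e ^+ 2 * c).
Proof.
move=> cf h S uS.
have E k : fourier_sq (fun x => e * f x) k = e ^+ 2 * fourier_sq f k.
  have ce : continuous (fun x => e * f x) by apply: mul_continuous => // x; exact: cst_continuous.
  by rewrite !fourier_sqE// !coefZ//; ring.
under eq_bigr do rewrite E mulrCA.
by rewrite -mulr_sumr ler_wpM2l ?sqr_ge0// h.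
Qed.

Lemma fourier_sqD f g k : continuous f -> continuous g ->
  fourier_sq (fun x => f x + g x) k <= 2 * fourier_sq f k + 2 * fourier_sq g k.
Proof.
move=> cf cg; rewrite !fourier_sqE//; last exact: add_continuous.
rewrite !coefD// -subr_ge0.
set w := _ ^+ 2; set a1 := coef f k 0; set a2 := coef f k _.
set b1 := coef g k 0; set b2 := coef g k _.
have -> : 2 * (w * (a1 ^+ 2 + a2 ^+ 2)) + 2 * (w * (b1 ^+ 2 + b2 ^+ 2)) -
   w * ((a1 + b1) ^+ 2 + (a2 + b2) ^+ 2) = w * ((a1 - b1) ^+ 2 + (a2 - b2) ^+ 2) by ring.
by rewrite mulr_ge0 ?addr_ge0 ?sqr_ge0.
Qed.

Lemma sobolev_leD s f g (c d : R) : continuous f -> continuous g ->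
  sobolev_le s f c -> sobolev_le s g d ->
  sobolev_le s (fun x => f x + g x) (2 * c + 2 * d).
Proof.
move=> cf cg hf hg S uS.
apply: (@le_trans _ _ (\sum_(k <- S) (2 * (bracket k ^+ s * fourier_sq f k) +
   2 * (bracket k ^+ s * fourier_sq g k)))).
  apply: ler_sum => k _; have b0 : 0 <= bracket k ^+ s :> R by rewrite exprn_ge0// ltW// bracket_gt0.
  by have := ler_wpM2l b0 (fourier_sqD k cf cg); lra.
rewrite big_split /= -!mulr_sumr.
by have := hf S uS; have := hg S uS; lra.
Qed.

Lemma sobolev_leB s f g (c d : R) : continuous f -> continuous g ->
  sobolev_le s f c -> sobolev_le s g d ->
  sobolev_le s (fun x => f x - g x) (2 * c + 2 * d).
Proof.
move=> cf cg hf hg.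
have cNg : continuous (fun x => -1 * g x) by apply: mul_continuous => // x; exact: cst_continuous.
have := sobolev_leD cf cNg hf (sobolev_leZ (-1) cg hg).
rewrite sqrrN expr1n mul1r (_ : (fun x => f x + -1 * g x) = (fun x => f x - g x))//.
by apply/funext => x; rewrite mulN1r.
Qed.

(** One derivative costs one power of the weight. *)
Lemma sobolev_le_pd s j f (c : R) : periodic2 f -> continuous f ->
  (forall x, derivable f x (dir j)) -> continuous (pd j f) ->
  sobolev_le s.+1 f c -> sobolev_le s (pd j f) c.
Proof.
move=> pf cf df cpf h S uS; apply: le_trans (h S uS); apply: ler_sum => k _.
have E : fourier_sq (pd j f) k = freq k j ^+ 2 * fourier_sq f k.
  have /= := trig_dcoef j (trig_coef cf) => -[H _].
  rewrite !fourier_sqE// !coef_pd// add0r (_ : pi / 2 + pi / 2 = 0 + pi); last by field.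
  by rewrite coef_pi//; ring.
rewrite E (exprSr (bracket k)) -mulrA ler_wpM2l ?exprn_ge0 ?(ltW (bracket_gt0 _))//.
by rewrite ler_wpM2r ?fourier_sq_ge0 ?freq_sq_le.
Qed.

(** Interpolation: uniformly small coefficients and a bound in the space of
    order 6 give smallness in order 5, frequencies being split at [N]: below it,
    the five powers of the weight are traded for an inverse square. *)
Lemma sobolev_interp f (d c N : R) : continuous f -> 1 <= N -> 0 <= d ->
  (forall k th, coef f k th ^+ 2 <= d) -> sobolev_le 6 f c ->
  sobolev_le 5 f (128 * N ^+ 7 * d + c / N).
Proof.
move=> cf N1 d0 hd hc S uS; have N0 : 0 < N by lra.
have fd k := fourier_sq_le cf (hd k).
apply: (@le_trans _ _ (\sum_(k <- S) (N ^+ 7 * (2 * d) * (bracket k ^+ 2)^-1 +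
    N^-1 * (bracket k ^+ 6 * fourier_sq f k)))).
  apply: ler_sum => k _; have b0 := @bracket_gt0 R k; have := fd k.
  have := fourier_sq_ge0 f k; move: (fourier_sq f k) (bracket k) b0 => F b b0 F0 Fd.
  have t1 : 0 <= N ^+ 7 * (2 * d) * (b ^+ 2)^-1.
    by rewrite !mulr_ge0 ?exprn_ge0 ?invr_ge0 ?exprn_ge0// ltW.
  have t2 : 0 <= N^-1 * (b ^+ 6 * F) by rewrite !mulr_ge0 ?invr_ge0 ?exprn_ge0// ltW.
  have [bN|Nb] := leP b N.
    apply: (@le_trans _ _ (N ^+ 7 * (2 * d) / b ^+ 2)); last by rewrite lerDl.
    rewrite ler_pdivlMr ?exprn_gt0// mulrAC -exprD.
    by apply: ler_pM; rewrite ?exprn_ge0 ?(ltW b0)// lerXn2r ?nnegrE ?(ltW b0) ?(ltW N0).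
  apply: (@le_trans _ _ (N^-1 * (b ^+ 6 * F))); last by rewrite lerDr.
  rewrite [leRHS]mulrC ler_pdivlMr// mulrAC ler_wpM2r//.
  by rewrite (exprSr b 5) ler_wpM2l ?exprn_ge0 ?(ltW b0)// ltW.
rewrite big_split /= -!mulr_sumr.
have h1 := (@majorant_bracket2 R).2 S uS.
have h2 := hc S uS.
have n1 : 0 <= N ^+ 7 * (2 * d) by rewrite !mulr_ge0 ?exprn_ge0// ltW.
have n2 : 0 <= N^-1 by rewrite invr_ge0 ltW.
by have := ler_wpM2l n1 h1; have := ler_wpM2l n2 h2; lra.
Qed.

(** A Fatou property: finite partial sums pass to the limit. *)
Lemma sobolev_le_lim s (T : Type) (F : set_system T) {FF : ProperFilter F}
    (h : T -> R * R -> R) f (c : R) : continuous f ->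
  (forall k th, coef (h t) k th @[t --> F] --> coef f k th) ->
  (\forall t \near F, continuous (h t) /\ sobolev_le s (h t) c) -> sobolev_le s f c.
Proof.
move=> cf hf hs S uS.
pose q (A : Z2 -> R -> R) k : R := ((2 * pi)^-1) ^+ 2 * (A k 0 ^+ 2 + A k (pi / 2) ^+ 2).
have C : \sum_(k <- S) bracket k ^+ s * q (coef (h t)) k @[t --> F] -->
    \sum_(k <- S) bracket k ^+ s * fourier_sq f k.
  elim: S {uS} => [|k S IH].
    by under eq_fun do rewrite big_nil; rewrite big_nil; exact: cvg_cst.
  under eq_fun do rewrite big_cons.
  rewrite big_cons; apply: cvgD => //; apply: cvgMr.
  rewrite fourier_sqE//; apply: cvgMr; apply: cvgD; rewrite expr2;
    under eq_fun do rewrite expr2; by apply: cvgM; exact: hf.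
apply: (cvgr_to_le C); apply: filterS hs => t [ct ht].
apply: le_trans (ht S uS); rewrite le_eqVlt; apply/orP; left; apply/eqP.
by apply: eq_bigr => k _; rewrite fourier_sqE.
Qed.

(** An enumeration of the lattice turns the norm into a series of functions, for
    which measurability is inherited. *)
Lemma sobolev_sq_nneseries s f : sobolev_sq s f =
  (\sum_(0 <= n <oo) (zterm (fun k => bracket k ^+ s * fourier_sq f k) n)%:E)%E.
Proof.
set a := fun k => _.
have a0 k : 0 <= a k.
  by rewrite mulr_ge0 ?fourier_sq_ge0// exprn_ge0// ltW// bracket_gt0.
rewrite nneseries_esum; last first.
  by move=> n _; rewrite lee_fin /zterm; case: pickle_inv.
transitivity (\esum_(n in [set: nat]) (zterm a n)%:E)%E; last first.
  by congr esum; apply/seteqP; split.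
transitivity (\esum_(k in [set: Z2]) (zterm a (pickle k))%:E)%E.
  by apply: eq_esum => k _; rewrite /zterm pickleK_inv.
rewrite -(@esum_image _ _ _ [set: Z2] pickle (fun n => (zterm a n)%:E)); last first.
  by move=> x y _ _; exact: (pcan_inj pickleK_inv).
rewrite [LHS]esum_mkcond; apply: eq_esum => n _ /=.
case: ifPn => // /negP nI; rewrite /zterm.
case E: (pickle_inv n) => [k|]//; case: nI; apply/mem_set; exists k => //.
by have := @pickle_invK Z2 n; rewrite E.
Qed.

Lemma sobolev_sq_measurable s (D : set R) (F : R -> R * R -> R) : measurable D ->
  (forall t, continuous (F t)) ->
  (forall k th, measurable_fun D (fun t => coef (F t) k th)) ->
  measurable_fun D (fun t => sobolev_sq s (F t)).
Proof.
move=> mD cF mF; under eq_fun do rewrite sobolev_sq_nneseries.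
apply: ge0_emeasurable_sum.
  move=> n t _ _; rewrite lee_fin /zterm; case: pickle_inv => [k|] //.
  by rewrite mulr_ge0 ?fourier_sq_ge0// exprn_ge0// ltW// bracket_gt0.
move=> n _; apply/measurable_EFinP; rewrite /zterm.
case: pickle_inv => [k|]; last exact: measurable_cst.
under eq_fun do rewrite fourier_sqE//.
apply: measurable_funM; first exact: measurable_cst.
apply: measurable_funM; first exact: measurable_cst.
by apply: measurable_funD; apply: measurable_funX.
Qed.

End SobolevBounds.

(** * Comparison of functions of time *)

Section TimeAnalysis.
Context {R : realType}.
Implicit Types (f g h : R -> R).

Definition primitive g (t : R) : R := \int[lebesgue_measure]_(s in `[0, t]) g s.

Lemma continuous_itv_integrable g (a b : R) : continuous g ->
  lebesgue_measure.-integrable `[a, b] (EFin \o g).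
Proof.
move=> cg; apply: continuous_compact_integrable; first exact: segment_compact.
exact: continuous_subspaceT.
Qed.

Lemma primitive0 g : primitive g 0 = 0.
Proof. by rewrite /primitive set_itv1 Rintegral_set1. Qed.

Lemma is_derive_primitive g (t : R) : continuous g -> 0 < t ->
  is_derive t 1 (primitive g) (g t).
Proof.
move=> cg t0.
have ig := continuous_itv_integrable 0 (t + 1) cg.
have t1 : t < t + 1 by rewrite ltrDl.
have [d1 d2] := @continuous_FTC1_closed R g 0 t (t + 1) t1 ig t0 (cg t).
by apply: DeriveDef; [exact: d1|rewrite -derive1E; exact: d2].
Qed.

Lemma primitive_within_continuous g (T : R) : continuous g -> 0 <= T ->
  {within `[0, T], continuous (primitive g)}.
Proof.
move=> cg T0; apply: parameterized_integral_continuous => //.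
exact: continuous_itv_integrable.
Qed.

Lemma primitive_le g (t T : R) : continuous g -> (forall s, 0 <= g s) -> 0 <= t <= T ->
  primitive g t <= primitive g T.
Proof.
move=> cg g0 /andP[t0 tT].
have fn s : (\int[lebesgue_measure]_(r in `[0%R, s]) (g r)%:E)%E \is a fin_num.
  by apply: integrable_fin_num => //; exact: continuous_itv_integrable.
rewrite /primitive /Rintegral fine_le//.
apply: ge0_subset_integral => //.
- by apply: measurable_funTS; apply/measurable_EFinP; exact: continuous_measurable_fun.
- by move=> x _; rewrite lee_fin.
- by move=> s /=; rewrite !in_itv /= => /andP[-> /le_trans]; apply.
Qed.

Lemma primitive_leE g (T c : R) : continuous g ->
  (\int[lebesgue_measure]_(t in `[0%R, T]) (g t)%:E <= c%:E)%E -> primitive g T <= c.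
Proof.
move=> cg h; rewrite /primitive /Rintegral -lee_fin fineK//.
by apply: integrable_fin_num => //; exact: continuous_itv_integrable.
Qed.

Lemma primitiveD f g (t : R) : continuous f -> continuous g ->
  primitive (fun s => f s + g s) t = primitive f t + primitive g t.
Proof.
by move=> cf cg; apply: RintegralD => //; exact: continuous_itv_integrable.
Qed.

Lemma primitiveZ f (c t : R) : continuous f ->
  primitive (fun s => c * f s) t = c * primitive f t.
Proof. by move=> cf; apply: RintegralZl => //; exact: continuous_itv_integrable. Qed.

Lemma lebesgue_measure_itv0 (t : R) : 0 <= t ->
  @lebesgue_measure R `[0, t]%classic = t%:E.
Proof.
move=> t0; rewrite lebesgue_measure_itv /= lte_fin; case: ltP => [_|t0'] /=.
  by rewrite -EFinD subr0.
by congr EFin; apply/eqP; rewrite eq_le t0 t0'.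
Qed.

Lemma primitive_cst (c t : R) : 0 <= t -> primitive (fun=> c) t = c * t.
Proof.
move=> t0; rewrite /primitive Rintegral_cst//.
have L := lebesgue_measure_itv0 t0.
by rewrite (_ : _ `[0, t]%classic = t%:E).
Qed.

Lemma primitive_compare f g df (T t : R) :
  {within `[0, T], continuous f} -> continuous g ->
  (forall s, 0 < s < T -> is_derive s 1 f (df s)) ->
  (forall s, 0 < s < T -> df s <= g s) -> 0 <= t <= T ->
  f t <= f 0 + primitive g t.
Proof.
move=> cf cg dfP dfg /andP[t0 tT].
pose h s := f s - primitive g s.
have dh s : s \in `]0, T[ -> is_derive s 1 h (df s - g s).
  rewrite in_itv /= => sI; have [s0 _] := andP sI.
  by have d1 := dfP s sI; have d2 := is_derive_primitive cg s0; exact: is_deriveB.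
have H : {in `[0, T] &, {homo h : x y /~ x <= y}}.
  apply: ler0_derive1_le_cc.
  - by move=> s /dh [].
  - move=> s sI; rewrite derive1E; have ds := dh s sI; rewrite derive_val.
    by rewrite subr_le0; apply: dfg; move: sI; rewrite in_itv.
  - have T0 : 0 <= T by exact: le_trans tT.
    move=> x; apply: continuousB; first exact: cf.
    exact: primitive_within_continuous.
have := H t 0; rewrite !in_itv /= lexx t0 tT (le_trans t0 tT) => /(_ isT isT isT).
by rewrite /h primitive0 subr0 lerBlDr.
Qed.

Lemma primitive_compare_norm f g df (T t : R) :
  {within `[0, T], continuous f} -> continuous g ->
  (forall s, 0 < s < T -> is_derive s 1 f (df s)) ->
  (forall s, 0 < s < T -> `|df s| <= g s) -> 0 <= t <= T ->
  `|f t - f 0| <= primitive g t.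
Proof.
move=> cf cg dfP dfg tT.
have h1 : f t <= f 0 + primitive g t.
  apply: (primitive_compare cf cg dfP) tT => s /dfg.
  by apply: le_trans; exact: ler_norm.
have h2 : - f t <= - f 0 + primitive g t.
  apply: (@primitive_compare (fun s => - f s) g (fun s => - df s) T) => //.
  - by move=> s; apply: continuousN; exact: cf.
  - by move=> s /dfP d; exact: is_deriveN.
  - by move=> s /dfg; apply: le_trans; rewrite -normrN; exact: ler_norm.
by rewrite ler_norml; apply/andP; split; lra.
Qed.

Lemma is_derive_eq_near f g (a b t d : R) : a < t < b ->
  (forall s, a < s < b -> f s = g s) -> is_derive t 1 g d -> is_derive t 1 f d.
Proof.
move=> tI fg [dg <-].
have E : \forall s \near t, f s = g s.
  have /andP[ta tb] := tI.
  have n1 := lt_nbhsr ta; have n2 := lt_nbhsl tb.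
  by near=> s; apply: fg; apply/andP; split; near: s.
have H : (h^-1 *: ((g \o shift t) (h *: 1) - g t)) @[h --> (0 : R)^'] --> 'D_1 g t by exact: dg.
have {}H : (h^-1 *: ((f \o shift t) (h *: 1) - f t)) @[h --> (0 : R)^'] --> 'D_1 g t.
  apply: cvg_trans H; apply: near_eq_cvg.
  have E' : \forall h \near (0 : R)^', f (h *: 1 + t) = g (h *: 1 + t).
    apply: nbhs_dnbhs.
    have c : (fun h : R => h *: (1 : R) + t) h @[h --> (0 : R)] --> t.
      rewrite -[X in _ --> X]add0r; apply: cvgD; last exact: cvg_cst.
      rewrite -[X in _ --> X](scale0r (1 : R)).
      by apply: cvgZr_tmp => //; exact: cvg_id.
    exact: (c _ E).
  near=> h; rewrite /= (fg t tI); congr (_ *: (_ - _)); apply: esym.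
  by near: h.
apply: DeriveDef; last exact: cvg_lim.
by apply/cvg_ex; exists ('D_1 g t).
Unshelve. all: by end_near. Qed.

(** Gronwall's inequality for a family of energies that are coupled through
    their supremum, as the modes of a quadratic equation are: the
    exponentially weighted supremum over family and time is at most half of
    itself plus the forcing. *)
Lemma gronwall_family (Q : Type) (E dE rho : Q -> R -> R) (T c r Em : R) :
  0 < c -> 0 < T ->
  (forall q, continuous (E q)) -> (forall q, continuous (rho q)) ->
  (forall q t, 0 <= rho q t) -> (forall q, primitive (rho q) T <= r) ->
  (forall q, E q 0 = 0) -> (forall q t, 0 <= t <= T -> 0 <= E q t <= Em) ->
  (forall q t, 0 < t < T -> is_derive t 1 (E q) (dE q t)) ->
  (forall q t D, 0 < t < T -> (forall q', E q' t <= D) -> dE q t <= c * D + rho q t) ->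
  forall q t, 0 <= t <= T -> E q t <= 2 * r * expR (2 * c * T).
Proof.
move=> c0 T0 cE crho rho0 rr E0 Eb dEP dEle q0 t0 t0I.
pose lam := 2 * c; have lam0 : 0 < lam by rewrite /lam; lra.
pose A := [set y | exists q t, 0 <= t <= T /\ y = expR (- lam * t) * E q t].
have ubA : has_sup A.
  split; first by exists (expR (- lam * t0) * E q0 t0), q0, t0.
  exists Em => _ [q [t [tI ->]]]; have /andP[e0 e1] := Eb q t tI.
  rewrite -[leRHS]mul1r ler_pM ?expR_ge0// -expR0 ler_expR.
  by have /andP[? ?] := tI; rewrite mulNr oppr_le0 mulr_ge0// ltW.
pose Phi := sup A.
have PhiP q t : 0 <= t <= T -> E q t <= Phi * expR (lam * t).
  move=> tI; rewrite -ler_pdivrMr ?expR_gt0// -expRN -mulNr mulrC.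
  by apply: sup_upper_bound => //; exists q, t.
have Phi0 : 0 <= Phi.
  have tI : 0 <= (0 : R) <= T by rewrite lexx ltW.
  by have := PhiP q0 0 tI; rewrite E0 mulr0 expR0 mulr1.
have dexp (k s : R) : is_derive s 1 (fun s => k * expR (lam * s)) (k * (lam * expR (lam * s))).
  have d1 : is_derive s 1 (fun s : R => lam * s) lam.
    by apply: is_derive_eq; rewrite [_ *: 1]mulr1.
  have d2 := is_derive1_comp (is_derive_expR (lam * s)) d1.
  rewrite [expR _ * lam]mulrC in d2.
  exact: (@is_deriveZ _ _ _ (expR \o *%R lam)).
have bound q t : 0 <= t <= T -> E q t <= Phi / 2 * expR (lam * t) + r.
  move=> tI.
  pose f s := E q s - Phi / 2 * expR (lam * s).
  have H : f t <= f 0 + primitive (rho q) t.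
    apply: (@primitive_compare f (rho q) (fun s => dE q s - Phi / 2 * (lam * expR (lam * s))) T) => //.
    - apply: continuous_subspaceT; apply: sub_continuous => //; apply: mul_continuous; first by move=> x; exact: cst_continuous.
      apply: (@continuousT_comp _ _ _ (fun s => lam * s) expR); last exact: continuous_expR.
      by apply: mul_continuous => x; [exact: cst_continuous|exact: cvg_id].
    - by move=> s sI; have d1 := dEP q s sI; have d2 := dexp (Phi / 2) s; exact: is_deriveB.
    - move=> s sI; rewrite lerBlDl.
      have -> : Phi / 2 * (lam * expR (lam * s)) = c * (Phi * expR (lam * s)).
        by rewrite /lam; field.
      apply: dEle => // q'; apply: PhiP; have /andP[? ?] := sI.
      by apply/andP; split; exact: ltW.
  have := primitive_le (crho q) (rho0 q) tI; have := rr q.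
  move: H; rewrite /f E0 mulr0 expR0; have := Phi0; lra.
have key : Phi <= Phi / 2 + r.
  apply: sup_le_ub; first exact: ubA.1.
  move=> _ [q [t [tI ->]]]; have := bound q t tI.
  have e0 : 0 < expR (- lam * t) by exact: expR_gt0.
  move/(ler_wpM2l (ltW e0)); rewrite mulrDr mulrCA -expRD mulNr addNr expR0 mulr1.
  have r0 : 0 <= r.
    by apply: le_trans (rr q); rewrite /primitive; apply: Rintegral_ge0 => s _.
  move/le_trans; apply; rewrite lerD2l -[leRHS]mul1r ler_wpM2r//.
  rewrite -expR0 ler_expR; have /andP[? ?] := tI.
  by rewrite oppr_le0 mulr_ge0// ltW.
have /andP[t00 t0T] := t0I.
apply: (le_trans (PhiP q0 t0 t0I)).
apply: (@le_trans _ _ (Phi * expR (2 * c * T))).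
  by rewrite ler_wpM2l// ler_expR ler_wpM2l// ltW.
by rewrite ler_wpM2r ?expR_ge0//; lra.
Qed.

End TimeAnalysis.

(** * Flows and their Fourier modes *)

Section Flows.
Context {R : realType}.
Local Notation Z2 := (int * int)%type.

Lemma sum2 (V : nmodType) (F : 'I_2 -> V) : \sum_j F j = F ord0 + F ord_max.
Proof.
rewrite big_ord_recl big_ord1; congr (_ + F _); exact/val_inj.
Qed.

(** Truncating the time to [[0, T]] turns fields that are continuous up to the
    ends of the time interval into globally continuous ones. *)
Definition clamp (T t : R) : R := Num.max 0 (Num.min t T).

Lemma clamp_id (T t : R) : 0 <= t <= T -> clamp T t = t.
Proof. by move=> /andP[t0 tT]; rewrite /clamp (min_idPl tT) (max_idPr t0). Qed.

Lemma clamp_itv (T t : R) : 0 <= T -> 0 <= clamp T t <= T.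
Proof.
move=> T0; rewrite /clamp le_max lexx /= ge_max T0 /=.
by rewrite ge_min lexx orbT.
Qed.

Lemma clamp_continuous (T : R) : continuous (clamp T).
Proof.
move=> t; apply: (@continuous_max R R (fun=> 0) (id \min (fun=> T)) t).
  exact: cst_continuous.
by apply: (@continuous_min R R id (fun=> T) t); [exact: cvg_id|exact: cst_continuous].
Qed.

Lemma within_continuous_comp (X Y Z : topologicalType) (D : set Y) (phi : X -> Y)
    (g : Y -> Z) : {within D, continuous g} -> continuous phi ->
  (forall x, D (phi x)) -> continuous (fun x => g (phi x)).
Proof.
move=> cg cphi Dphi x U gU.
have H : nbhs_subspace (phi x : subspace D) (g @^-1` U) := cg (phi x) U gU.
rewrite -(nbhs_subspace_in (Dphi x)) in H.
have H2 : \forall y \near x, D (phi y) -> U (g (phi y)) := cphi x _ H.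
by apply: filterS H2 => y; apply.
Qed.

Lemma clamp_jcont (S T : R) (f : R -> R * R -> R) : 0 <= T <= S ->
  continuous_upto S f -> jcont (fun t => f (clamp T t)).
Proof.
move=> /andP[T0 TS] cf.
apply: (@within_continuous_comp _ _ _ _ (fun z : R * (R * R) => (clamp T z.1, z.2)) _ cf).
  apply: continuousT_pair; last exact: continuousT_snd.
  by apply: continuousT_comp; [exact: continuousT_fst|exact: clamp_continuous].
move=> z; split => //=; have /andP[c0 cT] := clamp_itv z.1 T0.
by rewrite in_itv /= c0 (le_trans cT).
Qed.

(** The class [spaceC1] on the whole time axis. *)
Definition jC1 (F : R -> R * R -> R) : Prop :=
  [/\ forall t, periodic2 (F t), jcont F,
      forall t x j, derivable (F t) x (dir j) &
      forall j, jcont (fun t => pd j (F t))].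

Lemma clamp_jC1 (S T : R) f : 0 <= T <= S -> spaceC1 S f -> jC1 (fun t => f (clamp T t)).
Proof.
move=> TS [pf cf df cdf]; have /andP[T0 TS'] := TS.
have cI t : 0 <= clamp T t <= S.
  by have /andP[-> h] := clamp_itv t T0; exact: le_trans h TS'.
split.
- by move=> t; exact: pf.
- exact: clamp_jcont TS cf.
- by move=> t x j; exact: df.
- by move=> j; exact: (clamp_jcont TS (cdf j)).
Qed.

Lemma jcont_upto (T : R) F : jcont F -> continuous_upto T F.
Proof. by move=> cF; exact: continuous_subspaceT. Qed.

Lemma jC1_space (T : R) F : jC1 F -> spaceC1 T F.
Proof.
move=> [pF cF dF cdF]; split.
- by move=> t _; exact: pF.
- exact: jcont_upto.
- by move=> t x j _; exact: dF.
- by move=> j; exact: jcont_upto.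
Qed.

Lemma jcont_mul F G : jcont F -> jcont G -> jcont (fun t (x : R * R) => F t x * G t x : R).
Proof. by move=> cF cG; exact: mul_continuous. Qed.

Lemma jcont_add F G : jcont F -> jcont G -> jcont (fun t (x : R * R) => F t x + G t x : R).
Proof. by move=> cF cG; exact: add_continuous. Qed.

Lemma jcont_sub F G : jcont F -> jcont G -> jcont (fun t (x : R * R) => F t x - G t x : R).
Proof. by move=> cF cG; exact: sub_continuous. Qed.

Lemma jcont_cst (c : R) F : jcont F -> jcont (fun t (x : R * R) => c * F t x : R).
Proof. by move=> cF; apply: jcont_mul => // z; exact: cst_continuous. Qed.

Lemma coef_continuous F k th : jcont F -> continuous (fun t : R => coef (F t) k th).
Proof.
move=> cF; apply: (@cellint_continuous _ (fun t x => F t x * wave k th x)).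
apply: (@mul_continuous _ _ (fun z : R * (R * R) => F z.1 z.2) (fun z => wave k th z.2)) => //.
apply: (continuousT_comp (@continuousT_snd R (R * R)%type)).
exact: wave_continuous.
Qed.

Lemma coef_is_derive F G (T t : R) k th : jcont F -> jcont G ->
  (forall s x, 0 < s < T -> is_derive s 1 (F^~ x) (G s x)) -> 0 < t < T ->
  is_derive t 1 (fun s => coef (F s) k th) (coef (G t) k th).
Proof.
move=> cF cG dF tT.
have cw : continuous (fun z : R * (R * R) => wave k th z.2).
  apply: (continuousT_comp (@continuousT_snd R (R * R)%type)).
  exact: wave_continuous.
apply: (@cellint_derive _ (fun t x => F t x * wave k th x) (fun t x => G t x * wave k th x) 0 T) => //.
- exact: mul_continuous.
- exact: mul_continuous.
move=> s x sT; have d := dF s x sT.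
rewrite (_ : (fun s => _) = wave k th x \*: (F^~ x)); last first.
  by apply/funext => r; rewrite mulrC.
by rewrite mulrC; exact: is_deriveZ.
Qed.

Implicit Types (U : 'I_2 -> R -> R * R -> R) (Ta : 'I_2 -> 'I_2 -> R -> R * R -> R)
  (P : R -> R * R -> R).

(** The momentum balance and the incompressibility in components, the stress
    being a given field. *)
Definition flow (T : R) U Ta P : Prop :=
  [/\ forall i, jC1 (U i), forall i j, jC1 (Ta i j), jC1 P,
      forall t x, 0 < t < T -> \sum_j pd j (U j t) x = 0 &
      forall i t x, 0 < t < T -> is_derive t 1 (fun s => U i s x)
        (\sum_j pd j (Ta i j t) x - \sum_j U j t x * pd j (U i t) x - pd i (P t) x)].

Definition remainder U Ta i j t x : R :=
  Ta i j t x - 2^-1 * (pd j (U i t) x + pd i (U j t) x).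

Lemma remainder_jcont U Ta i j : (forall i, jC1 (U i)) -> jC1 (Ta i j) ->
  jcont (remainder U Ta i j).
Proof.
move=> jU [_ c _ _]; have [_ _ _ d] := jU i; have [_ _ _ d'] := jU j.
by apply: jcont_sub => //; apply: jcont_cst; exact: jcont_add.
Qed.

Definition lap2 k : R := freq k ord0 ^+ 2 + freq k ord_max ^+ 2.

Section OneFlow.
Variables (T : R) (U : 'I_2 -> R -> R * R -> R) (Ta : 'I_2 -> 'I_2 -> R -> R * R -> R)
  (P : R -> R * R -> R).
Hypothesis fl : flow T U Ta P.

Let jU i : jC1 (U i). Proof. by case: fl. Qed.
Let jTa i j : jC1 (Ta i j). Proof. by case: fl. Qed.
Let jP : jC1 P. Proof. by case: fl. Qed.

Let cU i t : continuous (U i t). Proof. by case: (jU i) => _ ? _ _; exact: jcont_slice. Qed.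
Let cdU i j t : continuous (pd j (U i t)).
Proof. by case: (jU i) => _ _ _ /(_ j) c; exact: (@jcont_slice _ _ t c). Qed.

Lemma jC1_coef_pd F j t k th : jC1 F -> coef (pd j (F t)) k th = dcoef j (coef (F t)) k th.
Proof.
move=> [pF cF dF cdF]; apply: coef_pd => //; first exact: jcont_slice.
exact: (@jcont_slice _ _ t (cdF j)).
Qed.

Lemma flow_div t k th : 0 < t < T ->
  \sum_j freq k j * coef (U j t) k th = 0.
Proof.
move=> tT; have H x : \sum_j pd j (U j t) x = 0 by case: fl => _ _ _ + _; apply.
have : coef (fun x => \sum_j pd j (U j t) x) k (th - pi / 2) = 0.
  rewrite (eq_coef _ _ H) -[RHS](mul0r (coef (fun=> 1) k (th - pi / 2))) -coefZ.
    by apply: eq_coef => x; rewrite mul0r.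
  by move=> x; exact: cst_continuous.
rewrite coef_sum// => E; rewrite -[RHS]E; apply: eq_bigr => j _.
by rewrite jC1_coef_pd// /dcoef subrK.
Qed.

Lemma jC1_mul F G : jC1 F -> jC1 G -> jC1 (fun t x => F t x * G t x) /\
  forall j t x, pd j (fun x => F t x * G t x) x = F t x * pd j (G t) x + G t x * pd j (F t) x.
Proof.
move=> [pF cF dF cdF] [pG cG dG cdG].
have E j t x : pd j (fun x => F t x * G t x) x = F t x * pd j (G t) x + G t x * pd j (F t) x.
  by rewrite /pd (deriveM (dF t x j) (dG t x j)).
split=> //; split.
- by move=> t; exact: periodic2M.
- exact: jcont_mul.
- by move=> t x j; exact: derivableM.
- move=> j; have -> : (fun t => pd j (fun x => F t x * G t x)) =
      (fun t x => F t x * pd j (G t) x + G t x * pd j (F t) x).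
    by apply/funext => t; apply/funext => x; exact: E.
  by apply: jcont_add; apply: jcont_mul.
Qed.

(** By incompressibility the transport term is the divergence of the momentum
    flux, and the strain rate contributes the viscous term [lap2 k / 2]. *)
Lemma flow_mode i t k th : 0 < t < T ->
  is_derive t 1 (fun s => coef (U i s) k th)
    (\sum_j freq k j * (coef (remainder U Ta i j t) k (th + pi / 2)
        - coef (fun x => U j t x * U i t x) k (th + pi / 2))
     - freq k i * coef (P t) k (th + pi / 2) - 2^-1 * lap2 k * coef (U i t) k th).
Proof.
move=> tT; case: fl => _ _ _ divU eqU.
pose G t x := \sum_j pd j (Ta i j t) x - \sum_j U j t x * pd j (U i t) x - pd i (P t) x.
have jpU j j' : jcont (fun t => pd j' (U j t)) by case: (jU j).
have jpT j : jcont (fun t => pd j (Ta i j t)) by case: (jTa i j).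
have jpP : jcont (fun t => pd i (P t)) by case: jP.
have jcU j : jcont (U j) by case: (jU j).
have cG : jcont G.
  have h1 := jcont_add (jpT ord0) (jpT ord_max).
  have h2 := jcont_add (jcont_mul (jcU ord0) (jpU i ord0)) (jcont_mul (jcU ord_max) (jpU i ord_max)).
  have := jcont_sub (jcont_sub h1 h2) jpP; congr jcont.
  by apply/funext => s; apply/funext => x; rewrite /G !sum2.
have D := @coef_is_derive (U i) G T t k th (jcU i) cG (fun s x => eqU i s x) tT.
have [_ E2] := all_and2 (fun j => jC1_mul (jU j) (jU i)).
have jUU j : jC1 (fun t x => U j t x * U i t x) by have [] := jC1_mul (jU j) (jU i).
have cUU j : continuous (pd j (fun x => U j t x * U i t x)).
  by have [_ _ _ /(_ j) c] := jUU j; exact: (@jcont_slice _ _ t c).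
have cTa j : continuous (pd j (Ta i j t)) by exact: (@jcont_slice _ _ t (jpT j)).
have cP : continuous (pd i (P t)) by exact: (@jcont_slice _ _ t jpP).
rewrite (_ : _ - _ - _ = coef (G t) k th)//.
have GE : G t =1 (fun x => (pd ord0 (Ta i ord0 t) x + pd ord_max (Ta i ord_max t) x) -
    (pd ord0 (fun x => U ord0 t x * U i t x) x + pd ord_max (fun x => U ord_max t x * U i t x) x)
    - pd i (P t) x).
  move=> x; rewrite /G !sum2 !E2.
  by have := divU t x tT; rewrite sum2 => d0; rewrite [in RHS](_ : pd ord_max (U ord_max t) x = - pd ord0 (U ord0 t) x); [ring|lra].
rewrite (eq_coef _ _ GE) !coefB//; try exact: add_continuous; last first.
  by apply: sub_continuous; exact: add_continuous.
rewrite !coefD// !(jC1_coef_pd _ _ _ _ (jTa _ _)) !(jC1_coef_pd _ _ _ _ (jUU _)) (jC1_coef_pd _ _ _ _ jP).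
have rE j : coef (remainder U Ta i j t) k (th + pi / 2) = coef (Ta i j t) k (th + pi / 2)
   + 2^-1 * (freq k j * coef (U i t) k th + freq k i * coef (U j t) k th).
  have c1 : continuous (fun x => pd j (U i t) x + pd i (U j t) x) by exact: add_continuous.
  have c2 : continuous (fun x => 2^-1 * (pd j (U i t) x + pd i (U j t) x)).
    by apply: mul_continuous => // x; exact: cst_continuous.
  have c3 : continuous (Ta i j t) by case: (jTa i j) => _ ? _ _; exact: jcont_slice.
  rewrite /remainder coefB// coefZ// coefD// !(jC1_coef_pd _ _ _ _ (jU _)) /dcoef.
  have -> : th + pi / 2 + pi / 2 = th + pi by field.
  by rewrite !coef_pi//; ring.
rewrite !sum2 !rE /dcoef /lap2.
have := flow_div k th tT; rewrite sum2 => dv.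
apply: subr0_eq; rewrite (_ : _ - _ = 2^-1 * freq k i *
  (freq k ord0 * coef (U ord0 t) k th + freq k ord_max * coef (U ord_max t) k th)).
  by rewrite dv mulr0.
ring.
Qed.

End OneFlow.
End Flows.

(** * Convergence of a family of flows *)

Section Projection.
Context {R : realType}.
Local Notation Z2 := (int * int)%type.
Implicit Types (k : Z2) (Y : 'I_2 -> 'I_2 -> R).

Lemma sqr_le_norm (x y : R) : `|x| <= y -> x ^+ 2 <= y ^+ 2.
Proof.
move=> xy; have y0 : 0 <= y by exact: le_trans (normr_ge0 x) xy.
by rewrite -[leLHS]ger0_norm ?sqr_ge0// normrX lerXn2r// nnegrE.
Qed.

Lemma is_derive_sqr2 (f g : R -> R) (t df dg : R) : is_derive t 1 f df ->
  is_derive t 1 g dg ->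
  is_derive t 1 (fun s => f s ^+ 2 + g s ^+ 2) (2 * (f t * df + g t * dg)).
Proof.
move=> d1 d2; have := is_deriveD (is_deriveM d1 d1) (is_deriveM d2 d2).
rewrite /GRing.scale /= => H.
by rewrite (_ : 2 * _ = f t * df + f t * df + (g t * dg + g t * dg)); [exact: H|ring].
Qed.

Lemma sqr_sub4_le (r1 r2 n1 n2 X : R) : (n1 - n2) ^+ 2 <= X ->
  ((r1 - n1) - (r2 - n2)) ^+ 2 <= 2 * X + 4 * (r1 ^+ 2 + r2 ^+ 2).
Proof.
move=> hN; rewrite (_ : _ ^+ 2 = 4 * (r1 ^+ 2 + r2 ^+ 2) + 2 * (n1 - n2) ^+ 2 -
  ((r1 - r2) + (n1 - n2)) ^+ 2 - 2 * (r1 + r2) ^+ 2); last by ring.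
by have := sqr_ge0 ((r1 - r2) + (n1 - n2)); have := sqr_ge0 (r1 + r2); lra.
Qed.

Lemma sum_young (r r' : 'I_2 -> 'I_2 -> R) (X Y : R) : 8 * X <= Y ->
  \sum_j \sum_l (2 * X + 4 * (r j l ^+ 2 + r' j l ^+ 2)) <=
    Y + 4 * (\sum_j \sum_l r j l ^+ 2 + \sum_j \sum_l r' j l ^+ 2).
Proof. by move=> XY; rewrite !sum2; lra. Qed.

Lemma sqrD_le (x y : R) : 0 <= x -> 0 <= y -> x ^+ 2 + y ^+ 2 <= (x + y) ^+ 2.
Proof. by move=> x0 y0; rewrite sqrrD; have := mulr_ge0 x0 y0; rewrite -mulr_natl; lra. Qed.

(** The Leray projection of the divergence of a tensor mode; at frequency zero
    the division by [lap2 k = 0] gives zero, as it should. *)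
Definition projdiv k Y (i : 'I_2) : R := \sum_j freq k j * Y i j -
  freq k i * (\sum_m \sum_j freq k m * freq k j * Y m j / lap2 k).

Lemma lap2_ge0 k : 0 <= lap2 k :> R.
Proof. by rewrite addr_ge0 ?sqr_ge0. Qed.

Lemma lap2_le k : lap2 k <= bracket k :> R.
Proof. by rewrite /lap2 /bracket /freq /= -addrA lerDr. Qed.

Lemma freq_le_bracket k i : `|freq k i| <= bracket k :> R.
Proof.
apply: (le_trans (freq_norm_le k i)).
rewrite -[leRHS]sqr_sqrtr ?(ltW (bracket_gt0 _))// expr2 ler_peMr ?sqrtr_ge0//.
by rewrite -sqrtr1 ler_wsqrtr// bracket_ge1.
Qed.

Lemma freq2_le_lap2 k m j : `|freq k m * freq k j| <= lap2 k :> R.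
Proof.
have h (x y : R) : `|x * y| <= x ^+ 2 + y ^+ 2.
  have := sqr_ge0 (x - y); have := sqr_ge0 (x + y).
  have := sqr_ge0 x; have := sqr_ge0 y.
  by rewrite sqrrD sqrrB ler_norml => ? ? ? ?; apply/andP; split; lra.
rewrite /lap2; elim/dir_cases: m; elim/dir_cases: j => //.
- by rewrite -expr2 ger0_norm ?sqr_ge0// lerDl sqr_ge0.
- by rewrite mulrC.
- by rewrite -expr2 ger0_norm ?sqr_ge0// lerDr sqr_ge0.
Qed.

Lemma projdivB k Y Y' i : projdiv k (fun m j => Y m j - Y' m j) i =
  projdiv k Y i - projdiv k Y' i.
Proof. by rewrite /projdiv !sum2; ring. Qed.

Lemma projdiv_le k Y i : `|projdiv k Y i| <= 2 * bracket k * \sum_m \sum_j `|Y m j|.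
Proof.
have b0 := @bracket_gt0 R k.
have row m : \sum_j `|Y m j| <= \sum_m \sum_j `|Y m j|.
  rewrite [leRHS](bigD1 m)//= lerDl; apply: sumr_ge0 => ? _; exact: sumr_ge0.
have h1 : `|\sum_j freq k j * Y i j| <= bracket k * \sum_m \sum_j `|Y m j|.
  apply: (le_trans (ler_norm_sum _ _ _)).
  apply: (@le_trans _ _ (\sum_j bracket k * `|Y i j|)).
    by apply: ler_sum => j _; rewrite normrM ler_wpM2r// freq_le_bracket.
  by rewrite -mulr_sumr ler_wpM2l ?(ltW b0).
have h2 : `|\sum_m \sum_j freq k m * freq k j * Y m j / lap2 k| <= \sum_m \sum_j `|Y m j|.
  apply: (le_trans (ler_norm_sum _ _ _)); apply: ler_sum => m _.
  apply: (le_trans (ler_norm_sum _ _ _)); apply: ler_sum => j _.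
  rewrite mulrAC normrM -[leRHS]mul1r ler_wpM2r//.
  rewrite normrM normfV (ger0_norm (lap2_ge0 k)).
  have [l0|l0] := eqVneq (lap2 k : R) 0; first by rewrite l0 invr0 mulr0.
  by rewrite ler_pdivrMr ?mul1r ?freq2_le_lap2// lt_neqAle eq_sym l0 lap2_ge0.
apply: (le_trans (ler_normB _ _)).
have -> : 2 * bracket k * (\sum_m \sum_j `|Y m j|) = bracket k * (\sum_m \sum_j `|Y m j|) +
   bracket k * (\sum_m \sum_j `|Y m j|) by ring.
by apply: lerD => //; rewrite normrM ler_pM// freq_le_bracket.
Qed.

Lemma mode_diff k Y N Y' N' (p p' w w' : R) i :
  (\sum_j freq k j * (Y i j - N i j) - freq k i * p - 2^-1 * lap2 k * w) -
  (\sum_j freq k j * (Y' i j - N' i j) - freq k i * p' - 2^-1 * lap2 k * w') =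
  \sum_j freq k j * ((Y i j - N i j) - (Y' i j - N' i j)) - freq k i * (p - p') -
    2^-1 * lap2 k * (w - w').
Proof. by rewrite !sum2; ring. Qed.

(** The incompressibility constraint determines the pressure mode, so that it
    can be eliminated from the equation. *)
Lemma projdiv_elim k (Y : 'I_2 -> 'I_2 -> R) (a da : 'I_2 -> R) (p : R) :
  \sum_i freq k i * a i = 0 -> \sum_i freq k i * da i = 0 ->
  (forall i, da i = \sum_j freq k j * Y i j - freq k i * p - 2^-1 * lap2 k * a i) ->
  forall i, da i = projdiv k Y i - 2^-1 * lap2 k * a i.
Proof.
move=> ka kda E i; rewrite {1}E /projdiv; congr (_ - _ - _).
have [l0|l0] := eqVneq (lap2 k : R) 0.
  have f0 : freq k i = 0 :> R.
    by apply/eqP; rewrite -sqrf_eq0 -normr_le0 -l0 expr2; exact: freq2_le_lap2.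
  by rewrite f0 !mul0r.
congr (_ * _); move: kda; rewrite !sum2 !E !sum2.
have := ka; rewrite sum2.
move: l0; rewrite /lap2; move: (freq k ord0) (freq k ord_max) => f0 f1 l0 ka' kda.
apply: (mulIf l0); rewrite !mulrDl !divfK//.
apply: subr0_eq; rewrite (_ : _ - _ = - (f0 * (f0 * Y ord0 ord0 + f1 * Y ord0 ord_max - f0 * p
      - 2^-1 * (f0 ^+ 2 + f1 ^+ 2) * a ord0) +
    f1 * (f0 * Y ord_max ord0 + f1 * Y ord_max ord_max - f1 * p
      - 2^-1 * (f0 ^+ 2 + f1 ^+ 2) * a ord_max))
   - 2^-1 * (f0 ^+ 2 + f1 ^+ 2) * (f0 * a ord0 + f1 * a ord_max)).
  by rewrite kda ka' mulr0 !oppr0 addr0.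
ring.
Qed.

(** Testing the equation with the mode itself: the pressure does no work, and
    the viscous term absorbs the frequency lost in the divergence, so that no
    estimate of derivatives is needed. *)
Lemma energy_mode k (Y : 'I_2 -> 'I_2 -> R) (w dw : 'I_2 -> R) (p : R) :
  \sum_i freq k i * w i = 0 ->
  (forall i, dw i = \sum_j freq k j * Y i j - freq k i * p - 2^-1 * lap2 k * w i) ->
  2 * (\sum_i w i * dw i) <= \sum_i \sum_j Y i j ^+ 2.
Proof.
rewrite !sum2 => kw E; rewrite !E !sum2 /lap2 in kw *.
move: (freq k ord0) (freq k ord_max) (w ord0) (w ord_max) kw => f0 f1 w0 w1 kw.
rewrite -subr_ge0.
rewrite (_ : _ - _ = ((f0 * w0 - Y ord0 ord0) ^+ 2 + (f1 * w0 - Y ord0 ord_max) ^+ 2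
  + (f0 * w1 - Y ord_max ord0) ^+ 2 + (f1 * w1 - Y ord_max ord_max) ^+ 2)
  + 2 * p * (f0 * w0 + f1 * w1)).
  by rewrite kw mulr0 addr0 !addr_ge0// sqr_ge0.
by field.
Qed.

Lemma projdiv_continuous (T : topologicalType) k (Y : 'I_2 -> 'I_2 -> T -> R) i :
  (forall m j, continuous (Y m j)) ->
  continuous (fun t => projdiv k (fun m j => Y m j t) i).
Proof.
move=> cY; rewrite /projdiv.
have cc (c : R) : continuous (fun _ : T => c) by move=> x; exact: cst_continuous.
apply: sub_continuous; first by apply: continuous_bigsum => j; exact: mul_continuous.
apply: mul_continuous => //; apply: continuous_bigsum => m; apply: continuous_bigsum => j.
by apply: mul_continuous => //; apply: mul_continuous.
Qed.

Lemma norm_le_young (r e : R) : 0 < e -> `|r| <= e + r ^+ 2 / e.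
Proof.
move=> e0; rewrite -(ler_pM2r e0) mulrDl divfK ?gt_eqF//.
have := sqr_ge0 (`|r| - e); rewrite sqrrB real_normK ?num_real// -expr2.
have := sqr_ge0 `|r|; have := mulr_ge0 (normr_ge0 r) (ltW e0).
by rewrite real_normK ?num_real// -mulr_natl; lra.
Qed.

(** Young's inequality trades [`|r|] for [e + r ^+ 2 / e]: a remainder whose mean
    square is of order [e ^+ 2] leaves a defect of order [e]. *)
Lemma projdiv_defect k (r n n' : 'I_2 -> 'I_2 -> R) (w w' e c d : R) i : 0 < e ->
  (forall m j, `|n m j - n' m j| <= c) -> `|w - w'| <= d ->
  `|(projdiv k (fun m j => r m j - n m j) i - 2^-1 * lap2 k * w) -
    (projdiv k (fun m j => - n' m j) i - 2^-1 * lap2 k * w')| <=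
  (2 * bracket k * (4 * e + 4 * c) + 2^-1 * lap2 k * d) +
  2 * bracket k / e * (\sum_m \sum_j r m j ^+ 2).
Proof.
move=> e0 nc wd; have b0 := @bracket_gt0 R k; have l0 := lap2_ge0 k.
rewrite (_ : _ - _ = projdiv k (fun m j => (r m j - n m j) - (- n' m j)) i -
   2^-1 * lap2 k * (w - w')); last first.
  by rewrite (projdivB k (fun m j => r m j - n m j) (fun m j => - n' m j)); ring.
apply: (le_trans (ler_normB _ _)).
have h1 : `|2^-1 * lap2 k * (w - w')| <= 2^-1 * lap2 k * d.
  by rewrite normrM ger0_norm ?ler_wpM2l// mulr_ge0// invr_ge0.
have h2 := projdiv_le k (fun m j => (r m j - n m j) - (- n' m j)) i.
have h3 m j : `|(r m j - n m j) - (- n' m j)| <= (e + c) + r m j ^+ 2 / e.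
  have := norm_le_young (r m j) e0; have := nc m j.
  rewrite (_ : _ - _ - - _ = r m j - (n m j - n' m j)); last by ring.
  by have := ler_normB (r m j) (n m j - n' m j); lra.
have h4 : \sum_m \sum_j `|(r m j - n m j) - (- n' m j)| <=
    4 * e + 4 * c + (\sum_m \sum_j r m j ^+ 2) / e.
  rewrite !sum2 !mulrDl.
  by have := h3 ord0 ord0; have := h3 ord0 ord_max; have := h3 ord_max ord0;
     have := h3 ord_max ord_max; lra.
have b2 : 0 <= 2 * bracket k :> R by rewrite mulr_ge0// ltW.
rewrite [leRHS](_ : _ = 2 * bracket k * (4 * e + 4 * c + (\sum_m \sum_j r m j ^+ 2) / e) +
  2^-1 * lap2 k * d); last by ring.
by apply: lerD => //; exact: le_trans h2 (ler_wpM2l b2 h4).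
Qed.

End Projection.

(** Polarization of [coef_mul_small]: 256 is twice its constant. *)
Lemma coef_mulB (R : realType) (B d : R) (f f' g g' : R * R -> R) k th : 0 <= B -> 0 <= d ->
  continuous f -> periodic2 f -> decay3 f B ->
  continuous f' -> periodic2 f' -> decay3 f' B ->
  continuous g -> periodic2 g -> decay3 g B ->
  continuous g' -> periodic2 g' -> decay3 g' B ->
  (forall k th, `|coef f k th - coef f' k th| <= d) ->
  (forall k th, `|coef g k th - coef g' k th| <= d) ->
  `|coef (fun x => f x * g x) k th - coef (fun x => f' x * g' x) k th| <= 256 * B * d.
Proof.
move=> B0 d0 cf pf df cf' pf' df' cg pg dg cg' pg' dg' hf hg.
have bd h h' : continuous h -> periodic2 h -> decay3 h B -> continuous h' -> periodic2 h' ->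
    decay3 h' B -> forall x, `|h x - h' x| <= B * 64 + B * 64.
  move=> ch ph dh ch' ph' dh' x; apply: (le_trans (ler_normB _ _)).
  by apply: lerD; apply: decay3_bounded.
have s1 : `|coef (fun x => (f x - f' x) * g x) k th| <= 128 * B * d.
  apply: (@coef_mul_small R g (fun x => f x - f' x) B (B * 64 + B * 64) d) => //.
  - exact: sub_continuous.
  - exact: bd.
  - by move=> k' th'; rewrite coefB.
have s2 : `|coef (fun x => (g x - g' x) * f' x) k th| <= 128 * B * d.
  apply: (@coef_mul_small R f' (fun x => g x - g' x) B (B * 64 + B * 64) d) => //.
  - exact: sub_continuous.
  - exact: bd.
  - by move=> k' th'; rewrite coefB.
rewrite -coefB; [|exact: mul_continuous..].
rewrite (@eq_coef _ _ (fun x => (f x - f' x) * g x + (g x - g' x) * f' x)); last first.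
  by move=> x; ring.
rewrite coefD; [|apply: mul_continuous => //; exact: sub_continuous..].
by apply: (le_trans (ler_normD _ _)); lra.
Qed.

(** What the limit needs to know about the solutions. The stress is only
    controlled in the mean square over time, hence the integral in [ff_rem];
    [ff_clamp] says that velocities are frozen outside of [[0, T]]. *)
Record flow_family {R : realType} (T e0 C C1 : R) (U : R -> 'I_2 -> R -> R * R -> R)
    (Ta : R -> 'I_2 -> 'I_2 -> R -> R * R -> R) (P : R -> R -> R * R -> R) : Prop := {
  ff_T : 0 < T;
  ff_e0 : 0 < e0;
  ff_C : 0 <= C;
  ff_C1 : 0 <= C1;
  ff_flow : forall e, 0 < e < e0 -> flow T (U e) (Ta e) (P e);
  ff_init : forall e e' i, 0 < e < e0 -> 0 < e' < e0 -> U e i 0 = U e' i 0;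
  ff_clamp : forall e i t, U e i t = U e i (clamp T t);
  ff_H6 : forall e i t, 0 < e < e0 -> sobolev_le 6 (U e i t) C;
  ff_rem : forall e k th, 0 < e < e0 ->
    primitive (fun t => \sum_i \sum_j coef (remainder (U e) (Ta e) i j t) k th ^+ 2) T
      <= C1 * e ^+ 2 }.

Section Family.
Context {R : realType}.
Local Notation Z2 := (int * int)%type.
Variables (T e0 C C1 : R) (U : R -> 'I_2 -> R -> R * R -> R)
  (Ta : R -> 'I_2 -> 'I_2 -> R -> R * R -> R) (P : R -> R -> R * R -> R).
Hypothesis ff : flow_family T e0 C C1 U Ta P.

Let T0 := ff_T ff.
Let C0 := ff_C ff.
Let C10 := ff_C1 ff.
Let flU := ff_flow ff.
Let initU := ff_init ff.
Let clampU := ff_clamp ff.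
Let H6 := ff_H6 ff.
Let remU := ff_rem ff.

Let B := 2 * pi * Num.sqrt C.
Let B0 : 0 <= B. Proof. by rewrite /B !mulr_ge0 ?pi_ge0 ?sqrtr_ge0. Qed.

Let jU e i : 0 < e < e0 -> jC1 (U e i). Proof. by move=> /flU[]. Qed.
Let cU e i t : 0 < e < e0 -> continuous (U e i t).
Proof. by move=> /(jU i)[_ ? _ _]; exact: jcont_slice. Qed.
Let pU e i t : 0 < e < e0 -> periodic2 (U e i t).
Proof. by move=> /(jU i)[]. Qed.
Let dU e i t : 0 < e < e0 -> decay3 (U e i t) B.
Proof. by move=> eI; apply: sobolev_le_decay => //; [exact: cU|exact: H6]. Qed.

Lemma family_remainder_jcont e i j : 0 < e < e0 -> jcont (remainder (U e) (Ta e) i j).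
Proof. by move=> /flU[jU' jT _ _ _]; exact: remainder_jcont. Qed.

(* The Lipschitz constant of [coef_mulB]. *)
Let L := 256 * B.
Let L0 : 0 <= L. Proof. by rewrite /L mulr_ge0 ?ler0n. Qed.
Let cc := 8 * L ^+ 2 + 1.
Let KK := 8 * C1 * expR (2 * cc * T).

Let KK0 : 0 <= KK. Proof. by rewrite /KK !mulr_ge0 ?expR_ge0. Qed.

(** The energy of one mode of the difference satisfies [energy_mode], whose
    right-hand side contains the flux; by [coef_mulB] the latter is controlled by
    the supremum of the energies over all modes, and [gronwall_family]
    concludes. *)
Lemma modes_close e e' i t k th : 0 < e < e0 -> 0 < e' < e0 -> 0 <= t <= T ->
  (coef (U e i t) k th - coef (U e' i t) k th) ^+ 2 <= KK * (e ^+ 2 + e' ^+ 2).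
Proof.
move=> eI eI' tT.
pose W (q : Z2 * R) i t := coef (U e i t) q.1 q.2 - coef (U e' i t) q.1 q.2.
pose E q t := \sum_i W q i t ^+ 2.
pose rr ee (q : Z2 * R) t := \sum_i \sum_j coef (remainder (U ee) (Ta ee) i j t) q.1 (q.2 + pi / 2) ^+ 2.
pose rho q t := 4 * (rr e q t + rr e' q t).
pose rhs ee i t k th := (\sum_j freq k j * (coef (remainder (U ee) (Ta ee) i j t) k (th + pi / 2)
        - coef (fun x => U ee j t x * U ee i t x) k (th + pi / 2))
     - freq k i * coef (P ee t) k (th + pi / 2) - 2^-1 * lap2 k * coef (U ee i t) k th).
pose dW q i t := rhs e i t q.1 q.2 - rhs e' i t q.1 q.2.
pose dE q t := 2 * (\sum_i W q i t * dW q i t).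
have cW q j : continuous (W q j).
  by apply: sub_continuous; apply: coef_continuous; [case: (jU j eI)|case: (jU j eI')].
have cE q : continuous (E q).
  apply: continuous_bigsum => j; under eq_fun do rewrite expr2.
  by apply: mul_continuous.
have crr ee q : 0 < ee < e0 -> continuous (rr ee q).
  move=> eeI; apply: continuous_bigsum => j; apply: continuous_bigsum => l.
  have c := coef_continuous (k := q.1) (th := q.2 + pi / 2) (family_remainder_jcont (i := j) (j := l) eeI).
  by under eq_fun do rewrite expr2; exact: mul_continuous.
have crho q : continuous (rho q).
  apply: mul_continuous; first by move=> x; exact: cst_continuous.
  by apply: add_continuous; exact: crr.
have rr0 ee q s : 0 <= rr ee q s.
  by apply: sumr_ge0 => j _; apply: sumr_ge0 => l _; exact: sqr_ge0.
have rho0 q s : 0 <= rho q s by rewrite mulr_ge0 ?addr_ge0.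
have prho q : primitive (rho q) T <= 4 * (C1 * (e ^+ 2 + e' ^+ 2)).
  rewrite primitiveZ; last by apply: add_continuous; exact: crr.
  rewrite ler_wpM2l// primitiveD; [|exact: crr..].
  by rewrite mulrDr lerD//; exact: remU.
have E0 q : E q 0 = 0.
  by rewrite /E big1// => j _; rewrite /W (initU j eI eI') subrr expr0n.
have Wb q j s : `|W q j s| <= 2 * B.
  rewrite /W; apply: (le_trans (ler_normB _ _)); rewrite mulr2n mulrDl mul1r.
  have b1 : B * (bracket q.1 ^+ 3)^-1 <= B.
    by rewrite ler_piMr// invf_le1 ?exprn_gt0 ?bracket_gt0// exprn_ege1// bracket_ge1.
  by apply: lerD; apply: le_trans b1; [exact: (dU j s eI)|exact: (dU j s eI')].
have Eb q s : 0 <= s <= T -> 0 <= E q s <= 8 * B ^+ 2.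
  move=> _; apply/andP; split; first by apply: sumr_ge0 => j _; exact: sqr_ge0.
  have h j : W q j s ^+ 2 <= 4 * B ^+ 2.
    have -> : 4 * B ^+ 2 = (2 * B) ^+ 2 by ring.
    exact: sqr_le_norm.
  by rewrite /E sum2; have := h ord0; have := h ord_max; lra.
have dEP q s : 0 < s < T -> is_derive s 1 (E q) (dE q s).
  move=> sI.
  have dWP j : is_derive s 1 (W q j) (dW q j s).
    have d1 := flow_mode (flU eI) j q.1 q.2 sI.
    have d2 := flow_mode (flU eI') j q.1 q.2 sI.
    exact: is_deriveB.
  have d0 := dWP ord0; have d1 := dWP ord_max.
  have := is_derive_sqr2 d0 d1.
  rewrite (_ : (fun r => _) = E q); last by apply/funext => r; rewrite /E sum2.
  by rewrite /dE sum2.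
have dEle q s D : 0 < s < T -> (forall q', E q' s <= D) -> dE q s <= cc * D + rho q s.
  move=> sI ED.
  have D0 : 0 <= D by apply: le_trans (ED q); case/andP: (Eb q s (introT andP (conj (ltW (andP sI).1) (ltW (andP sI).2)))).
  pose Nn ee j i := coef (fun x => U ee j s x * U ee i s x) q.1 (q.2 + pi / 2).
  pose Rm ee i j := coef (remainder (U ee) (Ta ee) i j s) q.1 (q.2 + pi / 2).
  pose Y i j := (Rm e i j - Nn e j i) - (Rm e' i j - Nn e' j i).
  have dv ee : 0 < ee < e0 -> \sum_j freq q.1 j * coef (U ee j s) q.1 q.2 = 0.
    by move=> eeI; exact: (flow_div (flU eeI)).
  have kw : \sum_j freq q.1 j * W q j s = 0.
    under eq_bigr do rewrite mulrBr.
    by rewrite sumrB !dv// subrr.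
  have := @energy_mode R q.1 Y (W q ^~ s) (dW q ^~ s)
     (coef (P e s) q.1 (q.2 + pi / 2) - coef (P e' s) q.1 (q.2 + pi / 2)) kw.
  move=> /(_ _) /le_trans; apply.
    move=> j; rewrite /dW /rhs /W /Y /=.
    exact: (@mode_diff R q.1 (Rm e) (fun i j => Nn e j i) (Rm e') (fun i j => Nn e' j i)
      _ _ (coef (U e j s) q.1 q.2) (coef (U e' j s) q.1 q.2) j).
  have Wd q' j : `|W q' j s| <= Num.sqrt D.
    rewrite -sqrtr_sqr ler_wsqrtr//; apply: le_trans (ED q').
    by rewrite /E (bigD1 j)//= lerDl; apply: sumr_ge0 => ? _; exact: sqr_ge0.
  have Nb j l : (Nn e j l - Nn e' j l) ^+ 2 <= L ^+ 2 * D.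
    have -> : L ^+ 2 * D = (L * Num.sqrt D) ^+ 2.
      by rewrite [RHS]exprMn sqr_sqrtr.
    apply: sqr_le_norm; exact: (coef_mulB q.1 (q.2 + pi / 2) B0 (sqrtr_ge0 D)
      (@cU e j s eI) (pU j s eI) (dU j s eI) (@cU e' j s eI') (pU j s eI') (dU j s eI')
      (@cU e l s eI) (pU l s eI) (dU l s eI) (@cU e' l s eI') (pU l s eI') (dU l s eI')
      (fun k' th' => Wd (k', th') j) (fun k' th' => Wd (k', th') l)).
  have Yb j l : Y j l ^+ 2 <= 2 * (L ^+ 2 * D) + 4 * (Rm e j l ^+ 2 + Rm e' j l ^+ 2).
    exact: sqr_sub4_le (Nb l j).
  apply: (@le_trans _ _ (\sum_j \sum_l (2 * (L ^+ 2 * D) + 4 * (Rm e j l ^+ 2 + Rm e' j l ^+ 2)))).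
    by apply: ler_sum => j _; apply: ler_sum => l _.
  have h8 : 8 * (L ^+ 2 * D) <= cc * D.
    by rewrite (_ : cc * D = 8 * (L ^+ 2 * D) + D) ?lerDl// /cc; move: (L ^+ 2) => l2; ring.
  exact: (sum_young (Rm e) (Rm e') h8).
have cc0 : 0 < cc by rewrite /cc; have := sqr_ge0 L; lra.
have := gronwall_family cc0 T0 cE crho rho0 prho E0 Eb dEP dEle (k, th) tT.
have : W (k, th) i t ^+ 2 <= E (k, th) t.
  by rewrite /E (bigD1 i)//= lerDl; apply: sumr_ge0 => ? _; exact: sqr_ge0.
move=> /le_trans h /h {h}; rewrite /W /= => /le_trans; apply.
rewrite le_eqVlt; apply/orP; left; apply/eqP; rewrite /KK.
have ex := expR_gt0 (2 * cc * T).
by move: (expR _) => X; ring.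
Qed.

Lemma modes_cauchy : exists2 K, 0 <= K & forall e e' i t k th, 0 < e < e0 -> 0 < e' < e0 ->
  `|coef (U e i t) k th - coef (U e' i t) k th| <= K * (e + e').
Proof.
exists (Num.sqrt KK); first exact: sqrtr_ge0.
move=> e e' i t k th eI eI'; rewrite clampU [U e' i t]clampU.
have [e1 _] := andP eI; have [e1' _] := andP eI'.
have h := modes_close i k th eI eI' (clamp_itv t (ltW T0)).
rewrite -sqrtr_sqr; apply: (le_trans (ler_wsqrtr h)).
rewrite sqrtrM// ler_wpM2l ?sqrtr_ge0//.
rewrite -[leRHS]ger0_norm; last by lra.
by rewrite -sqrtr_sqr ler_wsqrtr// sqrD_le// ltW.
Qed.

End Family.

(** * The limiting modes *)

Section LimitModes.
Context {R : realType}.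
Local Notation Z2 := (int * int)%type.

(** The Navier-Stokes equations mode by mode, the pressure being eliminated by
    the projection. *)
Record ns_modes (T B : R) (a : 'I_2 -> R -> Z2 -> R -> R) : Prop := {
  ns_T : 0 < T;
  ns_B : 0 <= B;
  ns_trig : forall i t, trig (a i t);
  ns_dom : forall i t, dominated (a i t) (fun k => B * (bracket k ^+ 3)^-1);
  ns_cont : forall i k th, continuous (fun t => a i t k th);
  ns_div : forall t k th, 0 < t < T -> \sum_j freq k j * a j t k th = 0;
  ns_ode : forall i t k th, 0 < t < T -> is_derive t 1 (fun s => a i s k th)
    (projdiv k (fun m j => - coef (fun x => synth (a j t) x * synth (a m t) x) k (th + pi / 2)) i
     - 2^-1 * lap2 k * a i t k th) }.

Variables (T e0 C C1 : R) (U : R -> 'I_2 -> R -> R * R -> R)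
  (Ta : R -> 'I_2 -> 'I_2 -> R -> R * R -> R) (P : R -> R -> R * R -> R).
Hypothesis ff : flow_family T e0 C C1 U Ta P.

Let B := 2 * pi * Num.sqrt C.
Let B0 : 0 <= B. Proof. by rewrite /B !mulr_ge0 ?pi_ge0 ?sqrtr_ge0. Qed.
Let jU e i : 0 < e < e0 -> jC1 (U e i). Proof. by move=> /(ff_flow ff)[]. Qed.
Let cU e i t : 0 < e < e0 -> continuous (U e i t).
Proof. by move=> /(jU i)[_ ? _ _]; exact: jcont_slice. Qed.
Let pU e i t : 0 < e < e0 -> periodic2 (U e i t).
Proof. by move=> /(jU i)[]. Qed.
Let dU e i t : 0 < e < e0 -> decay3 (U e i t) B.
Proof.
by move=> eI; apply: sobolev_le_decay; [exact: cU|exact: ff_C ff|exact: (ff_H6 ff)].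
Qed.

Lemma small_right : \forall e \near 0^'+, 0 < e < e0.
Proof.
near=> e; apply/andP; split; first by near: e; exact: nbhs_right_gt.
by near: e; apply: nbhs_right_lt; exact: ff_e0 ff.
Unshelve. all: by end_near. Qed.

Lemma cvg_of_rate (f : R -> R) (l K : R) : 0 <= K ->
  (forall e, 0 < e < e0 -> `|f e - l| <= K * e) -> f e @[e --> 0^'+] --> l.
Proof.
move=> K0 h; apply/cvgrPdist_le => eta eta0.
have d0 : 0 < eta / (K + 1) by rewrite divr_gt0//; lra.
near=> e.
have eI : 0 < e < e0 by near: e; exact: small_right.
have ed : e <= eta / (K + 1) by near: e; exact: nbhs_right_le.
rewrite distrC; apply: (le_trans (h e eI)).
have K1 : 0 < K + 1 by lra.
rewrite ler_pdivlMr// in ed; have [e1 _] := andP eI.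
by apply: le_trans ed; rewrite mulrC ler_wpM2l ?(ltW e1)//; lra.
Unshelve. all: by end_near. Qed.

Lemma modes_limit : exists K (a : 'I_2 -> R -> Z2 -> R -> R), 0 <= K /\
  forall e i t k th, 0 < e < e0 -> `|coef (U e i t) k th - a i t k th| <= K * e.
Proof.
have [K K0 HK] := modes_cauchy ff.
exists K, (fun i t k th => lim (coef (U e i t) k th @[e --> 0^'+])); split=> // e i t k th eI.
have c : cvg (coef (U e i t) k th @[e --> 0^'+]).
  apply/cauchy_cvgP/cauchy_exP => eta eta0.
  pose d := Num.min (e0 / 2) (eta / (2 * (K + 1))).
  have K1 : 0 < 2 * (K + 1) by lra.
  have d0 : 0 < d by rewrite lt_min !divr_gt0//; exact: ff_e0 ff.
  have de : d < e0.
    by rewrite gt_min; apply/orP; left; have := ff_e0 ff; lra.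
  have dk : d * (2 * (K + 1)) <= eta by rewrite -ler_pdivlMr// ge_min lexx orbT.
  have dI : 0 < d < e0 by rewrite d0 de.
  exists (coef (U d i t) k th).
  have n2 : \forall e \near 0^'+, e < d by exact: nbhs_right_lt.
  apply: filterS2 small_right n2 => e' eI' ed'; rewrite /= -ball_normE /=.
  apply: (le_lt_trans (HK d e' i t k th dI eI')); apply: lt_le_trans dk.
  have : K * (d + e') <= K * (2 * d) by rewrite ler_wpM2l//; lra.
  move/le_lt_trans; apply.
  by rewrite (_ : d * (2 * (K + 1)) = K * (2 * d) + 2 * d); [rewrite ltrDl; lra|ring].
have H : `|coef (U e i t) k th - coef (U e' i t) k th| @[e' --> 0^'+] -->
    `|coef (U e i t) k th - lim (coef (U e i t) k th @[e --> 0^'+])|.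
  by apply: cvg_norm; apply: cvgB => //; exact: cvg_cst.
have H2 : K * (e + e') @[e' --> 0^'+] --> K * (e + 0).
  apply: cvgMr; apply: cvgD; first exact: cvg_cst.
  by apply: cvg_at_right_filter; exact: cvg_id.
rewrite -[X in _ * X]addr0.
apply: ler_cvg_to H H2 _.
by apply: filterS small_right => e' eI'; exact: HK.
Qed.

Variables (K : R) (a : 'I_2 -> R -> Z2 -> R -> R).
Hypothesis K0 : 0 <= K.
Hypothesis close : forall e i t k th, 0 < e < e0 ->
  `|coef (U e i t) k th - a i t k th| <= K * e.

Let cvga i t k th : coef (U e i t) k th @[e --> 0^'+] --> a i t k th.
Proof. by apply: (@cvg_of_rate (fun e => coef (U e i t) k th) _ K) => // e eI; exact: close. Qed.

Lemma limit_trig i t : trig (a i t).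
Proof.
apply: (trig_lim (F := 0^'+) (a := fun e => coef (U e i t))) => //.
by apply: filterS small_right => e eI; apply: trig_coef; exact: cU.
Qed.

Lemma small_param (c eta : R) : 0 <= c -> 0 < eta -> exists e, 0 < e < e0 /\ c * e <= eta.
Proof.
move=> c0 eta0; pose d := Num.min (e0 / 2) (eta / (c + 1)).
have c1 : 0 < c + 1 by rewrite ltr_wpDl.
have d0 : 0 < d by rewrite lt_min !divr_gt0//; exact: ff_e0 ff.
have de : d < e0 by rewrite gt_min; apply/orP; left; have := ff_e0 ff; lra.
have dk : d * (c + 1) <= eta by rewrite -ler_pdivlMr// ge_min lexx orbT.
exists d; rewrite d0 de; split=> //; apply: le_trans dk.
by rewrite mulrC ler_wpM2l ?(ltW d0)// lerDl.
Qed.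

Lemma limit_dom i t : dominated (a i t) (fun k => B * (bracket k ^+ 3)^-1).
Proof.
move=> k th; apply/ler_addgt0Pl => eta eta0.
have [e [eI Ke]] := small_param K0 eta0.
have h := le_trans (close i t k th eI) Ke; have h2 := dU i t eI k th.
rewrite -[a i t k th](subKr (coef (U e i t) k th)).
by apply: (le_trans (ler_normB _ _)); rewrite addrC lerD.
Qed.

Lemma limit_cont i k th : continuous (fun t => a i t k th).
Proof.
move=> t; apply/cvgrPdist_le => eta eta0.
have e3 : 0 < eta / 3 by rewrite divr_gt0.
have [e [eI Ke]] := small_param K0 e3.
have c : continuous (fun t => coef (U e i t) k th).
  by apply: coef_continuous; case: (jU i eI).
have /cvgrPdist_le/(_ _ e3) n1 := c t.
near=> s.
have h1 : `|coef (U e i t) k th - coef (U e i s) k th| <= eta / 3 by near: s.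
have h2 := le_trans (close i t k th eI) Ke.
have h3 := le_trans (close i s k th eI) Ke.
move: h1 h2 h3; move: (coef _ _ _) (coef _ _ _) (a _ _ _ _) (a _ _ _ _) => p q r s'.
rewrite !ler_norml => /andP[? ?] /andP[? ?] /andP[? ?]; apply/andP; split; lra.
Unshelve. all: by end_near. Qed.

Lemma limit_div t k th : 0 < t < T -> \sum_j freq k j * a j t k th = 0.
Proof.
move=> tT.
have H : \sum_j freq k j * coef (U e j t) k th @[e --> 0^'+] --> \sum_j freq k j * a j t k th.
  under eq_fun do rewrite sum2.
  by rewrite sum2; apply: cvgD; apply: cvgMr; exact: cvga.
apply: (cvg_unique _ H) => //; apply: cvg_near_cst.
by apply: filterS small_right => e eI; exact: (flow_div (ff_flow ff eI)).
Qed.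

Let v i t := synth (a i t).

Lemma limit_jcont i : jcont (v i).
Proof.
apply: (synth_jcont (decay3_majorant B0)).
- by move=> t; exact: limit_trig.
- by move=> t; exact: limit_dom.
- by move=> k th; exact: limit_cont.
Qed.

Lemma limit_coef i t k th : coef (v i t) k th = a i t k th.
Proof. exact: (coef_synth _ _ (decay3_majorant B0) (limit_trig i t) (limit_dom i t)). Qed.

Let cv i t : continuous (v i t).
Proof. exact: (jcont_slice (limit_jcont (i := i))). Qed.
Let pv i t : periodic2 (v i t).
Proof. exact: synth_period (limit_trig i t). Qed.
Let dv i t : decay3 (v i t) B.
Proof. by move=> k th; rewrite limit_coef; exact: limit_dom. Qed.

(** All the frequencies of the velocity enter one mode of the flux, so that the
    rate of convergence has to be uniform in the mode. *)
Lemma limit_flux e i j t k th : 0 < e < e0 ->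
  `|coef (fun x => U e j t x * U e i t x) k th - coef (fun x => v j t x * v i t x) k th|
  <= 256 * B * (K * e).
Proof.
move=> eI; have [e1 _] := andP eI.
have Ke : 0 <= K * e by rewrite mulr_ge0// ltW.
have h i' k' th' : `|coef (U e i' t) k' th' - coef (v i' t) k' th'| <= K * e.
  by rewrite limit_coef; exact: close.
exact: (coef_mulB k th B0 Ke (@cU e j t eI) (pU j t eI) (dU j t eI) (@cv j t) (pv j t)
  (dv j t) (@cU e i t eI) (pU i t eI) (dU i t eI) (@cv i t) (pv i t) (dv i t) (h j) (h i)).
Qed.

Lemma flow_mode_projdiv e i t k th : 0 < e < e0 -> 0 < t < T ->
  is_derive t 1 (fun s => coef (U e i s) k th)
   (projdiv k (fun m j => coef (remainder (U e) (Ta e) m j t) k (th + pi / 2) -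
      coef (fun x => U e j t x * U e m t x) k (th + pi / 2)) i
    - 2^-1 * lap2 k * coef (U e i t) k th).
Proof.
move=> eI tT; have fl := ff_flow ff eI.
pose Y m j := coef (remainder (U e) (Ta e) m j t) k (th + pi / 2) -
      coef (fun x => U e j t x * U e m t x) k (th + pi / 2).
pose w m s := coef (U e m s) k th.
pose dw m := \sum_j freq k j * Y m j - freq k m * coef (P e t) k (th + pi / 2)
  - 2^-1 * lap2 k * w m t.
have D m : is_derive t 1 (w m) (dw m) by exact: (flow_mode fl m k th tT).
have kw : \sum_m freq k m * w m t = 0 by exact: (flow_div fl).
have kdw : \sum_m freq k m * dw m = 0.
  have dZ m : is_derive t 1 (fun s => freq k m * w m s) (freq k m * dw m).
    by have d := D m; exact: (@is_deriveZ _ _ _ (w m)).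
  have z : is_derive t 1 (fun s => freq k ord0 * w ord0 s + freq k ord_max * w ord_max s) (0 : R).
    apply: (is_derive_eq_near tT (g := fun=> 0)) => s sI.
    by have := flow_div fl k th sI; rewrite sum2.
  have z' := is_deriveD (dZ ord0) (dZ ord_max).
  have e1 := @derive_val _ _ _ _ _ _ _ z; have e2 := @derive_val _ _ _ _ _ _ _ z'.
  by rewrite sum2 -[RHS]e1 -[LHS]e2.
have E := @projdiv_elim R k Y (w ^~ t) dw _ kw kdw (fun=> erefl) i.
rewrite -[X in is_derive _ _ _ X]/(projdiv k Y i - 2^-1 * lap2 k * w i t) -E.
exact: D.
Qed.

(** Integrated in time, the defect of the flow modes vanishes with the
    parameter; the limiting modes therefore satisfy the integrated, hence the
    differential, equation. *)
Lemma limit_ode i t k th : 0 < t < T -> is_derive t 1 (fun s => a i s k th)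
  (projdiv k (fun m j => - coef (fun x => v j t x * v m t x) k (th + pi / 2)) i
   - 2^-1 * lap2 k * a i t k th).
Proof.
move=> tT.
pose n m j s := coef (fun x => v j s x * v m s x) k (th + pi / 2).
pose h s := projdiv k (fun m j => - n m j s) i - 2^-1 * lap2 k * a i s k th.
have cc (c : R) : continuous (fun _ : R => c) by move=> x; exact: cst_continuous.
have ch : continuous h.
  apply: sub_continuous.
    apply: (@projdiv_continuous _ _ k (fun m j s => - n m j s)) => m j s.
    apply: continuousN; apply: coef_continuous.
    exact: (jcont_mul (limit_jcont (i := j)) (limit_jcont (i := m))).
  by apply: mul_continuous => //; exact: limit_cont.
have T0 := ff_T ff.
pose D := (2 * bracket k * (4 + 4 * (256 * B * K)) + 2^-1 * lap2 k * K) * T +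
  2 * bracket k * C1 + 2 * K.
have b0 := @bracket_gt0 R k.
have F0 (x : R) : 0 <= x -> 0 <= 256 * B * x.
  move=> x0; apply: mulr_ge0; last exact: x0.
  by apply: mulr_ge0; [exact: ler0n|exact: B0].
have D0 : 0 <= D.
  rewrite /D; have := F0 K K0; move: (256 * B * K) (ff_C1 ff) (@lap2_ge0 R k) => F c1 l0 f0.
  by repeat first [done|exact: ltW|apply: addr_ge0|apply: mulr_ge0|rewrite invr_ge0].
have key e s : 0 < e < e0 -> 0 <= s <= T ->
    `|a i s k th - primitive h s - a i 0 k th| <= D * e.
  move=> eI sT; have [e1 _] := andP eI.
  pose Q r := \sum_m \sum_j coef (remainder (U e) (Ta e) m j r) k (th + pi / 2) ^+ 2.
  have cQ : continuous Q.
    apply: continuous_bigsum => m; apply: continuous_bigsum => j.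
    have c := coef_continuous (k := k) (th := th + pi / 2) (family_remainder_jcont ff (i := m) (j := j) eI).
    by under eq_fun do rewrite expr2; exact: mul_continuous.
  pose A := 2 * bracket k * (4 * e + 4 * (256 * B * (K * e))) + 2^-1 * lap2 k * (K * e).
  pose f r := coef (U e i r) k th - primitive h r.
  have cf : {within `[0, T], continuous f}.
    have c1 : {within `[0, T], continuous (fun r => coef (U e i r) k th)}.
      by apply: continuous_subspaceT; apply: coef_continuous; case: (jU i eI).
    have c2 := primitive_within_continuous ch (ltW T0).
    exact: (fun r => continuousB (c1 r) (c2 r)).
  have cg : continuous (fun r => A + 2 * bracket k / e * Q r).
    by apply: add_continuous => //; exact: mul_continuous.
  have fP r : 0 < r < T -> is_derive r 1 f
     ((projdiv k (fun m j => coef (remainder (U e) (Ta e) m j r) k (th + pi / 2) -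
        coef (fun x => U e j r x * U e m r x) k (th + pi / 2)) i
      - 2^-1 * lap2 k * coef (U e i r) k th) - h r).
    move=> rT; have d1 := flow_mode_projdiv i k th eI rT.
    have d2 := is_derive_primitive ch (andP rT).1.
    exact: is_deriveB.
  have H := primitive_compare_norm cf cg fP _ sT.
  have {}H : `|f s - f 0| <= primitive (fun r => A + 2 * bracket k / e * Q r) s.
    apply: H => r rT; apply: projdiv_defect => //.
      by move=> m j; exact: limit_flux.
    exact: close.
  have Q0 r : 0 <= A + 2 * bracket k / e * Q r.
    have q0 : 0 <= Q r by apply: sumr_ge0 => m _; apply: sumr_ge0 => j _; exact: sqr_ge0.
    have := F0 (K * e) (mulr_ge0 K0 (ltW e1)); rewrite /A.
    move: (256 * B * (K * e)) (@lap2_ge0 R k) (mulr_ge0 K0 (ltW e1)) => F l0 ke f0.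
    by repeat first [done|exact: ltW|apply: addr_ge0|apply: mulr_ge0|rewrite invr_ge0].
  have H2 := primitive_le cg Q0 sT.
  rewrite [X in _ <= X]primitiveD in H2; [|exact: cc|exact: mul_continuous].
  rewrite primitive_cst ?(ltW T0)// primitiveZ// in H2.
  have H3 : 2 * bracket k / e * primitive Q T <= 2 * bracket k * C1 * e.
    have := ff_rem ff k (th + pi / 2) eI; rewrite -/Q => hQ.
    have q : 0 <= 2 * bracket k / e by rewrite mulr_ge0 ?mulr_ge0 ?invr_ge0 ?(ltW b0) ?(ltW e1).
    apply: (le_trans (ler_wpM2l q hQ)); rewrite le_eqVlt; apply/orP; left; apply/eqP.
    by field; rewrite gt_eqF.
  have h1 := close i s k th eI; have h2 := close i 0 k th eI.
  have AE : A * T = (2 * bracket k * (4 + 4 * (256 * B * K)) + 2^-1 * lap2 k * K) * T * e.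
    rewrite /A; move: (256 : R) (4 : R) (2 : R) => x y z; ring.
  move: H H2 H3 h1 h2; rewrite /f primitive0 subr0 AE /D.
  move: (primitive _ s) (primitive h s) (_ * primitive Q T) => p1 p2 p3.
  move: (coef _ _ _) (coef _ _ _) (a _ _ _ _) (a _ _ _ _) => u0 u1 x0 x1.
  move: (_ * T) (2 * bracket k * C1) => y0 y1.
  rewrite !ler_norml => /andP[? ?] ? ? /andP[? ?] /andP[? ?]; apply/andP; split; lra.
have E s : 0 < s < T -> a i s k th = a i 0 k th + primitive h s.
  move=> /andP[s0 sT]; apply/eqP; rewrite -subr_eq0 -normr_le0.
  apply/ler_addgt0Pl => eta eta0; rewrite addr0.
  have [e [eI De]] := small_param D0 eta0.
  apply: le_trans De; apply: le_trans (key e s eI _); last by rewrite !ltW.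
  by rewrite opprD addrA addrAC.
apply: (is_derive_eq_near tT E).
have d := is_derive_primitive ch (andP tT).1.
have d0 : is_derive t 1 (fun _ : R => a i 0 k th) (0 : R) by exact: is_derive_cst.
by have := is_deriveD d0 d; rewrite add0r.
Qed.

Lemma limit_ns_modes : ns_modes T B a.
Proof.
split.
- exact: ff_T ff.
- exact: B0.
- exact: limit_trig.
- exact: limit_dom.
- exact: limit_cont.
- exact: limit_div.
- exact: limit_ode.
Qed.

End LimitModes.

(** * From the limiting modes to the Navier-Stokes equations *)

Section NavierStokesModes.
Context {R : realType}.
Local Notation Z2 := (int * int)%type.

Lemma jC1_synth (A : R -> Z2 -> R -> R) M Z M' Z' : majorant M Z -> majorant M' Z' ->
  (forall t, trig (A t)) -> (forall k th, continuous (fun t => A t k th)) ->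
  (forall t, dominated (A t) M) -> (forall j t, dominated (dcoef j (A t)) M') ->
  jC1 (fun t => synth (A t)) /\
  forall j t, pd j (synth (A t)) = synth (dcoef j (A t)).
Proof.
move=> MZ MZ' tA cA dA dA'.
have D j t x := synth_pd x MZ MZ' (tA t) (dA t) (dA' j t).
have E j t : pd j (synth (A t)) = synth (dcoef j (A t)).
  by apply/funext => x; have d := D j t x; rewrite /pd derive_val.
split=> //; split.
- by move=> t; apply: synth_period.
- exact: synth_jcont MZ tA dA cA.
- by move=> t x j; have [] := D j t x.
- move=> j; under eq_fun do rewrite E.
  apply: (@synth_jcont R (fun t => dcoef j (A t)) M' Z' MZ').
  + by move=> t; exact: trig_dcoef.
  + by move=> t; exact: dA'.
  + move=> k th; apply: mul_continuous; first by move=> x; exact: cst_continuous.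
    exact: cA.
Qed.

Variables (T B : R) (a : 'I_2 -> R -> Z2 -> R -> R).
Hypothesis ns : ns_modes T B a.

Let v i t := synth (a i t).
Let T0 := ns_T ns.
Let B0 := ns_B ns.
Let ta := ns_trig ns.
Let da := ns_dom ns.
Let ca := ns_cont ns.

Lemma majorant_decay2 (c : R) : 0 <= c ->
  majorant (fun k => c * (bracket k ^+ 2)^-1) (c * 64).
Proof. by move=> c0; exact: majorantZ majorant_bracket2. Qed.

(** A derivative costs one power of the bracket, so three powers leave room for
    one derivative in a summable series; two derivatives of the velocity are
    summable because [freq2_decay] counts them together. *)
Lemma freq_decay (x c : R) k j n : 0 <= c -> `|x| <= c * (bracket k ^+ n.+1)^-1 ->
  `|freq k j * x| <= c * (bracket k ^+ n)^-1.
Proof.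
move=> c0 h; have b0 := @bracket_gt0 R k; rewrite normrM.
apply: (le_trans (ler_pM (normr_ge0 _) (normr_ge0 _) (freq_le_bracket k j) h)).
by rewrite mulrCA ler_wpM2l// exprSr invfM mulrA mulrAC divff ?gt_eqF// mul1r.
Qed.

Lemma freq2_decay (x c : R) k j l : 0 <= c -> `|x| <= c * (bracket k ^+ 3)^-1 ->
  `|freq k j * (freq k l * x)| <= c * (bracket k ^+ 2)^-1.
Proof.
move=> c0 h; have b0 := @bracket_gt0 R k; rewrite mulrA normrM.
have hf := le_trans (freq2_le_lap2 k j l) (@lap2_le R k).
apply: (le_trans (ler_pM (normr_ge0 _) (normr_ge0 _) hf h)).
by rewrite mulrCA ler_wpM2l// exprSr invfM mulrA mulrAC divff ?gt_eqF// mul1r.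
Qed.

Lemma jC1_velocity i : jC1 (v i) /\ forall j t, pd j (v i t) = synth (dcoef j (a i t)).
Proof.
apply: (jC1_synth (decay3_majorant B0) (majorant_decay2 B0)).
- exact: ta.
- exact: ca.
- exact: da.
- by move=> j t k th; apply: freq_decay B0 _; exact: da.
Qed.

Let v1 := jC1_velocity.

Let v2 i j : jC1 (fun t => synth (dcoef j (a i t))) /\
  forall l t, pd l (synth (dcoef j (a i t))) = synth (dcoef l (dcoef j (a i t))).
Proof.
apply: (jC1_synth (majorant_decay2 B0) (majorant_decay2 B0)).
- by move=> t; exact: trig_dcoef.
- move=> k th; apply: mul_continuous; first by move=> x; exact: cst_continuous.
  exact: ca.
- by move=> t k th; apply: freq_decay B0 _; exact: da.
- move=> l t k th; rewrite /dcoef; apply: freq2_decay B0 _; exact: da.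
Qed.

Let cv i t : continuous (v i t).
Proof. by have [[_ c _ _] _] := v1 i; exact: (jcont_slice c). Qed.

Let coefv i t k th : coef (v i t) k th = a i t k th.
Proof. exact: (coef_synth _ _ (decay3_majorant B0) (ta i t) (da i t)). Qed.

Let flux m j t x := v j t x * v m t x.

Let jflux m j : jC1 (flux m j).
Proof. by have [] := jC1_mul (v1 j).1 (v1 m).1. Qed.

Let cflux m j t : continuous (flux m j t).
Proof. by have [_ c _ _] := jflux m j; exact: (jcont_slice c). Qed.

Let N := 8192 * B * B.
Let N0 : 0 <= N.
Proof.
have h (c d : R) : 0 <= c -> 0 <= d -> 0 <= c * d * d by move=> *; rewrite !mulr_ge0.
exact: h (ler0n _ _) B0.
Qed.

Let dflux m j t : dominated (coef (flux m j t)) (fun k => N * (bracket k ^+ 3)^-1).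
Proof.
have pv i : periodic2 (v i t) by exact: synth_period.
have dv i : decay3 (v i t) B by move=> k th; rewrite coefv; exact: da.
exact: (decay3_mul B0 B0 (@cv m t) (pv m) (dv m) (@cv j t) (pv j) (dv j)).
Qed.

(** The pressure solves the Poisson equation given by the divergence of the
    momentum equation. *)
Definition pressure_coef t : Z2 -> R -> R := fun k th =>
  \sum_m \sum_j freq k m * freq k j * (- coef (flux m j t) k th) / lap2 k.

Lemma pressure_trig t : trig (pressure_coef t).
Proof.
apply: trig_sum => m; apply: trig_sum => j.
have tf := trig_coef (@cflux m j t).
have := trig_mulfreq (w := fun k => - (freq k m * freq k j / lap2 k)) _ tf.
rewrite (_ : (fun k th => - _ * _) = fun k th =>
  freq k m * freq k j * (- coef (flux m j t) k th) / lap2 k); last first.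
  by apply/funext => k; apply/funext => th; ring.
apply=> k; have fN l : freq (- k) l = - freq k l :> R.
  by rewrite /freq; case: ifP => _; rewrite /= mulrNz.
by rewrite /lap2 !fN !sqrrN mulrNN.
Qed.

Lemma pressure_dom t : dominated (pressure_coef t) (fun k => 4 * N * (bracket k ^+ 3)^-1).
Proof.
move=> k th.
have h m j : `|freq k m * freq k j * (- coef (flux m j t) k th) / lap2 k| <=
    N * (bracket k ^+ 3)^-1.
  apply: le_trans (dflux m j t k th).
  rewrite mulrAC normrM normrN -[leRHS]mul1r ler_wpM2r//.
  rewrite normrM normfV (ger0_norm (lap2_ge0 k)).
  have [l0|l0] := eqVneq (lap2 k : R) 0; first by rewrite l0 invr0 mulr0.
  by rewrite ler_pdivrMr ?mul1r ?freq2_le_lap2// lt_neqAle eq_sym l0 lap2_ge0.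
apply: (@le_trans _ _ (\sum_(m < 2) \sum_(j < 2) N * (bracket k ^+ 3)^-1)).
  apply: (le_trans (ler_norm_sum _ _ _)); apply: ler_sum => m _.
  by apply: (le_trans (ler_norm_sum _ _ _)); apply: ler_sum => j _.
by rewrite !sum2 -[4 * N * _]mulrA; move: (N * _) => z; lra.
Qed.

Lemma pressure_cont k th : continuous (fun t => pressure_coef t k th).
Proof.
apply: continuous_bigsum => m; apply: continuous_bigsum => j.
apply: mul_continuous; last by move=> x; exact: cst_continuous.
apply: mul_continuous; first by move=> x; exact: cst_continuous.
have c : continuous (fun t => coef (flux m j t) k th).
  by apply: coef_continuous; case: (jflux m j).
by move=> t; exact: (continuousN (c t)).
Qed.

Let N40 : 0 <= 4 * N. Proof. by apply: mulr_ge0 => //; exact: ler0n. Qed.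

Let q1 : jC1 (fun t => synth (pressure_coef t)) /\
  forall j t, pd j (synth (pressure_coef t)) = synth (dcoef j (pressure_coef t)).
Proof.
apply: (jC1_synth (decay3_majorant N40) (majorant_decay2 N40)).
- exact: pressure_trig.
- exact: pressure_cont.
- exact: pressure_dom.
- by move=> j t k th; apply: freq_decay N40 _; exact: pressure_dom.
Qed.

(** The right-hand side of [ns_ode], which is the family of coefficients of the
    time derivative. *)
Let L i t : Z2 -> R -> R := fun k th =>
  projdiv k (fun m j => - coef (flux m j t) k (th + pi / 2)) i - 2^-1 * lap2 k * a i t k th.

Let LE i t k th : L i t k th = - (\sum_j dcoef j (coef (flux i j t)) k th)
  - dcoef i (pressure_coef t) k th - 2^-1 * (lap2 k * a i t k th).
Proof.
rewrite /L /projdiv /dcoef /pressure_coef; rewrite -mulrA; congr (_ - _ - _).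
by rewrite !sum2; ring.
Qed.

Let tL i t : trig (L i t).
Proof.
have lN k : lap2 (- k) = lap2 k :> R.
  by rewrite /lap2 /freq /= !mulrNz !sqrrN.
have t1 : trig (fun k th => \sum_j dcoef j (coef (flux i j t)) k th).
  by apply: trig_sum => j; apply: trig_dcoef; apply: trig_coef; exact: cflux.
have t2 := trig_dcoef i (pressure_trig t).
have t3 := trig_mulfreq lN (ta i t).
have t4 := trig_lin (-1) (-1) t1 t2.
have t5 := trig_lin 1 (- 2^-1) t4 t3.
have -> : L i t = (fun k th => 1 * (-1 * (\sum_j dcoef j (coef (flux i j t)) k th) +
   -1 * dcoef i (pressure_coef t) k th) + - 2^-1 * (lap2 k * a i t k th)) by
  apply/funext => k; apply/funext => th; rewrite LE; ring.
exact: t5.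
Qed.

Let M := 8 * N + B.
Let M0 : 0 <= M. Proof. by apply: addr_ge0 => //; apply: mulr_ge0 => //; exact: ler0n. Qed.

Let dL i t : dominated (L i t) (fun k => M * (bracket k ^+ 2)^-1).
Proof.
move=> k th; have b0 := @bracket_gt0 R k.
have h1 := projdiv_le k (fun m j => - coef (flux m j t) k (th + pi / 2)) i.
have h2 : \sum_m \sum_j `|- coef (flux m j t) k (th + pi / 2)| <= 4 * (N * (bracket k ^+ 3)^-1).
  apply: (@le_trans _ _ (\sum_(m < 2) \sum_(j < 2) N * (bracket k ^+ 3)^-1)).
    by apply: ler_sum => m _; apply: ler_sum => j _; rewrite normrN; exact: dflux.
  by rewrite !sum2; move: (N * _) => z; lra.
have h3 : `|2^-1 * lap2 k * a i t k th| <= 2^-1 * (bracket k * (B * (bracket k ^+ 3)^-1)).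
  rewrite -mulrA normrM ger0_norm ?invr_ge0// ler_wpM2l ?invr_ge0// normrM.
  by rewrite ler_pM// ?da// ger0_norm ?lap2_le// lap2_ge0.
have h4 : (bracket k ^+ 3)^-1 * bracket k = (bracket k ^+ 2)^-1 :> R.
  by rewrite exprSr invfM -mulrA mulVf ?mulr1// gt_eqF.
apply: (le_trans (ler_normB _ _)).
apply: (@le_trans _ _ (8 * N * ((bracket k ^+ 3)^-1 * bracket k) + B * ((bracket k ^+ 3)^-1 * bracket k))).
  apply: lerD.
    apply: (le_trans h1); have b2 : 0 <= 2 * bracket k :> R by rewrite mulr_ge0// ltW.
    apply: (le_trans (ler_wpM2l b2 h2)); rewrite le_eqVlt; apply/orP; left; apply/eqP.
    by move: (bracket k) N => b n; ring.
  apply: (le_trans h3).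
  have half (p q r : R) : 0 <= p -> 0 <= q -> 0 <= r -> 2^-1 * (p * (q * r)) <= q * (r * p).
    move=> p0 q0 r0; rewrite [leRHS]mulrA [leRHS]mulrC; rewrite -[leRHS]mul1r.
    by rewrite ler_wpM2r ?invf_le1 ?ler1n// !mulr_ge0.
  by apply: half; rewrite ?invr_ge0 ?exprn_ge0// ltW.
by rewrite h4 -mulrDl.
Qed.

Let v_dt i t x : 0 < t < T -> is_derive t 1 (fun s => v i s x) (synth (L i t) x).
Proof.
move=> tT; apply: (synth_dt x (decay3_majorant B0) (majorant_decay2 M0) tT).
- exact: da.
- exact: dL.
- by move=> k th s sT; exact: (ns_ode ns).
Qed.

Let v_div t x : 0 < t < T -> \sum_j pd j (v j t) x = 0.
Proof.
move=> tT.
have cd j : continuous (pd j (v j t)).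
  by have [[_ _ _ c] _] := v1 j; exact: (jcont_slice (c j)).
have pd' j : periodic2 (pd j (v j t)).
  by rewrite (v1 j).2; apply: synth_period; exact: trig_dcoef.
apply: (coef_uniq (f := fun x => \sum_j pd j (v j t) x)).
- exact: continuous_bigsum.
- by move=> y; split; apply: eq_bigr => j _; case: (pd' j y).
move=> k th; rewrite coef_sum// -[RHS](ns_div ns k (th + pi / 2) tT).
by apply: eq_bigr => j _; rewrite (jC1_coef_pd _ _ _ _ (v1 j).1) /dcoef coefv.
Qed.

(** Both sides are continuous and periodic, so that it is enough to compare
    their coefficients. *)
Let v_eq i t x : 0 < t < T ->
  synth (L i t) x + \sum_j v j t x * pd j (v i t) x + pd i (synth (pressure_coef t)) x
  = \sum_j pd j (fun y => 2^-1 * (pd j (v i t) y + pd i (v j t) y)) x.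
Proof.
move=> tT.
have cd j l : continuous (pd l (v j t)).
  by have [[_ _ _ c] _] := v1 j; exact: (jcont_slice (c l)).
have j2 j l : jC1 (fun t => pd l (v j t)).
  by have [h _] := v2 j l; move: h; congr jC1; apply/funext => s; rewrite (v1 j).2.
have pdE j y : pd j (fun y => 2^-1 * (pd j (v i t) y + pd i (v j t) y)) y =
    2^-1 * (pd j (pd j (v i t)) y + pd j (pd i (v j t)) y).
  have [_ _ h1 _] := j2 i j; have [_ _ h2 _] := j2 j i.
  have e1 : derivable (pd j (v i t)) y (dir j) by exact: (h1 t).
  have e2 : derivable (pd i (v j t)) y (dir j) by exact: (h2 t).
  rewrite [LHS](_ : _ = 'D_(dir j) (2^-1 \*: (pd j (v i t) + pd i (v j t))) y)//.
  rewrite deriveZ; last exact: derivableD e1 e2.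
  by rewrite deriveD.
under [in RHS]eq_bigr do rewrite pdE.
apply: subr0_eq.
pose F1 := synth (L i t); pose F2 := fun y => \sum_j v j t y * pd j (v i t) y.
pose F3 := pd i (synth (pressure_coef t)).
pose F4 := fun y => \sum_j 2^-1 * (pd j (pd j (v i t)) y + pd j (pd i (v j t)) y).
rewrite -[LHS]/((fun y => F1 y + F2 y + F3 y - F4 y) x).
have cc (c : R) : continuous (fun _ : R * R => c) by move=> ?; exact: cst_continuous.
have c1 : continuous F1 := synth_continuous (majorant_decay2 M0) (tL i t) (dL i t).
have c2j j : continuous (fun y => v j t y * pd j (v i t) y) by exact: mul_continuous.
have c2 : continuous F2 by exact: continuous_bigsum.
have c3 : continuous F3 by have [[_ _ _ c] _] := q1; exact: (jcont_slice (c i)).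
have c5 j l m : continuous (pd j (pd l (v m t))).
  by have [_ _ _ c] := j2 m l; exact: (jcont_slice (c j)).
have c4j j : continuous (fun y => 2^-1 * (pd j (pd j (v i t)) y + pd j (pd i (v j t)) y)).
  by apply: mul_continuous => //; exact: add_continuous.
have c4 : continuous F4 by exact: continuous_bigsum.
have p1 : periodic2 F1 by exact: synth_period.
have pvv j : periodic2 (v j t) by exact: synth_period.
have pv2 l m : periodic2 (pd l (v m t)).
  by rewrite (v1 m).2; apply: synth_period; exact: trig_dcoef.
have pv3 j l m : periodic2 (pd j (pd l (v m t))).
  by rewrite (v1 m).2 (v2 m l).2; apply: synth_period; do 2 apply: trig_dcoef.
have p2 : periodic2 F2.
  move=> y; split; apply: eq_bigr => j _; case: (pvv j y) => e1 e2;
    case: (pv2 j i y) => e3 e4; [by rewrite e1 e3|by rewrite e2 e4].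
have p3 : periodic2 F3.
  by rewrite /F3 q1.2; apply: synth_period; apply: trig_dcoef; exact: pressure_trig.
have p4 : periodic2 F4.
  move=> y; split; apply: eq_bigr => j _; case: (pv3 j j i y) => e1 e2;
    case: (pv3 j i j y) => e3 e4; [by rewrite e1 e3|by rewrite e2 e4].
apply: (coef_uniq (f := fun y => F1 y + F2 y + F3 y - F4 y)).
- by apply: sub_continuous => //; apply: add_continuous => //; exact: add_continuous.
- move=> y; case: (p1 y) => -> ->; case: (p2 y) => -> ->; case: (p3 y) => -> ->.
  by case: (p4 y) => -> ->.
move=> k th; rewrite coefB//; last by apply: add_continuous => //; exact: add_continuous.
rewrite coefD//; last exact: add_continuous.
rewrite coefD//.
have K1 : coef F1 k th = L i t k th.
  exact: (coef_synth _ _ (majorant_decay2 M0) (tL i t) (dL i t)).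
have K2 : coef F2 k th = \sum_j dcoef j (coef (flux i j t)) k th.
  have e : F2 =1 (fun y => \sum_j pd j (flux i j t) y).
    move=> y; have [_ E] := all_and2 (fun j => jC1_mul (v1 j).1 (v1 i).1).
    rewrite /F2 /flux; under [RHS]eq_bigr do rewrite E.
    by rewrite big_split /= -mulr_sumr v_div// mulr0 addr0.
  rewrite (eq_coef _ _ e) coef_sum; last first.
    by move=> j; have [_ _ _ c] := jflux i j; exact: (jcont_slice (c j)).
  by apply: eq_bigr => j _; rewrite (jC1_coef_pd _ _ _ _ (jflux i j)).
have K3 : coef F3 k th = dcoef i (pressure_coef t) k th.
  rewrite /F3 (jC1_coef_pd _ _ _ _ q1.1) /dcoef.
  by rewrite (coef_synth _ _ (decay3_majorant N40) (pressure_trig t) (pressure_dom t)).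
have K4 : coef F4 k th = - (2^-1 * (lap2 k * a i t k th)).
  rewrite coef_sum//.
  have E2 j l m : coef (pd j (pd l (v m t))) k th = - (freq k j * (freq k l * a m t k th)).
    have h := jC1_coef_pd j t k th (j2 m l).
    have h' := jC1_coef_pd l t k (th + pi / 2) (v1 m).1.
    rewrite h /dcoef h' /dcoef coefv (_ : th + pi / 2 + pi / 2 = th + pi); last by field.
    by rewrite (trig_addpi _ _ (ta m t)) !mulrN.
  have e j : coef (fun y => 2^-1 * (pd j (pd j (v i t)) y + pd j (pd i (v j t)) y)) k th =
      - (2^-1 * (freq k j ^+ 2 * a i t k th)) - 2^-1 * freq k i * (freq k j * a j t k th).
    have h := coefD k th (c5 j j i) (c5 j i j).
    have c := add_continuous (c5 j j i) (c5 j i j).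
    rewrite (coefZ 2^-1 k th c) (etrans h (congr2 +%R (E2 j j i) (E2 j i j))).
    move: (a i t k th) (a j t k th) (freq k i : R) (freq k j : R) => x1 x2 y1 y2; ring.
  under eq_bigr do rewrite e.
  rewrite sumrB -mulr_sumr (ns_div ns k th tT) mulr0 subr0 sumrN -mulr_sumr -mulr_suml.
  by rewrite sum2.
rewrite K1 K2 K3 K4 LE.
by move: (\sum_j _) (dcoef _ _ _ _) (2^-1 * _) => x1 x2 x3; ring.
Qed.

Definition velocity t x : 'cV[R]_2 := \col_i v i t x.

Lemma entry_velocity i k t : entry (velocity t) i k = v i t.
Proof. by apply/funext => x; rewrite /entry mxE. Qed.

Lemma Dsym_velocity t i j : entry (Dsym (velocity t)) i j =
  fun y => 2^-1 * (pd j (v i t) y + pd i (v j t) y).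
Proof.
apply/funext => y; rewrite /entry /Dsym /symm !mxE.
by rewrite !entry_velocity.
Qed.

Theorem velocity_navier_stokes : navier_stokes T velocity.
Proof.
split; [|split].
- move=> i k; rewrite (_ : (fun t => _) = v i); last by apply/funext => t; exact: entry_velocity.
  split; first exact: jC1_space (v1 i).1.
  move=> j; apply: jC1_space; have [h _] := v2 i j; move: h; congr jC1.
  by apply/funext => s; rewrite (v1 i).2.
- move=> t x i k tT; have [] := v_dt i x tT.
  by rewrite (_ : (fun r => velocity r x i k) = (fun s => v i s x))//; apply/funext => r; rewrite mxE.
exists (fun t => synth (pressure_coef t)); split; first exact: jC1_space q1.1.
move=> t x tT; split; last first.
  rewrite -[RHS](v_div x tT); apply: eq_bigr => j _.
  by rewrite entry_velocity.
apply/colP => i; rewrite !mxE.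
rewrite [X in X + _ + _ = _](_ : _ = synth (L i t) x); last first.
  rewrite (_ : (fun r => velocity r x i ord0) = (fun s => v i s x)); last first.
    by apply/funext => r; rewrite mxE.
  by have d := v_dt i x tT; rewrite derive1E derive_val.
rewrite [X in _ + X + _ = _](_ : _ = \sum_j v j t x * pd j (v i t) x); last first.
  rewrite /advect summxE; apply: eq_bigr => j _.
  by rewrite !mxE entry_velocity.
rewrite v_eq//; apply: eq_bigr => j _.
by rewrite Dsym_velocity.
Qed.

End NavierStokesModes.

(** * Convergence in the Sobolev norms of the statement *)

Section SobolevFields.
Context {R : realType}.
Local Notation Z2 := (int * int)%type.

Lemma sobolev_sq_term s f k :
  ((bracket k ^+ s * fourier_sq f k)%:E <= @sobolev_sq R s f)%E.
Proof.
case E : (sobolev_sq s f) => [c| |]; rewrite ?leey//.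
  by rewrite lee_fin; apply: sobolev_le_term; apply/sobolev_leP; rewrite E.
by have := sobolev_sq_ge0 s f; rewrite E.
Qed.

Lemma sobolev_sq_mono s s' (f : R * R -> R) : (s' <= s)%N ->
  (sobolev_sq s' f <= sobolev_sq s f)%E.
Proof.
move=> ss; case E : (sobolev_sq s f) => [c| |]; rewrite ?leey//.
  apply/sobolev_leP; apply: (sobolev_le_mono ss); apply/sobolev_leP; by rewrite E.
by have := sobolev_sq_ge0 s f; rewrite E.
Qed.

(** The factor [e] is kept apart from [f] because the dissipation controls [f],
    the stress remainder divided by the parameter. *)
Lemma sobolev_sq_perturb s f g (e d : R) : continuous f -> continuous g -> 0 < e ->
  sobolev_le s g d ->
  (sobolev_sq s (fun x => e * f x + g x)%R <= (2 * e ^+ 2)%:E * sobolev_sq s f + (2 * d)%:E)%E.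
Proof.
move=> cf cg e0 hg; have := sobolev_sq_ge0 s f.
have e2 : 0 < 2 * e ^+ 2 by rewrite mulr_gt0// exprn_gt0.
case E : (sobolev_sq s f) => [c| |] // _; last by rewrite gt0_muley ?lte_fin// addye// leey.
rewrite -EFinM -EFinD; apply/sobolev_leP; rewrite -mulrA.
apply: sobolev_leD => //.
  by apply: mul_continuous => // x; exact: cst_continuous.
by apply: sobolev_leZ => //; apply/sobolev_leP; rewrite E.
Qed.

Lemma strain_sobolev (w : 'I_2 -> R * R -> R) (c : R) i j : 0 <= c -> (forall i, periodic2 (w i)) ->
  (forall i, continuous (w i)) -> (forall i x j, derivable (w i) x (dir j)) ->
  (forall i j, continuous (pd j (w i))) -> (forall i : 'I_2, sobolev_le 5 (w i) c) ->
  sobolev_le 2 (fun x => 2^-1 * (pd j (w i) x + pd i (w j) x)) c.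
Proof.
move=> c0 pw cw dw cdw h.
have hp l m : sobolev_le 2 (pd l (w m)) c.
  apply: (@sobolev_le_mono _ 4) => //.
  exact: (sobolev_le_pd (pw m) (cw m) (fun x => dw m x l) (cdw m l) (h m)).
have := sobolev_leZ (2^-1) (add_continuous (cdw i j) (cdw j i))
  (sobolev_leD (cdw i j) (cdw j i) (hp j i) (hp i j)).
by rewrite (_ : 2^-1 ^+ 2 * (2 * c + 2 * c) = c); last by field.
Qed.

Section Matrices.
Variables (m n : nat).
Implicit Types A : R * R -> 'M[R]_(m, n).

Lemma sobolevM_sq_ge0 s A : (0 <= sobolevM_sq s A)%E.
Proof. by apply: sume_ge0 => i _; apply: sume_ge0 => k _; exact: sobolev_sq_ge0. Qed.

Lemma sobolev_gradM_sq_ge0 s A : (0 <= sobolev_gradM_sq s A)%E.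
Proof. by apply: sume_ge0 => j _; exact: sobolevM_sq_ge0. Qed.

Lemma sobolev_sq_entry s A i k : (sobolev_sq s (entry A i k) <= sobolevM_sq s A)%E.
Proof.
rewrite /sobolevM_sq (bigD1 i)//= (bigD1 k)//=.
apply: (@le_trans _ _ (sobolev_sq s (entry A i k) +
  \sum_(k' < n | k' != k) sobolev_sq s (entry A i k'))%E).
  by rewrite leeDl//; apply: sume_ge0 => k' _; exact: sobolev_sq_ge0.
rewrite leeDl//; apply: sume_ge0 => i' _; apply: sume_ge0 => k' _.
exact: sobolev_sq_ge0.
Qed.

Lemma sobolevM_sq_le s A (c : R) : (forall i k, sobolev_le s (entry A i k) c) ->
  (sobolevM_sq s A <= ((m * n)%:R * c)%:E)%E.
Proof.
move=> h.
have -> : ((m * n)%:R * c)%:E = (\sum_(i < m) \sum_(k < n) c%:E)%E.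
  rewrite (eq_bigr (fun=> (n%:R * c)%:E)) => [|i _].
    by rewrite sumEFin sumr_const card_ord natrM -mulrA [in LHS]mulr_natl.
  by rewrite sumEFin sumr_const card_ord mulr_natl.
by apply: lee_sum => i _; apply: lee_sum => k _; exact/sobolev_leP.
Qed.

Lemma sobolevM_sq_mono s s' A : (s' <= s)%N -> (sobolevM_sq s' A <= sobolevM_sq s A)%E.
Proof. by move=> ss; apply: lee_sum => i _; apply: lee_sum => k _; exact: sobolev_sq_mono. Qed.

End Matrices.

Lemma sobolev_le_in s f (c : R) : continuous f -> periodic2 f -> sobolev_le s f c ->
  in_sobolev s f.
Proof.
move=> cf pf h; split=> //.
- exact: continuous_measurable2.
- by apply: continuous_cell_integrable; apply: mul_continuous.
- by apply: (@le_lt_trans _ _ c%:E); [exact/sobolev_leP|rewrite ltry].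
Qed.

Lemma cvge0P (T : Type) (F : set_system T) {FF : Filter F} (f : T -> \bar R) :
  (forall t, 0 <= f t)%E ->
  (forall eta : R, 0 < eta -> \forall t \near F, (f t <= eta%:E)%E) -> f @ F --> 0%E.
Proof.
move=> f0 h; apply/fine_cvgP; split.
  apply: filterS (h 1 ltr01) => t ft; rewrite ge0_fin_numE//.
  by apply: le_lt_trans ft _; rewrite ltry.
apply/cvgrPdist_le => eta eta0; apply: filterS (h _ eta0) => t ft /=.
have tfin : f t \is a fin_num by rewrite ge0_fin_numE// (le_lt_trans ft)// ltry.
by rewrite sub0r normrN ger0_norm ?fine_ge0// -lee_fin fineK.
Qed.

(** A uniform bound in [H^6] turns uniformly small Fourier coefficients into a
    small [H^5] norm, so only the coefficients need to be controlled. *)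
Lemma sobolev5_small (c eta : R) : 0 <= c -> 0 < eta -> exists2 d : R, 0 < d &
  forall f, continuous f -> sobolev_le 6 f c ->
    (forall k th, coef f k th ^+ 2 <= d) -> sobolev_le 5 f eta.
Proof.
move=> c0 eta0; pose N := 1 + 2 * c / eta.
have N1 : 1 <= N by rewrite lerDl divr_ge0 ?mulr_ge0// ltW.
have N0 : 0 < N by rewrite (lt_le_trans ltr01).
have [q q0 qE] : exists2 q : R, 0 < q & q = 128 * N ^+ 7.
  by eexists; last reflexivity; rewrite mulr_gt0 ?ltr0n// exprn_gt0.
exists (eta / 2 / q); first by rewrite !divr_gt0.
move=> f cf h6 hd.
have d0 : 0 <= eta / 2 / q by rewrite ltW// !divr_gt0.
have := sobolev_interp cf N1 d0 hd h6; rewrite -qE mulrC divfK ?gt_eqF//.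
have cN : c / N <= eta / 2.
  rewrite ler_pdivrMr// /N (_ : eta / 2 * (1 + 2 * c / eta) = eta / 2 + c).
    by rewrite lerDr divr_ge0// ltW.
  by field; rewrite gt_eqF.
move=> h S uS; apply: le_trans (h S uS) _.
by move: cN; move: (c / N) => z; lra.
Qed.

(** By compactness of the cell, the Fourier coefficients are continuous in time
    uniformly in the frequency. *)
Lemma jcont_sobolev5 F (c eta t : R) : 0 <= c -> 0 < eta -> jcont F ->
  (forall t, sobolev_le 6 (F t) c) ->
  \forall r \near t, sobolev_le 5 (fun x => F r x - F t x) eta.
Proof.
move=> c0 eta0 cF h6.
have c4 : 0 <= 2 * c + 2 * c by rewrite addr_ge0// mulr_ge0.
have [d d0 H] := sobolev5_small c4 eta0.
have p0 : 0 < (2 * pi) ^+ 2 :> R by rewrite exprn_gt0// twopi_gt0.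
have e0 : 0 < Num.sqrt d / (2 * pi) ^+ 2 by rewrite divr_gt0// sqrtr_gt0.
have cs r : continuous (F r) by exact: jcont_slice.
apply: filterS (near_cell_uniform t cF e0) => r hr.
have cB : continuous (fun x => F r x - F t x) by exact: sub_continuous.
apply: H => //; first exact: sobolev_leB.
move=> k th; have hc : `|coef (fun x => F r x - F t x) k th| <=
    Num.sqrt d / (2 * pi) ^+ 2 * (2 * pi) ^+ 2.
  by apply: coef_norm_le => // x cx; apply: ltW; exact: hr.
move: hc; rewrite divfK ?gt_eqF// => hc.
rewrite -(sqr_sqrtr (ltW d0)) -[leLHS]real_normK ?num_real//.
by rewrite ler_sqr ?nnegrE ?sqrtr_ge0.
Qed.

Lemma in_C_sobolev5 (T : R) (A : R -> R * R -> 'cV[R]_2) (F : 'I_2 -> R -> R * R -> R) c :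
  0 <= c ->
  (forall i k t, 0 <= t <= T -> entry (A t) i k = F i t) -> (forall i, jcont (F i)) ->
  (forall i t, periodic2 (F i t)) -> (forall i t, sobolev_le 6 (F i t) c) ->
  in_C_sobolev T 5 A.
Proof.
move=> c0 AF cF pF h6; split.
  move=> t tT i k; rewrite AF//; apply: sobolev_le_in => //.
  - exact: jcont_slice (cF i).
  - exact: sobolev_le_mono (h6 i t).
move=> t tT; apply: cvge0P => [r|eta eta0]; first exact: sobolevM_sq_ge0.
have eta2 : 0 < eta / 2 by rewrite divr_gt0.
rewrite near_withinE.
have n i := @jcont_sobolev5 (F i) c (eta / 2) t c0 eta2 (cF i) (h6 i).
apply: filterS2 (n ord0) (n ord_max) => r h0 h1 rT.
have rT' : 0 <= r <= T by move: rT; rewrite /= in_itv.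
rewrite (_ : eta = (2 * 1)%:R * (eta / 2)); last by rewrite mulrC divfK.
apply: sobolevM_sq_le => i k.
rewrite (_ : entry _ i k = fun x => F i r x - F i t x); last first.
  apply/funext => x; rewrite /entry !mxE -!/(entry _ i k x) !AF//.
have : i = ord0 \/ i = ord_max.
  case: i => [[|[|?]] ?] //; [left|right]; exact: val_inj.
by case=> ->.
Qed.

(** Monotonicity for possibly non-measurable functions: the integral of a
    nonnegative function is a supremum over the simple functions below it. *)
Lemma integral_le_nonneg d (X : measurableType d) (mu : {measure set X -> \bar R})
    (D E : set X) (f g : X -> \bar R) : D `<=` E ->
  (forall x, D x -> 0 <= f x <= g x)%E -> (forall x, E x -> 0 <= g x)%E ->
  (\int[mu]_(x in D) f x <= \int[mu]_(x in E) g x)%E.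
Proof.
move=> DE fg g0.
rewrite ge0_integralE; last by move=> x /fg/andP[].
rewrite ge0_integralE//; apply: ereal_sup_le => _ [h hf <-]; exists h => // x.
apply: le_trans (hf x) _; rewrite /patch.
case: ifPn => [/set_mem xD|_].
  by rewrite mem_set; [have /andP[] := fg x xD|exact: DE].
by case: ifPn => // /set_mem; exact: g0.
Qed.

Lemma integral_cst_itv (c T : R) : 0 <= T ->
  (\int[lebesgue_measure]_(t in `[0%R, T]) c%:E = (c * T)%:E)%E.
Proof.
move=> T0; have L := lebesgue_measure_itv0 T0.
have := @integral_cst _ _ R (@lebesgue_measure R) `[0, T]%classic.
by move=> /(_ (measurable_itv _) c%:E) E; rewrite EFinM -L; exact: E.
Qed.

End SobolevFields.

(** * The viscoelastic solutions as a family of flows *)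

Section OneSolution.
Context {R : realType}.
Local Notation Z2 := (int * int)%type.

(** Solutions restricted to [[0, T]] and frozen outside, in components. *)
Definition clampV (T : R) (u : R -> R * R -> 'cV[R]_2) i t x : R :=
  u (clamp T t) x i ord0.

Definition clampM (T : R) (tau : R -> R * R -> 'M[R]_2) i j t x : R :=
  tau (clamp T t) x i j.

Variables (b eps S T C : R) (uin : R * R -> 'cV[R]_2) (tauin : R * R -> 'M[R]_2)
  (u : R -> R * R -> 'cV[R]_2) (tau : R -> R * R -> 'M[R]_2).
Hypotheses (eps_gt0 : 0 < eps) (T_gt0 : 0 < T) (TS : T <= S)
  (sol : classical_solution b eps S uin tauin u tau)
  (bnd : uniform_bound eps S C u tau).

Let U := clampV T u.
Let Ta := clampM T tau.

Let T0S : 0 <= T <= S. Proof. by rewrite ltW. Qed.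

Lemma clampV_jC1 i : jC1 (U i).
Proof.
have [su _] := sol; exact: (clamp_jC1 T0S (su i ord0)).
Qed.

Lemma clampM_jC1 i j : jC1 (Ta i j).
Proof.
have [_ [st _]] := sol; have [h _] := st i j; exact: (clamp_jC1 T0S h).
Qed.

Lemma solution_flow : exists P, flow T U Ta P.
Proof.
have [_ [_ [du [_ [_ [p [sp eqs]]]]]]] := sol.
exists (fun t => p (clamp T t)).
have tc t : 0 < t < T -> clamp T t = t.
  by move=> /andP[t0 tT]; rewrite clamp_id// !ltW.
have tS t : 0 < t < T -> 0 < t < S.
  by move=> /andP[-> tT]; exact: lt_le_trans tT TS.
have Eu t i : 0 < t < T -> U i t = entry (u t) i ord0.
  by move=> tT; apply/funext => x; rewrite /U /clampV tc.
have Et t i j : 0 < t < T -> Ta i j t = entry (tau t) i j.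
  by move=> tT; apply/funext => x; rewrite /Ta /clampM tc.
split.
- exact: clampV_jC1.
- exact: clampM_jC1.
- exact: clamp_jC1 T0S sp.
- move=> t x tT; have [_ _ h] := eqs t x (tS t tT).
  by rewrite -[RHS]h; apply: eq_bigr => j _; rewrite Eu.
move=> i t x tT.
apply: (is_derive_eq_near (g := fun s => u s x i ord0) tT).
  by move=> s sT; rewrite /U /clampV tc.
have d := du t x i ord0 (tS t tT); rewrite tc//.
have [h _ _] := eqs t x (tS t tT).
have := congr1 (fun M : 'cV[R]_2 => M i ord0) h; rewrite !mxE.
rewrite [X in _ + X + _](_ : _ = \sum_j U j t x * pd j (U i t) x); last first.
  by rewrite /advect summxE; apply: eq_bigr => j _; rewrite !mxE !Eu.
rewrite [RHS](_ : _ = \sum_j pd j (Ta i j t) x); last first.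
  by apply: eq_bigr => j _; rewrite Et.
move=> <-; rewrite derive1E.
apply: DeriveDef => //; rewrite addrAC addrK.
by move: ('D_1 _ t) => z; ring.
Qed.

Let clampI t : 0 <= clamp T t <= S.
Proof. by have /andP[-> h] := clamp_itv t (ltW T_gt0); exact: le_trans h TS. Qed.

Lemma energy_le t : 0 <= t <= S -> (energy_sq eps (u t) (tau t) <= C%:E)%E.
Proof.
move=> tS; apply: le_trans (ltW bnd); apply: (@le_trans _ _
  (ereal_sup [set energy_sq eps (u t) (tau t) | t in `[0%R, S]])).
  by apply: ereal_sup_ubound; exists t => //=; rewrite in_itv.
rewrite leeDl//; apply: integral_ge0 => s _.
by rewrite !adde_ge0// ?sobolevM_sq_ge0// sobolev_gradM_sq_ge0.
Qed.

Lemma dissipation_le :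
  (\int[lebesgue_measure]_(t in `[0%R, S]) dissipation_sq eps (u t) (tau t) <= C%:E)%E.
Proof.
apply: le_trans (ltW bnd); rewrite leeDr//.
have S0 : 0 <= S by case/andP: T0S; exact: le_trans.
apply: (@le_trans _ _ (energy_sq eps (u 0) (tau 0))).
  by rewrite !adde_ge0// ?sobolevM_sq_ge0// sobolev_gradM_sq_ge0.
by apply: ereal_sup_ubound; exists 0 => //=; rewrite in_itv /= lexx.
Qed.

Lemma velocity_H6 i t : sobolev_le 6 (U i t) C.
Proof.
apply/sobolev_leP; apply: le_trans (energy_le (clampI t)).
apply: le_trans (sobolev_sq_entry 6 (u (clamp T t)) i ord0) _.
rewrite /energy_sq -!addeA leeDl//.
by rewrite !adde_ge0// ?sobolevM_sq_ge0// sobolev_gradM_sq_ge0.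
Qed.

Lemma stress_H6 i j t : sobolev_le 6 (Ta i j t) (eps^-1 ^+ 2 * C).
Proof.
have ct : continuous (Ta i j t).
  by have [_ c _ _] := clampM_jC1 i j; exact: jcont_slice.
have h : sobolev_le 6 (fun x => eps * Ta i j t x) C.
  apply/sobolev_leP; apply: le_trans (energy_le (clampI t)).
  have := sobolev_sq_entry 6 (fun x => eps *: tau (clamp T t) x) i j.
  rewrite (_ : entry _ i j = fun x => eps * Ta i j t x); last first.
    by apply/funext => x; rewrite /entry mxE.
  move=> /le_trans; apply; rewrite /energy_sq -!addeA addeCA leeDl//.
  by rewrite !adde_ge0// ?sobolevM_sq_ge0// sobolev_gradM_sq_ge0.
have -> : Ta i j t = fun x => eps^-1 * (eps * Ta i j t x).
  by apply/funext => x; rewrite mulrA mulVf ?mul1r// gt_eqF.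
apply: sobolev_leZ h; apply: mul_continuous => // x; exact: cst_continuous.
Qed.

(** The quantity whose [H^2] norm enters the dissipation. *)
Definition rate i j t x := eps^-1 * remainder U Ta i j t x.

Let rem_jcont i j : jcont (remainder U Ta i j).
Proof. by apply: remainder_jcont; [exact: clampV_jC1|exact: clampM_jC1]. Qed.

Let rate_jcont i j : jcont (rate i j).
Proof. by apply: jcont_cst; exact: rem_jcont. Qed.

(** The part of the dissipation that measures the distance of the stress to the
    strain rate. *)
Definition excess t : \bar R := (\sum_i \sum_j sobolev_sq 2 (rate i j t))%E.

Lemma excess_ge0 t : (0 <= excess t)%E.
Proof. by apply: sume_ge0 => i _; apply: sume_ge0 => j _; exact: sobolev_sq_ge0. Qed.

Lemma excess_measurable : measurable_fun (`[0, T]%classic : set (measurableTypeR R)) excess.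
Proof.
apply: emeasurable_sum => i; apply: emeasurable_sum => j.
apply: sobolev_sq_measurable => //.
- by move=> t; exact: jcont_slice.
- move=> k th; apply: measurable_funTS; apply: continuous_measurable_fun.
  exact: coef_continuous.
Qed.

Lemma integral_excess_le :
  (\int[lebesgue_measure]_(t in `[0%R, T]) excess t <= C%:E)%E.
Proof.
apply: le_trans dissipation_le; apply: integral_le_nonneg.
- by move=> t /=; rewrite !in_itv /= => /andP[-> h]; exact: le_trans h TS.
- move=> t; rewrite /= in_itv /= => tT; rewrite excess_ge0 /=.
  rewrite /dissipation_sq addeA.
  rewrite (_ : excess t = sobolevM_sq 2 (fun x => eps^-1 *: (tau t x - Dsym (u t) x))%R).
    by rewrite leeDr// adde_ge0// ?sobolevM_sq_ge0// sobolev_gradM_sq_ge0.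
  apply: eq_bigr => i _; apply: eq_bigr => j _; congr sobolev_sq.
  apply/funext => x; rewrite /rate /remainder /entry /Dsym /symm !mxE.
  by rewrite /U /Ta /clampV /clampM clamp_id.
- by move=> t _; rewrite !adde_ge0// ?sobolevM_sq_ge0// sobolev_gradM_sq_ge0.
Qed.

Lemma remainder_sq_le i j t k th :
  ((coef (remainder U Ta i j t) k th ^+ 2)%:E <=
    ((2 * pi) ^+ 2 * eps ^+ 2)%:E * sobolev_sq 2 (rate i j t))%E.
Proof.
have cr : continuous (rate i j t) by exact: jcont_slice.
have e : coef (remainder U Ta i j t) k th = eps * coef (rate i j t) k th.
  rewrite -coefZ//; apply: eq_coef => x.
  by rewrite /rate mulrA mulfV ?mul1r// gt_eqF.
rewrite e exprMn.
have c0 : 0 <= (2 * pi) ^+ 2 * eps ^+ 2 by rewrite mulr_ge0// sqr_ge0.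
apply: (@le_trans _ _ (((2 * pi) ^+ 2 * eps ^+ 2)%:E *
    (bracket k ^+ 2 * fourier_sq (rate i j t) k)%:E)%E); last first.
  by apply: lee_wpmul2l; [rewrite lee_fin|exact: sobolev_sq_term].
rewrite -EFinM lee_fin [leRHS]mulrAC [leRHS]mulrC ler_wpM2l ?sqr_ge0//.
apply: (le_trans (coef_sq_le k th cr)); rewrite ler_wpM2l ?sqr_ge0//.
by rewrite ler_peMl ?fourier_sq_ge0// exprn_ege1// bracket_ge1.
Qed.

Lemma remainder_primitive_le k th :
  primitive (fun t => \sum_i \sum_j coef (remainder U Ta i j t) k th ^+ 2) T
    <= (2 * pi) ^+ 2 * C * eps ^+ 2.
Proof.
pose c := (2 * pi) ^+ 2 * eps ^+ 2.
have c0 : 0 <= c by rewrite mulr_ge0// sqr_ge0.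
have cc i j : continuous (fun t => coef (remainder U Ta i j t) k th ^+ 2).
  by apply: mul_continuous; apply: coef_continuous; exact: rem_jcont.
apply: primitive_leE.
  by apply: continuous_bigsum => i; exact: continuous_bigsum.
apply: (@le_trans _ _ (\int[lebesgue_measure]_(t in `[0%R, T]) (c%:E * excess t))%E).
  apply: integral_le_nonneg => // [t _|t _]; last first.
    by rewrite mule_ge0// ?lee_fin// excess_ge0.
  rewrite lee_fin sumr_ge0 => [|i _]; last by rewrite sumr_ge0// => j _; rewrite sqr_ge0.
  rewrite /= /excess ge0_sume_distrr => [|i _]; last first.
    by apply: sume_ge0 => j _; exact: sobolev_sq_ge0.
  rewrite -sumEFin; apply: lee_sum => i _.
  rewrite ge0_sume_distrr => [|j _]; last exact: sobolev_sq_ge0.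
  by rewrite -sumEFin; apply: lee_sum => j _; exact: remainder_sq_le.
rewrite ge0_integralZl_EFin//; last 2 first.
- by move=> t _; exact: excess_ge0.
- exact: excess_measurable.
have h := @lee_wpmul2l _ c%:E _ _ _ integral_excess_le.
rewrite (_ : _ * C * _ = c * C); last by rewrite /c mulrAC.
by rewrite EFinM; apply: h; rewrite lee_fin.
Qed.

(** The stress differs from the limiting strain rate by [eps * rate], whose
    [L^2(0,T;H^2)] norm is controlled by the dissipation, and by the strain rate
    of the difference of the velocities. *)
Lemma strain_distance_le (w : R -> R * R -> 'cV[R]_2) (F : 'I_2 -> R -> R * R -> R)
    (eta : R) : 0 <= eta -> (forall i, jC1 (F i)) ->
  (forall i k t, entry (w t) i k = F i t) ->
  (forall i t, sobolev_le 5 (fun x => U i t x - F i t x) eta) ->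
  (L2_sobolev_dist_sq T 2 tau (fun t => Dsym (w t)) <=
    (2 * eps ^+ 2 * C + 4 * (2 * eta) * T)%:E)%E.
Proof.
move=> eta0 jF wF close.
pose z i j t x := 2^-1 * (pd j (fun y => U i t y - F i t y) x +
  pd i (fun y => U j t y - F j t y) x).
have cU i t : continuous (U i t).
  by have [_ c _ _] := clampV_jC1 i; exact: (jcont_slice c).
have cF i t : continuous (F i t) by have [_ c _ _] := jF i; exact: (jcont_slice c).
have dB i j t x : is_derive x (dir j) (fun y => U i t y - F i t y)
    (pd j (U i t) x - pd j (F i t) x).
  have [_ _ d _] := clampV_jC1 i; have [_ _ d' _] := jF i.
  have d1 : derivable (U i t) x (dir j) by exact: d.
  have d2 : derivable (F i t) x (dir j) by exact: d'.
  exact: (is_deriveB (derivableP d1) (derivableP d2)).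
have pdB i j t : pd j (fun y => U i t y - F i t y) = fun x => pd j (U i t) x - pd j (F i t) x.
  by apply/funext => x; have d := dB i j t x; rewrite /pd derive_val.
have cpd i j t : continuous (pd j (fun y => U i t y - F i t y)).
  rewrite pdB; have [_ _ _ d] := clampV_jC1 i; have [_ _ _ d'] := jF i.
  exact: (sub_continuous (jcont_slice (t := t) (d j)) (jcont_slice (t := t) (d' j))).
have hz i j t : sobolev_le 2 (z i j t) eta.
  apply: (strain_sobolev (w := fun i x => U i t x - F i t x) _ _ eta0) => m.
  - have [pU _ _ _] := clampV_jC1 m; have [pF _ _ _] := jF m.
    by move=> x; have [e1 e2] := pU t x; have [e3 e4] := pF t x;
      split; [rewrite e1 e3|rewrite e2 e4].
  - exact: sub_continuous.
  - by move=> x j'; have [] := dB m j' t x.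
  - by move=> l; exact: cpd.
  - exact: close.
have cz i j t : continuous (z i j t).
  by apply: mul_continuous; [move=> x; exact: cst_continuous|exact: add_continuous].
have pt t : 0 <= t <= T ->
    (sobolevM_sq 2 (fun x => tau t x - Dsym (w t) x)%R <=
      (2 * eps ^+ 2)%:E * excess t + (4 * (2 * eta))%:E)%E.
  move=> tT.
  have -> : (4 * (2 * eta))%:E = (\sum_(i < 2) \sum_(j < 2) (2 * eta)%:E)%E.
    by rewrite !sumEFin !sum2; congr EFin; ring.
  rewrite ge0_sume_distrr => [|i _]; last first.
    by apply: sume_ge0 => j _; exact: sobolev_sq_ge0.
  rewrite -big_split; apply: lee_sum => i _.
  rewrite ge0_sume_distrr => [|j _]; last exact: sobolev_sq_ge0.
  rewrite -big_split; apply: lee_sum => j _.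
  have -> : entry (fun x => tau t x - Dsym (w t) x) i j = fun x => eps * rate i j t x + z i j t x.
    apply/funext => x; rewrite /entry /Dsym /symm !mxE !wF /rate mulrA mulfV ?gt_eqF// mul1r.
    rewrite /remainder /z !pdB /Ta /clampM clamp_id//.
    move: (pd j (U i t) x) (pd i (U j t) x) (pd j (F i t) x) (pd i (F j t) x) => *; ring.
  apply: sobolev_sq_perturb => //; exact: jcont_slice.
have e2 : 0 <= 2 * eps ^+ 2 by rewrite mulr_ge0// sqr_ge0.
have eT : 0 <= 4 * (2 * eta) by rewrite !mulr_ge0.
apply: (@le_trans _ _ (\int[lebesgue_measure]_(t in `[0%R, T])
  ((2 * eps ^+ 2)%:E * excess t + (4 * (2 * eta))%:E))%E).
  apply: integral_le_nonneg => // [t|t _]; last first.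
    by rewrite adde_ge0// ?lee_fin// mule_ge0// ?lee_fin// excess_ge0.
  by rewrite /= in_itv /= => tT; rewrite sobolevM_sq_ge0 pt.
have mx := excess_measurable.
rewrite ge0_integralD//; last 2 first.
- by move=> t _; rewrite mule_ge0// ?lee_fin// excess_ge0.
- exact: measurable_funeM.
rewrite integral_cst_itv; last exact: ltW.
rewrite ge0_integralZl_EFin//; last by move=> t _; exact: excess_ge0.
rewrite EFinD; apply: leeD => //.
have h := @lee_wpmul2l _ (2 * eps ^+ 2)%:E _ _ _ integral_excess_le.
by rewrite EFinM; apply: h; rewrite lee_fin.
Qed.

Lemma velocity_in_C : 0 <= C -> in_C_sobolev T 5 u.
Proof.
move=> C0; apply: (in_C_sobolev5 (F := U) C0).
- move=> i k t tT; rewrite (ord1 k); apply/funext => x.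
  by rewrite /U /clampV clamp_id.
- by move=> i; case: (clampV_jC1 i).
- by move=> i t; case: (clampV_jC1 i).
- exact: velocity_H6.
Qed.

Lemma stress_in_L2 : in_L2_sobolev T 2 tau.
Proof.
have [_ [st _]] := sol.
split.
- move=> i j; apply: continuous_measurable3; first exact: measurable_itv.
  have [[_ c _ _] _] := st i j; apply: continuous_subspaceW c.
  move=> z [z1 z2]; split=> //; move: z1; rewrite /= !in_itv /= => /andP[-> h].
  exact: le_trans h TS.
- apply: aeW => t tT i j; have [pT cT _ _] := clampM_jC1 i j.
  have E : entry (tau t) i j = Ta i j t.
    by apply/funext => x; rewrite /Ta /clampM clamp_id.
  rewrite E; apply: (@sobolev_le_in _ _ _ (eps^-1 ^+ 2 * C)) => //.
    exact: jcont_slice.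
  exact: sobolev_le_mono (stress_H6 i j t).
apply: (@le_lt_trans _ _ C%:E); last by rewrite ltry.
apply: le_trans dissipation_le; apply: integral_le_nonneg.
- by move=> t /=; rewrite !in_itv /= => /andP[-> h]; exact: le_trans h TS.
- move=> t _; rewrite sobolevM_sq_ge0 /=.
  apply: (@le_trans _ _ (sobolevM_sq 6 (tau t))); first exact: sobolevM_sq_mono.
  by rewrite leeDl// adde_ge0// ?sobolevM_sq_ge0// sobolev_gradM_sq_ge0.
- by move=> t _; rewrite !adde_ge0// ?sobolevM_sq_ge0// sobolev_gradM_sq_ge0.
Qed.

End OneSolution.

(** * The limit velocity *)

Section LimitVelocity.
Context {R : realType}.
Local Notation Z2 := (int * int)%type.
Variables (T e0 C C1 : R) (U : R -> 'I_2 -> R -> R * R -> R)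
  (Ta : R -> 'I_2 -> 'I_2 -> R -> R * R -> R) (P : R -> R -> R * R -> R).
Hypothesis ff : flow_family T e0 C C1 U Ta P.
Variables (K : R) (a : 'I_2 -> R -> Z2 -> R -> R).
Hypothesis K0 : 0 <= K.
Hypothesis close : forall e i t k th, 0 < e < e0 ->
  `|coef (U e i t) k th - a i t k th| <= K * e.

Let ns := limit_ns_modes ff K0 close.
Let v i t := synth (a i t).
Let C0 := ff_C ff.

Let jU e i : 0 < e < e0 -> jC1 (U e i). Proof. by move=> /(ff_flow ff)[]. Qed.
Let cU e i t : 0 < e < e0 -> continuous (U e i t).
Proof. by move=> /(jU i)[_ ? _ _]; exact: jcont_slice. Qed.

Let jv i : jC1 (v i) := (jC1_velocity ns i).1.

Let cv i t : continuous (v i t).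
Proof. by have [_ c _ _] := jv i; exact: jcont_slice. Qed.

Let pv i t : periodic2 (v i t).
Proof. by case: (jv i). Qed.

Let coefv i t k th : coef (v i t) k th = a i t k th.
Proof. exact: (coef_synth _ _ (decay3_majorant (ns_B ns)) (ns_trig ns i t) (ns_dom ns i t)). Qed.

Lemma limit_H6 i t : sobolev_le 6 (v i t) C.
Proof.
apply: (@sobolev_le_lim _ 6 _ 0^'+ _ (fun e => U e i t)) => //.
  move=> k th; rewrite coefv.
  by apply: (cvg_of_rate ff K0) => e eI; exact: close.
by apply: filterS (small_right ff) => e eI; split; [exact: cU|exact: (ff_H6 ff)].
Qed.

(** The coefficients converge uniformly in the mode and in time, at the rate
    [K * e], which [sobolev5_small] turns into convergence in [H^5]. *)
Lemma velocity_close (eta : R) : 0 < eta ->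
  \forall e \near 0^'+, 0 < e < e0 /\
    forall i t, sobolev_le 5 (fun x => U e i t x - v i t x) eta.
Proof.
move=> eta0.
have c4 : 0 <= 2 * C + 2 * C by rewrite addr_ge0// mulr_ge0.
have [d d0 H] := sobolev5_small c4 eta0.
have K1 : 0 < K + 1 by rewrite ltr_wpDl.
have sd : 0 < Num.sqrt d / (K + 1) by rewrite divr_gt0// sqrtr_gt0.
have n2 : \forall e \near 0^'+, e < Num.sqrt d / (K + 1) by exact: nbhs_right_lt.
apply: filterS2 (small_right ff) n2 => e eI ed; split=> // i t.
have [e_gt0 _] := andP eI.
apply: H.
- by apply: sub_continuous; [exact: cU|exact: cv].
- by apply: sobolev_leB; [exact: cU|exact: cv|exact: (ff_H6 ff)|exact: limit_H6].
move=> k th; rewrite coefB; [|exact: cU|exact: cv].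
rewrite coefv -(sqr_sqrtr (ltW d0)) -[leLHS]real_normK ?num_real//.
rewrite ler_sqr ?nnegrE ?sqrtr_ge0//; apply: le_trans (close i t k th eI) _.
rewrite ltr_pdivlMr// mulrC in ed; apply: le_trans (ltW ed).
by rewrite ler_wpM2r ?(ltW e_gt0)// lerDl.
Qed.

Lemma velocity_in_Linfty : in_Linfty_sobolev T 6 (velocity a).
Proof.
split.
  move=> i k; apply: continuous_measurable3; first exact: measurable_itv.
  rewrite (_ : (fun z => _) = (fun z => v i z.1 z.2)); last first.
    by apply/funext => z; rewrite mxE.
  by apply: continuous_subspaceT; case: (jv i).
exists ((2 * 1)%:R * C); apply: aeW => t _; split.
  move=> i k; rewrite entry_velocity; apply: (@sobolev_le_in _ _ _ C) => //.
  - exact: cv.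
  - exact: pv.
  - exact: limit_H6.
by apply: sobolevM_sq_le => i k; rewrite entry_velocity; exact: limit_H6.
Qed.

Lemma velocity_in_C5 : in_C_sobolev T 5 (velocity a).
Proof.
apply: (in_C_sobolev5 (F := v) C0).
- by move=> i k t _; rewrite entry_velocity.
- by move=> i; case: (jv i).
- by move=> i; case: (jv i).
- exact: limit_H6.
Qed.

Let Dv i j t x := 2^-1 * (pd j (v i t) x + pd i (v j t) x).

Let jDv i j : jcont (Dv i j).
Proof.
have [_ _ _ d] := jv i; have [_ _ _ d'] := jv j.
by apply: jcont_cst; exact: jcont_add.
Qed.

Let pDv i j t : periodic2 (Dv i j t).
Proof.
have p l m : periodic2 (pd l (v m t)).
  rewrite (_ : pd l _ = synth (dcoef l (a m t))).
    by apply: synth_period; apply: trig_dcoef; exact: ns_trig ns m t.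
  by have [_ E] := jC1_velocity ns m; exact: E.
by move=> x; rewrite /Dv !(p _ _ x).1 !(p _ _ x).2.
Qed.

Lemma strain_in_L2 : in_L2_sobolev T 2 (fun t => Dsym (velocity a t)).
Proof.
have E t i j : entry (Dsym (velocity a t)) i j = Dv i j t := Dsym_velocity a t i j.
have h i j t : sobolev_le 2 (Dv i j t) C.
  apply: (strain_sobolev (w := fun i => v i t) _ _ C0) => m.
  - by case: (jv m).
  - exact: cv.
  - by case: (jv m).
  - by move=> l; have [_ _ _ c] := jv m; exact: (jcont_slice (c l)).
  - exact: sobolev_le_mono (limit_H6 m t).
split.
- move=> i j; apply: continuous_measurable3; first exact: measurable_itv.
  rewrite (_ : (fun z => _) = (fun z => Dv i j z.1 z.2)); last first.
    by apply/funext => z; rewrite -E.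
  by apply: continuous_subspaceT; exact: jDv.
- apply: aeW => t _ i j; rewrite E.
  exact: (sobolev_le_in (jcont_slice (t := t) (jDv (i := i) (j := j)))
    (pDv i j t) (h i j t)).
apply: (@le_lt_trans _ _ (((2 * 2)%:R * C * T)%:E)); last by rewrite ltry.
rewrite -integral_cst_itv; last exact: ltW (ff_T ff).
apply: integral_le_nonneg => // [t _|t _].
  rewrite sobolevM_sq_ge0 /=; apply: sobolevM_sq_le => i j; rewrite E; exact: h.
by rewrite lee_fin mulr_ge0.
Qed.

End LimitVelocity.

(** * The limit of vanishing relaxation parameter *)

(** The lifespan [e `^ (- (2 / 3))] exceeds [T] as soon as [e] is below
    [T `^ (- (3 / 2))]. *)
Lemma time_scale (R : realType) (T e0 : R) : 0 < T -> 0 < e0 ->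
  exists2 e1, 0 < e1 <= e0 & forall e, 0 < e < e1 -> T <= e `^ (- (2 / 3)).
Proof.
move=> T0 e00; pose d := T `^ (- (3 / 2)).
have d0 : 0 < d by exact: powR_gt0.
exists (Num.min e0 d); first by rewrite lt_min e00 d0 ge_min lexx.
move=> e; rewrite lt_min => /andP[e_gt0 /andP[_ ed]].
have p0 : 0 < e `^ (2 / 3) by exact: powR_gt0.
have h : e `^ (2 / 3) < d `^ (2 / 3).
  by apply: gt0_ltr_powR => //; rewrite ?nnegrE ltW.
have E : d `^ (2 / 3) = T^-1.
  by rewrite /d -powRrM (_ : - (3 / 2) * (2 / 3) = - 1) ?powRN ?powRr1 ?ltW//; field.
rewrite powRN -[leLHS]invrK lef_pV2 ?posrE ?invr_gt0//.
by rewrite -E ltW.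
Qed.

Section Convergence.
Variables (R : realType) (b : R) (uin : R * R -> 'cV[R]_2) (tauin : R * R -> 'M[R]_2)
  (eps0 C : R) (u : R -> R -> R * R -> 'cV[R]_2) (tau : R -> R -> R * R -> 'M[R]_2).
Hypotheses (C_ge0 : 0 <= C)
  (sol : forall eps, 0 < eps < eps0 ->
    classical_solution b eps (eps `^ (- (2 / 3))) uin tauin (u eps) (tau eps))
  (bnd : forall eps, 0 < eps < eps0 ->
    uniform_bound eps (eps `^ (- (2 / 3))) C (u eps) (tau eps)).
Variables (T e1 : R).
Hypotheses (T_gt0 : 0 < T) (e1_bnd : 0 < e1 <= eps0)
  (long : forall e, 0 < e < e1 -> T <= e `^ (- (2 / 3))).

Let U e := clampV T (u e).
Let Ta e := clampM T (tau e).

Let smaller e : 0 < e < e1 -> 0 < e < eps0.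
Proof. by case/andP: e1_bnd => _ h /andP[-> /lt_le_trans]; apply. Qed.

(** The pressures are chosen one by one, the solutions being given only for small
    parameters. *)
Lemma solutions_flow_family : exists P,
  flow_family T e1 C ((2 * pi) ^+ 2 * C) U Ta P.
Proof.
have [P HP] : exists P, forall e, 0 < e < e1 -> flow T (U e) (Ta e) (P e).
  suff /choice[P HP] : forall e, exists p, 0 < e < e1 -> flow T (U e) (Ta e) p.
    by exists P.
  move=> e; have [eI|eI] := pselect (0 < e < e1).
    have [p hp] := solution_flow T_gt0 (long eI) (sol (smaller eI)).
    by exists p.
  by exists (fun _ _ => 0) => /eI.
have [e1_gt0 _] := andP e1_bnd.
exists P; split=> //.
- by rewrite mulr_ge0// sqr_ge0.
- move=> e e' i eI e'I; apply/funext => x; rewrite /U /clampV clamp_id ?lexx ?ltW//.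
  have [_ [_ [_ [_ [h _]]]]] := sol (smaller eI).
  have [_ [_ [_ [_ [h' _]]]]] := sol (smaller e'I).
  by have [-> _] := h x; have [-> _] := h' x.
- move=> e i t; rewrite /U /clampV; apply/funext => x.
  by rewrite (clamp_id (clamp_itv t (ltW T_gt0))).
- move=> e i t eI; exact: (velocity_H6 T_gt0 (long eI) (bnd (smaller eI))).
- move=> e k th eI; have [e_gt0 _] := andP eI.
  exact: (remainder_primitive_le e_gt0 T_gt0 (long eI) (sol (smaller eI)) (bnd (smaller eI))).
Qed.

Lemma solutions_converge : exists v : R -> R * R -> 'cV[R]_2,
  in_Linfty_sobolev T 6 v /\
  (in_C_sobolev T 5 v /\ C_sobolev_dist_sq T 5 (u eps) v @[eps --> 0^'+] --> 0%E) /\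
  (in_L2_sobolev T 2 (fun t => Dsym (v t)) /\
   L2_sobolev_dist_sq T 2 (tau eps) (fun t => Dsym (v t)) @[eps --> 0^'+] --> 0%E) /\
  navier_stokes T v.
Proof.
have [P ff] := solutions_flow_family.
have [K [a [K0 close]]] := modes_limit ff.
exists (velocity a); split; first exact: (velocity_in_Linfty ff K0 close).
have pos : \forall e \near (0 : R)^'+, 0 < e by exact: nbhs_right_gt.
split; [split|split; [split|]].
- exact: (velocity_in_C5 ff K0 close).
- apply: cvge0P => [e|eta eta0].
    apply: le_ereal_sup_tmp; exists (sobolevM_sq 5 (fun x => u e 0 x - velocity a 0 x)).
      by exists 0 => //=; rewrite in_itv /= lexx ltW.
    exact: sobolevM_sq_ge0.
  have eta2 : 0 < eta / 2 by rewrite divr_gt0.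
  apply: filterS (velocity_close ff K0 close eta2) => e [eI h].
  apply: ge_ereal_sup => _ [t tT <-]; have {}tT : 0 <= t <= T by move: tT; rewrite /= in_itv.
  rewrite (_ : eta = (2 * 1)%:R * (eta / 2)); last by rewrite mulrC divfK.
  apply: sobolevM_sq_le => i k.
  rewrite (_ : entry _ i k = fun x => U e i t x - synth (a i t) x)//.
  apply/funext => x; rewrite /entry !mxE /U /clampV clamp_id//.
  by rewrite (ord1 k).
- exact: (strain_in_L2 ff K0 close).
- apply: cvge0P => [e|eta eta0].
    by apply: integral_ge0 => t _; exact: sobolevM_sq_ge0.
  have q0 : 0 < 2 * (8 * T + 1) by rewrite mulr_gt0// ltr_wpDl// mulr_ge0// ltW.
  have eta2 : 0 < eta / (2 * (8 * T + 1)) by rewrite divr_gt0.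
  have small : \forall e \near (0 : R)^'+, e < Num.sqrt (eta / (4 * C + 1)).
    by apply: nbhs_right_lt; rewrite sqrtr_gt0 divr_gt0// ltr_wpDl// mulr_ge0.
  apply: filterS2 small (velocity_close ff K0 close eta2) => e es [eI h].
  have [e_gt0 _] := andP eI; have eI' := smaller eI.
  have ns := limit_ns_modes ff K0 close.
  have jv i : jC1 (fun t => synth (a i t)).
    have B0 := ns_B ns.
    have [j _] := jC1_velocity ns i; exact: j.
  apply: le_trans (strain_distance_le e_gt0 T_gt0 (long eI) (sol eI') (bnd eI')
    (ltW eta2) jv (entry_velocity a) h) _.
  rewrite lee_fin.
  (* The two terms of [strain_distance_le]; the choices of [small] and [eta2] make
     each of them at most half of [eta]. *)
  have h1 : 2 * e ^+ 2 * C <= eta / 2.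
    have : e ^+ 2 <= eta / (4 * C + 1).
      rewrite -[leRHS]sqr_sqrtr; last by rewrite divr_ge0 ?addr_ge0 ?mulr_ge0// ltW.
      by rewrite ler_sqr ?nnegrE ?sqrtr_ge0 ?ltW.
    have c1 : 0 < 4 * C + 1 by rewrite ltr_wpDl// mulr_ge0.
    rewrite ler_pdivlMr//; move: (e ^+ 2) (sqr_ge0 e) C_ge0 => x x0 c0; nra.
  have h2 : 4 * (2 * (eta / (2 * (8 * T + 1)))) * T <= eta / 2.
    rewrite (_ : 4 * _ * T = eta / 2 * (8 * T / (8 * T + 1))); last first.
      by field; rewrite gt_eqF// ltr_wpDl// mulr_ge0// ltW.
    rewrite -[leRHS]mulr1; apply: ler_wpM2l; first by rewrite divr_ge0// ltW.
    by rewrite ler_pdivrMr ?mul1r ?lerDl// ltr_wpDl// mulr_ge0// ltW.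
  by move: h1 h2; move: (_ * C) (_ * T) => x y; lra.
- exact: (velocity_navier_stokes (limit_ns_modes ff K0 close)).
Qed.

End Convergence.

Theorem theorem3 (R : realType) (b : R)
  (uin : R * R -> 'cV[R]_2) (tauin : R * R -> 'M[R]_2)
  (uinH6 : in_sobolevM 6 uin) (tauinH6 : in_sobolevM 6 tauin)
  (uin_div : forall x, vdiv uin x = 0)
  (uin_mean : forall i, \int[area]_(x in cell) uin x i ord0 = 0)
  (eps0 C : R) (eps0_bnd : 0 < eps0 < 1) (C_gt0 : 0 < C)
  (u : R -> R -> R * R -> 'cV[R]_2) (tau : R -> R -> R * R -> 'M[R]_2)
  (u_tau_solution : forall eps, 0 < eps < eps0 ->
     classical_solution b eps (eps `^ (- (2 / 3))) uin tauin (u eps) (tau eps))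
  (u_tau_unique : forall eps, 0 < eps < eps0 -> forall u' tau',
     classical_solution b eps (eps `^ (- (2 / 3))) uin tauin u' tau' ->
     forall t x, 0 <= t <= eps `^ (- (2 / 3)) ->
     u' t x = u eps t x /\ tau' t x = tau eps t x)
  (u_tau_bound : forall eps, 0 < eps < eps0 ->
     uniform_bound eps (eps `^ (- (2 / 3))) C (u eps) (tau eps)) :
  forall T : R, 0 < T ->
  exists2 epsT : R, 0 < epsT <= eps0 &
    (forall eps, 0 < eps < epsT ->
       [/\ T <= eps `^ (- (2 / 3)),
           in_C_sobolev T 5 (u eps) & in_L2_sobolev T 2 (tau eps)]) /\
    exists v : R -> R * R -> 'cV[R]_2,
      in_Linfty_sobolev T 6 v /\
      (in_C_sobolev T 5 v /\
       C_sobolev_dist_sq T 5 (u eps) v @[eps --> 0^'+] --> 0%E) /\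
      (in_L2_sobolev T 2 (fun t => Dsym (v t)) /\
       L2_sobolev_dist_sq T 2 (tau eps) (fun t => Dsym (v t))
         @[eps --> 0^'+] --> 0%E) /\
      navier_stokes T v.
Proof.
move=> T T0; have [e00 _] := andP eps0_bnd.
have [e1 e1b long] := time_scale T0 e00; exists e1 => //.
have [_ e10] := andP e1b.
split; last exact: (solutions_converge (ltW C_gt0) u_tau_solution u_tau_bound T0 e1b long).
move=> eps eI; have [eps_gt0 ee] := andP eI.
have eI0 : 0 < eps < eps0 by rewrite eps_gt0 (lt_le_trans ee).
have TS := long eps eI; have s := u_tau_solution eps eI0; have d := u_tau_bound eps eI0.
split=> //.
- exact: (velocity_in_C T0 TS s d (ltW C_gt0)).
- exact: (stress_in_L2 eps_gt0 T0 TS s d).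
Qed.
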